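(* Let $\mathcal{E}$ be a finite dimensional Hilbert space and let $R = VW^*$ where $V$ and $W$ are two bi-inner rational functions in $H^\infty(\mathcal{E},\mathcal{E})$. Let $\{A_v \text{ on } \mathcal{X}_v, B_v, C_v, D_v\}$ and $\{A_w \text{ on } \mathcal{X}_w, B_w, C_w, D_w\}$ be stable dissipative realizations of $V$ and $W$, respectively. Let $\Omega:\mathcal{X}_w\to\mathcal{X}_v$ be the unique solution of the Lyapunov equation $$A_v\Omega + \Omega A_w^* + B_vB_w^* = 0.$$ Let $C_\circ:\mathcal{X}_w\to\mathcal{E}$ be the operator $C_\circ = D_vB_w^* + C_v\Omega$. Finally, let $Q$ on $\mathcal{X}_w$ be the unique solution of the Lyapunov equation $$A_wQ + QA_w^* + C_\circ^*C_\circ = 0.$$ Then the following holds. (1) The operator $Q$ is a positive contraction. (2) The multiplicity of $1$ as an eigenvalue of $Q$ equals $\mathfrak{n}(T_R)$; in other words, $\mathfrak{n}(T_R) = \mathfrak{n}(I-Q)$. Moreover, with $\zeta(s) = \frac{1-s}{1+s}$, for every integer $k\ge 0$, $$\mathfrak{n}(T_{\zeta^kR}) = \dim\ker\big(I - \zeta(-A_w)^kQ\,\zeta(-A_w)^{*k}\big).$$ (3) For $k = 1,2,\ldots$ define the integers $$\mu_k = \mathfrak{n}\big(I - \zeta(-A_w)^{k-1}Q\,(\zeta(-A_w)^* )^{k-1}\big) - \mathfrak{n}\big(I - \zeta(-A_w)^kQ\,\zeta(-A_w)^{*k}\big).$$ Then the negative Wiener-Hopf indices $-\kappa_1,\ldots,-\kappa_p$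 of $R$, ordered so that $\kappa_1\ge\kappa_2\ge\cdots\ge\kappa_p$, are given by $$\kappa_j = \#\{k : \mu_k\ge j\}\qquad (j = 1,\ldots,p = \mu_1).$$
   Context: All spaces are complex. $\mathbb{C}_+$ and $\mathbb{C}_-$ are the open right and left half planes. $H^\infty(\mathcal{E},\mathcal{E})$ is the space of bounded analytic functions on $\mathbb{C}_+$ with values in the operators on $\mathcal{E}$. A function $\Theta\in H^\infty(\mathcal{E},\mathcal{E})$ is bi-inner if $\Theta(i\omega)$ is a unitary operator on $\mathcal{E}$ for almost all $\omega\in\mathbb{R}$. For a rational $W$, $W^*(s) = (W(-\bar s))^*$, so that $W^*(i\omega) = W(i\omega)^*$ for $\omega\in\mathbb{R}$. Realizations: $\{A \text{ on } \mathcal{X},B,C,D\}$ is a realization of $\Theta$ if $\Theta(s) = D + C(sI-A)^{-1}B$; all state spaces $\mathcal{X}$ are finite dimensional Hilbert spaces. An operator $A$ is stable if all its eigenvalues lie in $\mathbb{C}_-$. The realization is stable dissipative if $A$ is stable, $A+A^*+C^*C=0$, $D$ is unitary and $B=-C^*D$ (equivalently: $A$ is stable, $A+A^*+BB^*=0$, $D$ is unitary and $C=-DB^*$). Wiener-Hopf operator: $L^2_+(\mathcal{E})$ is the space of square integrable functions $[0,\infty)\to\mathcal{E}$. For a rational operator-valued function $R$ taking unitary values on $i\mathbb{R}$, write $R(i\omega) = R(\infty) + \int_{-\infty}^\infty e^{-i\omega t}r(t)\,dt$ with $r$ integrable on $\mathbb{R}$; then $T_R$ is the operator on $L^2_+(\mathcal{E})$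 given by $(T_Rf)(t) = R(\infty)f(t) + \int_0^\infty r(t-\tau)f(\tau)\,d\tau$. $\mathfrak{n}(T)$ denotes the dimension of the kernel of $T$. Wiener-Hopf indices: let $m=\dim\mathcal{E}$ and identify operators on $\mathcal{E}$ with $m\times m$ matrices. A (right) Wiener-Hopf factorization of $R$ with respect to the imaginary axis is $R(s) = W_-(s)\,\mathrm{diag}\big((\tfrac{1-s}{1+s})^{\lambda_j}\big)_{j=1}^m\,W_+(s)$ with integers $\lambda_j$, where $W_-$ and $W_-^{-1}$ are analytic on the closed left half plane including infinity, and $W_+$ and $W_+^{-1}$ are analytic on the closed right half plane including infinity. The integers $\lambda_j$ are uniquely determined by $R$ (up to order) and are called the Wiener-Hopf indices of $R$ (also of $T_R$); the negative ones, listed with multiplicity, are written $-\kappa_1,\ldots,-\kappa_p$. ''Positive'' means positive semidefinite and ''contraction'' means norm at most $1$. $\zeta(-A_w) = (I+A_w)(I-A_w)^{-1}$, and $\zeta(-A_w)^{*k}$ is the $k$-th power of the adjoint of $\zeta(-A_w)$. $\#E$ is the number of elements of $E$. *)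

(* Defs.v *)
From HB Require Import structures.
From mathcomp Require Import all_boot all_order all_algebra.
From mathcomp Require Import spectral.
From mathcomp Require Import complex.
From mathcomp Require Import all_classical all_reals all_analysis.

Set Implicit Arguments.
Unset Strict Implicit.
Unset Printing Implicit Defensive.

Import Order.TTheory GRing.Theory Num.Theory.
Import numFieldNormedType.Exports.

Local Open Scope classical_set_scope.
Local Open Scope complex_scope.
Local Open Scope sesquilinear_scope.
Local Open Scope ring_scope.

(* The Hilbert spaces E, X_v, X_w are C^m, C^nv, C^nw (column vectors) with the
   standard inner product <x, y> = y^t* *m x, so that operators are matrices
   and the adjoint is ^t*.  A rational operator-valued function is a total
   function C -> 'M_m; only its values away from finitely many points (its
   poles, and possibly removable singularities) are meaningful. *)

Section Functions.
Variables (R : realType) (m : nat).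
Local Notation C := R[i].
Implicit Types (F G : C -> 'M[C]_m) (s : C).

Definition rational_mx F : Prop :=
  exists (N : 'M[{poly C}]_m) (q : {poly C}), q != 0 /\
    forall s, q.[s] != 0 -> F s = (q.[s])^-1 *: map_mx (fun p => p.[s]) N.

(* C^o is C as a normed space over itself: this is complex differentiability. *)
Definition holo_at F s : Prop :=
  forall i j, \forall z \near (s : C^o),
    derivable ((fun u => F u i j) : C^o -> C^o) z 1.

Definition lim_infty F (D : 'M[C]_m) : Prop :=
  forall i j, ((F z^-1 i j : C^o) @[z --> (0 : C^o)^']) --> (D i j : C^o).

Definition holo_at_infty F : Prop :=
  exists D : 'M[C]_m, holo_at (fun z => if z == 0 then D else F z^-1) 0.

Definition Hinfty F : Prop :=
  (forall s, 0 < complex.Re s -> holo_at F s) /\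
  (exists M : C, forall s, 0 < complex.Re s -> forall i j, `|F s i j| <= M).

Definition bi_inner F : Prop :=
  Hinfty F /\
  {ae (@lebesgue_measure R), forall w : R, F (0 +i* w) \is unitarymx}.

(* W^*(s) = (W(- conj s))^* *)
Definition para_adj F : C -> 'M[C]_m := fun s => (F (- s^*))^t*.

Definition zeta s : C := (1 - s) / (1 + s).

(* A is invertible on [set s | H s] together with infinity, and both it and its
   inverse are analytic there.  invmx is the identity on singular matrices,
   hence the explicit unitmx condition. *)
Definition holo_unit_on (H : C -> Prop) F : Prop :=
  [/\ forall s, H s -> F s \in unitmx,
      (forall s, H s -> holo_at F s) /\ holo_at_infty F
    & (forall s, H s -> holo_at (fun z => invmx (F z)) s)
      /\ holo_at_infty (fun z => invmx (F z))].

(* lam lists (in some order) the Wiener-Hopf indices of the rational function F.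
   The factorization is an identity of rational functions, so it is required
   off a finite set. *)
Definition WH_indices F (lam : 'I_m -> int) : Prop :=
  exists Wm Wp : C -> 'M[C]_m,
    [/\ rational_mx Wm /\ rational_mx Wp,
        holo_unit_on (fun s => complex.Re s <= 0) Wm,
        holo_unit_on (fun s => 0 <= complex.Re s) Wp
      & finite_set [set s | F s <>
          Wm s *m diag_mx (\row_j (zeta s ^ lam j)) *m Wp s]].

(* kappa_1 >= ... >= kappa_p, where -kappa_j are the negative entries of lam *)
Definition kappas (lam : 'I_m -> int) : seq nat :=
  sort geq [seq `|lam j|%N | j <- enum 'I_m & lam j < 0].

End Functions.

Section Realizations.
Variable R : realType.
Local Notation C := R[i].

Definition stable n (A : 'M[C]_n) : Prop :=
  forall a : C, eigenvalue A a -> complex.Re a < 0.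

Definition realization m n (A : 'M[C]_n) (B : 'M[C]_(n, m)) (K : 'M[C]_(m, n))
    (D : 'M[C]_m) (F : C -> 'M[C]_m) : Prop :=
  forall s : C, ~~ eigenvalue A s -> F s = D + K *m invmx (s%:M - A) *m B.

Definition stable_dissipative_realization m n (A : 'M[C]_n) (B : 'M[C]_(n, m))
    (K : 'M[C]_(m, n)) (D : 'M[C]_m) (F : C -> 'M[C]_m) : Prop :=
  [/\ realization A B K D F,
      stable A,
      A + A^t* + K^t* *m K = 0,
      D \is unitarymx
    & B = - (K^t* *m D)].

(* zeta(-A) *)
Definition zeta_opp n (A : 'M[C]_n) : 'M[C]_n :=
  (1%:M + A) *m invmx (1%:M - A).

(* dim {x | M x = 0}; kermx is the row kernel, hence the transpose *)
Definition nullity n (M : 'M[C]_n) : nat := \rank (kermx M^T).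

Definition positive_op n (Q : 'M[C]_n) : Prop :=
  forall x : 'cV[C]_n, 0 <= (x^t* *m Q *m x) 0 0.

(* |Q x|^2 <= |x|^2 *)
Definition contraction_op n (Q : 'M[C]_n) : Prop :=
  forall x : 'cV[C]_n, ((Q *m x)^t* *m (Q *m x)) 0 0 <= (x^t* *m x) 0 0.

(* dim ker (I - zeta(-A)^k Q zeta(-A)^{*k}) *)
Definition shifted_nullity n (A Q : 'M[C]_n) (k : nat) : nat :=
  nullity (1%:M - (zeta_opp A) ^+ k *m Q *m ((zeta_opp A)^t*) ^+ k).

(* mu_k, for k >= 1 *)
Definition mu_seq n (A Q : 'M[C]_n) (k : nat) : int :=
  (shifted_nullity A Q k.-1)%:Z - (shifted_nullity A Q k)%:Z.

End Realizations.

Section WienerHopf.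
Variables (R : realType) (m : nat).
Local Notation C := R[i].
Local Notation leb := (@lebesgue_measure R).
Local Notation half := (`[0, +oo[%classic : set R).

Definition Cintegrable (D : set R) (f : R -> C) : Prop :=
  leb.-integrable D (fun t => (complex.Re (f t))%:E) /\
  leb.-integrable D (fun t => (complex.Im (f t))%:E).

Definition Cintegral (D : set R) (f : R -> C) : C :=
  (Rintegral leb D (fun t => complex.Re (f t))) +i*
  (Rintegral leb D (fun t => complex.Im (f t))).

(* membership in L^2_+; only the values on [0, +oo[ matter *)
Definition L2plus (f : R -> 'cV[C]_m) : Prop :=
  forall i, [/\ measurable_fun half (fun t : R => complex.Re (f t i 0)),
                measurable_fun half (fun t : R => complex.Im (f t i 0))
              & leb.-integrable half
                  (fun t : R => (complex.Re (f t i 0) ^+ 2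
                                 + complex.Im (f t i 0) ^+ 2)%:E)].

(* equality in L^2_+ *)
Definition eq_plus (f g : R -> 'cV[C]_m) : Prop :=
  {ae leb, forall t : R, 0 <= t -> f t = g t}.

(* e^{-i w t} *)
Definition expNi (w t : R) : C := cos (w * t) +i* (- sin (w * t)).

(* F(i w) = D + int_R e^{-i w t} r(t) dt, with D = F(oo) and r integrable *)
Definition WH_kernel_fun (F : C -> 'M[C]_m) (D : 'M[C]_m) (r : R -> 'M[C]_m) :
    Prop :=
  [/\ lim_infty F D,
      forall i j, Cintegrable setT (fun t => r t i j)
    & forall (w : R) i j, F (0 +i* w) i j =
        D i j + Cintegral setT (fun t => expNi w t * r t i j)].

Definition WH_op (D : 'M[C]_m) (r : R -> 'M[C]_m) (f : R -> 'cV[C]_m) :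
    R -> 'cV[C]_m :=
  fun t => D *m f t +
    \col_i Cintegral half (fun tau => (r (t - tau) *m f tau) i 0).

Definition WH_ker (D : 'M[C]_m) (r : R -> 'M[C]_m) (f : R -> 'cV[C]_m) : Prop :=
  L2plus f /\ eq_plus (WH_op D r f) (fun=> 0).

(* dim ker T_F = d: the kernel has a basis of d elements (modulo a.e. equality).
   D is unique, and r is unique up to a null set. *)
Definition WH_nullity (F : C -> 'M[C]_m) (d : nat) : Prop :=
  exists (D : 'M[C]_m) (r : R -> 'M[C]_m), WH_kernel_fun F D r /\
  exists b : 'I_d -> R -> 'cV[C]_m,
    [/\ forall i, WH_ker D r (b i),
        forall c : 'I_d -> C,
          eq_plus (fun t => \sum_i c i *: b i t) (fun=> 0) ->
          forall i, c i = 0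
      & forall f, WH_ker D r f ->
          exists c : 'I_d -> C, eq_plus f (fun t => \sum_i c i *: b i t)].

End WienerHopf.

(* Main.v *)
Require Import Defs.
From HB Require Import structures.
From mathcomp Require Import all_boot all_order all_algebra.
From mathcomp Require Import perm fraction ring lra zify.
From mathcomp Require Import spectral.
From mathcomp Require Import complex.
From mathcomp Require Import all_classical all_reals all_analysis.
From mathcomp Require Import measurable_realfun.

Set Implicit Arguments.
Unset Strict Implicit.
Unset Printing Implicit Defensive.

Import Order.TTheory GRing.Theory Num.Theory.
Import numFieldNormedType.Exports.

Local Open Scope classical_set_scope.
Local Open Scope sesquilinear_scope.
Local Open Scope ring_scope.

(** Both Lyapunov equations together give 1 - Q = Omega^* Omega, so Q <= 1 and the
    eigenvectors of Q for the eigenvalue 1 form ker Omega.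

    The operator T_R acts through the states x' = A_v x + B_1 f, x(0) = 0, and
    y' = - A_w^* y - C_w^* f, y in L^2.  If T_R f = 0, then z = x + Omega y satisfies
    z' = - A_v^* z; as z grows at most linearly while e^(t A_v^* ) z(t) is constant,
    z = 0.  Eliminating x leaves f = C_w y, y' = A_w y and Omega y(0) = 0.  Hence
    ker T_R = { C_w e^(t A_w) y_0 : Omega y_0 = 0 }.

    Multiplying V by zeta adds a cascade section to its realization and changes Q to
    zeta(-A_w) Q zeta(-A_w)^*, which gives the statement for zeta^k R.

    For the indices, the rational vectors f, analytic on the closed right half plane
    and zero at infinity, for which R f is analytic on the closed left half plane and
    zero at infinity, are counted twice: they are the C_w (s - A_w)^-1 y_0 with
    Omega y_0 = 0, and through a Wiener-Hopf factorization they form a space of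
    dimension sum_j max(0, - lambda_j).  As zeta^k R has the indices lambda_j + k, the
    mu_k and kappa_j are conjugate partitions.  A factorization exists: among the bases
    F over the rational functions with F analytic on the right and
    R F diag(zeta^k_j) analytic on the left, one with maximal sum_j k_j has both
    functions invertible at every point, since a singular value at some point would
    allow one k_j to be increased. *)

(** * Values of rational functions on the Riemann sphere *)

(** The identity [1 - Q = Omega^* Omega] bounds [Q] only from above; [Q >= 0] comes from excluding
    negative eigenvalues, without an integral formula for [Q]. Contour integrals are replaced by one
    principle: the closed half planes overlap on the imaginary axis, both contain infinity, and a
    rational function regular on both and zero at infinity is 0. Uniqueness for Lyapunov equations,
    observability and the kernel over the rational functions are instances of it. Total functions
    carry arbitrary values at their poles, so they are tied to elements of the field only off
    finitely many points. Maximality in the factorization is meaningful because every [k_j] is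
    bounded by the size of a common denominator of the entries of [R]. On the operator side an [f]
    in L^2 is known only almost everywhere, so the equation [T_R f = 0] is first solved for [f],
    which gives a continuous representative on [t > 0]. The linear bound on [z] comes from
    [u v <= u^2 + v^2], integrated over an interval of length t. Passing to [zeta^k R] changes only
    [V], whose realization stays stable dissipative. *)

Lemma invmx_scalarB (F : fieldType) n (x : F) (M : 'M[F]_n) : x != 0 ->
  1%:M - x^-1 *: M \in unitmx -> invmx (x%:M - M) = x^-1 *: invmx (1%:M - x^-1 *: M).
Proof.
move=> x0 u; have -> : x%:M - M = x *: (1%:M - x^-1 *: M).
  by rewrite scalerBr scalerA divff // scale1r scale_scalar_mx mulr1.
by rewrite invmxZ // unitmxZ ?unitfE.
Qed.

(* [lia] identifies atoms syntactically, whereas [size p] occurs with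
   convertible but distinct types of coefficients. *)
Definition psize (R : nzSemiRingType) (p : {poly R}) := size p.
Ltac plia :=
  repeat match goal with
  | |- context [@size ?T (@polyseq ?R ?p)] =>
      match type of p with @polynomial ?R' =>
        change (@size T (@polyseq R p)) with (@psize R' p) end
  | H : context [@size ?T (@polyseq ?R ?p)] |- _ =>
      match type of p with @polynomial ?R' =>
        change (@size T (@polyseq R p)) with (@psize R' p) in H end
  end; lia.

(* The field of rational functions over [C], used abstractly: unification
   must never unfold the quotient construction of {fraction {poly C}}. *)
Record fracfield (C : closedFieldType) := Fracfield {
  ff_sort : fieldType;
  ff_io : {rmorphism {poly C} -> ff_sort};
  ff_inj : injective ff_io;
  ff_frac : forall x : ff_sort, exists p q, q != 0 /\ x = ff_io p / ff_io q }.

Section RationalFunctions.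
Variables (C : closedFieldType) (F : fracfield C).
Local Notation K := (ff_sort F).
Local Notation io := (ff_io F).
Local Notation io_inj := (@ff_inj C F).
Local Notation fracP := (@ff_frac C F).
Local Notation "p %:F" := (io p).
Implicit Types (a b : option C) (x y : K) (p q : {poly C}).

(* [None] is the point at infinity of the Riemann sphere. *)
Definition ev a x (v : C) : Prop :=
  exists p q, x = p%:F / q%:F /\
    match a with
    | Some s => q.[s] != 0 /\ v = p.[s] / q.[s]
    | None => [/\ q != 0, (size p <= size q)%N & v = p`_(size q).-1 / lead_coef q]
    end.

Definition reg a x : Prop := exists v, ev a x v.


Lemma ff_io_eq p q : (p%:F == q%:F) = (p == q).
Proof. exact: (inj_eq io_inj). Qed.

Lemma ff_io_eq0 p : (p%:F == 0) = (p == 0).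
Proof. by rewrite -(rmorph0 io) ff_io_eq. Qed.

Lemma fracE p q p' q' : q != 0 -> q' != 0 ->
  p%:F / q%:F = p'%:F / q'%:F -> p * q' = p' * q.
Proof.
move=> q0 q'0 /eqP; rewrite eqr_div ?ff_io_eq0 // -!rmorphM ff_io_eq => /eqP ->.
by [].
Qed.

Lemma frac_coprimeP x : exists p q, [/\ q != 0, coprimep p q & x = p%:F / q%:F].
Proof.
have [p [q [q0 ->]]] := fracP x.
have [p0|p0] := eqVneq p 0.
  exists 0, 1; rewrite oner_neq0 coprimep1 p0 rmorph0 !mul0r; split => //.
have g0 : gcdp p q != 0 by rewrite gcdp_eq0 negb_and p0.
exists (p %/ gcdp p q), (q %/ gcdp p q); split.
- by rewrite dvdp_div_eq0 ?dvdp_gcdr.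
- by rewrite coprimep_div_gcd ?p0.
- apply/eqP; rewrite eqr_div ?ff_io_eq0 ?dvdp_div_eq0 ?dvdp_gcdr // -!rmorphM ff_io_eq.
  apply/eqP; transitivity (p %/ gcdp p q * (q %/ gcdp p q * gcdp p q)).
    by rewrite mulrCA mulrC divpK ?dvdp_gcdl // mulrC.
  by rewrite divpK ?dvdp_gcdr.
Qed.


Let sz p : p != 0 -> (0 < size p)%N. Proof. by rewrite size_poly_gt0. Qed.

(** In the convolution every other term has an index beyond one of the two degree bounds. The
    degrees are those of the denominators, so the selected coefficients may vanish: this makes the
    value at infinity multiplicative even at zeros. *)
Lemma coefM_top (r s t u : {poly C}) :
  (size r <= size s)%N -> (size t <= size u)%N -> s != 0 -> u != 0 ->
  (r * t)`_((size s).-1 + (size u).-1) = r`_(size s).-1 * t`_(size u).-1.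
Proof.
move=> rs tu s0 u0; rewrite coefM (bigD1 (inord (size s).-1)) //=.
rewrite inordK ?ltnS ?leq_addr // addKn big1 ?addr0 // => i.
rewrite -val_eqE /= inordK ?ltnS ?leq_addr // => ni.
have [lt|ge] := ltnP i (size s).-1.
  rewrite [t`__]nth_default ?mulr0 // (leq_trans tu) //.
  by have := sz s0; have := sz u0; plia.
rewrite nth_default ?mul0r // (leq_trans rs) //.
by have := sz s0; plia.
Qed.

Lemma ev_uniq a x v w : ev a x v -> ev a x w -> v = w.
Proof.
move=> [p [q [-> H]]] [p' [q' [E H']]].
case: a H H' => [s|] [].
  move=> qs -> [q's ->]; apply/eqP; rewrite eqr_div // -!hornerM; apply/eqP; congr (_.[s]).
  by apply: fracE E; [apply: contraNneq qs|apply: contraNneq q's] => ->; rewrite horner0.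
move=> q0 sp -> [q'0 sp' ->].
have /(congr1 (fun p : {poly C} => p`_((size q).-1 + (size q').-1))) := fracE q0 q'0 E.
rewrite coefM_top // addnC coefM_top // => EE.
by apply/eqP; rewrite eqr_div ?lead_coef_eq0 //; apply/eqP.
Qed.

Lemma ev_const a c : ev a (c%:P)%:F c.
Proof.
exists c%:P, 1; split; first by rewrite rmorph1 divr1.
case: a => [s|]; first by rewrite !hornerC oner_neq0 divr1.
by rewrite oner_neq0 size_poly1 size_polyC_leq1 lead_coef1 divr1 coefC.
Qed.

Lemma ev0 a : ev a 0 0. Proof. by rewrite -(rmorph0 io) -polyC0; exact: ev_const. Qed.
Lemma ev1 a : ev a 1 1. Proof. by rewrite -(rmorph1 io) -polyC1; exact: ev_const. Qed.

Lemma evM a x y v w : ev a x v -> ev a y w -> ev a (x * y) (v * w).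
Proof.
move=> [p [q [-> H]]] [p' [q' [-> H']]]; exists (p * p'), (q * q').
split; first by rewrite !rmorphM mulf_div.
case: a H H' => [s|] [].
  by move=> qs -> [q's ->]; rewrite !hornerM mulf_neq0 // mulf_div.
move=> q0 sp -> [q'0 sp' ->]; split.
- by rewrite mulf_neq0.
- have [->|p0] := eqVneq p 0; first by rewrite mul0r size_poly0.
  have [->|p'0] := eqVneq p' 0; first by rewrite mulr0 size_poly0.
  by rewrite (size_mul p0 p'0) (size_mul q0 q'0); plia.
- rewrite lead_coefM mulf_div; congr (_ / _).
  rewrite size_mul //.
  have -> : ((size q + size q').-1.-1 = (size q).-1 + (size q').-1)%N.
    by have := sz q0; have := sz q'0; plia.
  by rewrite coefM_top.
Qed.

Lemma evD a x y v w : ev a x v -> ev a y w -> ev a (x + y) (v + w).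
Proof.
move=> [p [q [-> H]]] [p' [q' [-> H']]]; exists (p * q' + p' * q), (q * q').
have [q0 q'0] : q != 0 /\ q' != 0.
  case: a H H' => [s|] []; last by move=> ? ? _ [].
  by move=> qs _ [q's _]; split; [apply: contraNneq qs|apply: contraNneq q's] => ->;
    rewrite horner0.
split; first by rewrite rmorphD !rmorphM addf_div ?ff_io_eq0.
case: a H H' => [s|] [].
  move=> qs -> [q's ->]; rewrite hornerM hornerD !hornerM mulf_neq0 //.
  by rewrite addf_div.
move=> _ sp -> [_ sp' ->]; split.
- by rewrite mulf_neq0.
- rewrite (leq_trans (size_polyD _ _)) // geq_max (size_mul q0 q'0).
  by apply/andP; split; apply: leq_trans (size_polyMleq _ _) _;
    have := sz q0; have := sz q'0; plia.
- rewrite lead_coefM addf_div ?lead_coef_eq0 //; congr (_ / _).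
  rewrite size_mul //.
  have -> : ((size q + size q').-1.-1 = (size q).-1 + (size q').-1)%N.
    by have := sz q0; have := sz q'0; plia.
  by rewrite coefD coefM_top // addnC coefM_top.
Qed.

Lemma evN a x v : ev a x v -> ev a (- x) (- v).
Proof.
move=> /(evM (ev_const a (-1))); rewrite mulN1r polyCN polyC1 rmorphN rmorph1.
by rewrite mulN1r.
Qed.

Lemma evB a x y v w : ev a x v -> ev a y w -> ev a (x - y) (v - w).
Proof. by move=> xv /evN; exact: evD. Qed.

Lemma evV a x v : v != 0 -> ev a x v -> ev a x^-1 v^-1.
Proof.
move=> v0 [p [q [E H]]]; rewrite E invf_div.
case: a H => [s|] [].
  move=> qs vE; exists q, p; split=> //.
  split; last by rewrite vE invf_div.
  by apply: contraNneq v0 => p0; rewrite vE p0 mul0r.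
move=> q0 sp vE.
have pq0 : p`_(size q).-1 != 0 by apply: contraNneq v0 => p0; rewrite vE p0 mul0r.
have p0 : p != 0 by apply: contraNneq pq0 => ->; rewrite coef0.
have spq : size p = size q.
  apply/eqP; rewrite eqn_leq sp /= leqNgt; apply: contraNN pq0 => lt.
  by rewrite nth_default // -ltnS (leq_trans lt) // leqSpred.
exists q, p; split=> //; split=> //; first by rewrite spq.
by rewrite vE invf_div /lead_coef spq.
Qed.

Lemma ev_sum a (I : Type) (r : seq I) (P : pred I) (f : I -> K) (g : I -> C) :
  (forall i, P i -> ev a (f i) (g i)) -> ev a (\sum_(i <- r | P i) f i) (\sum_(i <- r | P i) g i).
Proof. by move=> H; elim/big_ind2: _ => // *; [exact: ev0|exact: evD]. Qed.

Lemma ev_prod a (I : Type) (r : seq I) (P : pred I) (f : I -> K) (g : I -> C) :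
  (forall i, P i -> ev a (f i) (g i)) -> ev a (\prod_(i <- r | P i) f i) (\prod_(i <- r | P i) g i).
Proof. by move=> H; elim/big_ind2: _ => // *; [exact: ev1|exact: evM]. Qed.

Lemma evX s : ev (Some s) ('X)%:F s.
Proof.
exists 'X, 1; rewrite rmorph1 divr1; split=> //.
by rewrite hornerX hornerC oner_neq0 divr1.
Qed.

Lemma ev_poly s p : ev (Some s) p%:F p.[s].
Proof.
exists p, 1; rewrite rmorph1 divr1; split=> //.
by rewrite hornerC oner_neq0 divr1.
Qed.

Lemma ev_infV : ev None (('X)%:F)^-1 0.
Proof.
exists 1, 'X; rewrite rmorph1 div1r polyX_eq0 size_polyX size_poly1.
by rewrite coefC /= mul0r.
Qed.

Lemma regP a x v : ev a x v -> reg a x. Proof. by exists v. Qed.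
Lemma reg0 a : reg a 0. Proof. exact: regP (ev0 a). Qed.
Lemma reg_const a c : reg a (c%:P)%:F. Proof. exact: regP (ev_const a c). Qed.
Lemma regM a x y : reg a x -> reg a y -> reg a (x * y).
Proof. by move=> [v H] [w H']; exact: regP (evM H H'). Qed.
Lemma regD a x y : reg a x -> reg a y -> reg a (x + y).
Proof. by move=> [v H] [w H']; exact: regP (evD H H'). Qed.
Lemma regN a x : reg a x -> reg a (- x).
Proof. by move=> [v H]; exact: regP (evN H). Qed.
Lemma reg_sum a (I : Type) (r : seq I) (P : pred I) (f : I -> K) :
  (forall i, P i -> reg a (f i)) -> reg a (\sum_(i <- r | P i) f i).
Proof. by move=> H; elim/big_ind: _ => // *; [exact: reg0|exact: regD]. Qed.

(** In lowest terms a root of the denominator is a pole, and over an algebraically closed field a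
    denominator without roots is constant. *)
Lemma reg_finite_poly x : (forall s, reg (Some s) x) -> exists p, x = p%:F.
Proof.
move=> H; have [p [q [q0 cpq xE]]] := frac_coprimeP x.
have sq : size q == 1%N.
  apply/negPn/negP => /closed_rootP[s qs].
  have [v [p' [q' [E [q's _]]]]] := H s.
  have q'0 : q' != 0 by apply: contraNneq q's => ->; rewrite horner0.
  move: E; rewrite xE => /(fracE q0 q'0)/(congr1 (horner^~ s)).
  rewrite !hornerM (eqP qs) mulr0 => /eqP; rewrite mulf_eq0 (negPf q's) orbF => ps.
  by have := coprimep_root cpq ps; rewrite (eqP qs) eqxx.
have /size_poly1P[c c0 qE] := sq.
exists (p * c^-1%:P); rewrite xE qE rmorphM; congr (_ * _).
apply: (mulfI (x := c%:P%:F)); first by rewrite ff_io_eq0 polyC_eq0.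
by rewrite divff ?ff_io_eq0 ?polyC_eq0 // -rmorphM -polyCM divff ?polyC1 ?rmorph1.
Qed.

(** Strict properness does not depend on the fraction chosen: cross multiplication carries it from
    the witness inside [ev] to [p / q]. *)
Lemma ev_inf_size p q : q != 0 -> ev None (p%:F / q%:F) 0 -> (size p < size q)%N.
Proof.
move=> q0 [p' [q' [E [q'0 sp' /esym/eqP]]]].
have [->|p0] := eqVneq p 0; first by rewrite size_poly0 sz.
rewrite mulf_eq0 invr_eq0 lead_coef_eq0 (negPf q'0) orbF => p'0.
have lt : (size p' < size q')%N.
  rewrite ltn_neqAle sp' andbT; apply: contraNN q'0 => /eqP spq.
  by move: p'0; rewrite -spq -lead_coefE lead_coef_eq0 => /eqP p'0; rewrite -size_poly_eq0 -spq p'0 size_poly0.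
have EE := fracE q0 q'0 E.
have p'n0 : p' != 0.
  by apply: contraNneq (mulf_neq0 p0 q'0) => p'E; rewrite EE p'E mul0r.
move/(congr1 (fun p : {poly C} => size p)): EE.
by rewrite (size_mul p0 q'0) (size_mul p'n0 q0); have := sz p0; have := sz q0; plia.
Qed.

(* Liouville's theorem *)
Lemma reg_everywhere x : (forall a, reg a x) -> exists c, x = (c%:P)%:F.
Proof.
move=> H; have [p xE] := reg_finite_poly (fun s => H (Some s)).
have [c xc] := H None.
suff sp : (size p <= 1)%N by exists p`_0; rewrite xE [in LHS](size1_polyC sp).
have e : ev None (x - (c%:P)%:F) 0 by rewrite -(subrr c); apply: evB => //; exact: ev_const.
have : (size (p - c%:P)%R < size (1%R : {poly C}))%N.
  apply: ev_inf_size; first exact: oner_neq0.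
  by rewrite rmorphB rmorph1 divr1 -xE.
rewrite size_poly1 ltnS leqn0 size_poly_eq0 subr_eq0 => /eqP ->.
exact: size_polyC_leq1.
Qed.

Lemma reg_everywhere0 a x : (forall b, reg b x) -> ev a x 0 -> x = 0.
Proof.
move=> /reg_everywhere[c ->] /(ev_uniq (ev_const a c)) ->.
by rewrite polyC0 rmorph0.
Qed.

(** For [l] of degree at most 1 this has at most a simple pole, at [a], also when [a] is infinity.
    The numerator is left free so that multiplication by zeta can exchange [1 + X] for [1 - X]. *)
Definition mu a (l : {poly C}) : K :=
  if a is Some s then l%:F / ('X - s%:P)%:F else l%:F.

Lemma reg_mu a b (l : {poly C}) : (size l <= 2)%N -> a <> b -> reg b (mu a l).
Proof.
move=> sl; case: a => [s|] ab; case: b ab => [t|] // ab; last exact: regP (ev_poly _ _).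
- apply: (@regP _ _ (l.[t] / ('X - s%:P).[t])); exists l, ('X - s%:P); split => //.
  by rewrite hornerXsubC subr_eq0; split=> //; apply/eqP => ts; rewrite ts in ab.
- apply: (@regP _ _ (l`_(size ('X - s%:P)).-1 / lead_coef ('X - s%:P))).
  by exists l, ('X - s%:P); rewrite polyXsubC_eq0 size_XsubC.
Qed.

(** At a finite point the numerator of [x] contains the factor [X - s]; at infinity a strictly
    proper fraction has room for one more degree. *)
Lemma ev_mu a (l : {poly C}) x : (size l <= 2)%N -> ev a x 0 -> reg a (mu a l * x).
Proof.
move=> sl [p [q [-> H]]].
case: a H => [s|] []; last first.
  move=> q0 sp vE; exists ((l * p)`_(size q).-1 / lead_coef q), (l * p), q.
  split; first by rewrite rmorphM mulrA.
  split => //; apply: leq_trans (size_polyMleq _ _) _.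
  suff : (size p < size q)%N by plia.
  rewrite ltn_neqAle sp andbT; apply: contraNN q0 => /eqP spq.
  move/esym/eqP: vE; rewrite mulf_eq0 invr_eq0 lead_coef_eq0 => /orP[|//].
  by rewrite -spq -lead_coefE lead_coef_eq0 => /eqP p0; rewrite -size_poly_eq0 -spq p0 size_poly0.
move=> qs /esym/eqP; rewrite mulf_eq0 invr_eq0 (negPf qs) orbF => /factor_theorem[p' ->].
exists ((l * p').[s] / q.[s]), (l * p'), q; split=> //=.
have d0 : ('X - s%:P)%:F != 0 by rewrite ff_io_eq0 polyXsubC_eq0.
have q0 : q%:F != 0 by rewrite ff_io_eq0; apply: contraNneq qs => ->; rewrite horner0.
rewrite rmorphB in d0; rewrite !rmorphM rmorphB; field; rewrite d0 q0 //.
Qed.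

Lemma ev_inf0 p q : (size p < size q)%N -> ev None (p%:F / q%:F) 0.
Proof.
move=> pq; have q0 : q != 0 by rewrite -size_poly_gt0 (leq_trans _ pq).
exists p, q; split=> //; split=> //; first exact: ltnW.
by rewrite nth_default ?mul0r // -ltnS (leq_trans pq) // leqSpred.
Qed.

Lemma poly_split (P : C -> Prop) q : q != 0 ->
  exists q1 q2, [/\ q = q1 * q2, forall s, P s -> q1.[s] != 0,
    forall s, ~ P s -> q2.[s] != 0 & coprimep q1 q2].
Proof.
move=> q0; have [r qE] := closed_field_poly_normal q.
pose q1 := \prod_(z <- r | ~~ `[<P z>]) ('X - z%:P).
pose q2 := \prod_(z <- r | `[<P z>]) ('X - z%:P).
have root1 s : P s -> ~~ root q1 s.
  move=> Ps; rewrite /q1 -big_filter root_prod_XsubC mem_filter negb_and negbK.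
  by apply/orP; left; apply/asboolP.
have root2 s : ~ P s -> ~~ root q2 s.
  move=> Ps; rewrite /q2 -big_filter root_prod_XsubC mem_filter negb_and.
  by apply/orP; left; apply/asboolP.
have l0 : lead_coef q != 0 by rewrite lead_coef_eq0.
exists (lead_coef q *: q1), q2; split.
- by rewrite -scalerAl {1}qE (bigID (fun z => `[<P z>])) /= mulrC.
- by move=> s Ps; rewrite hornerZ mulf_neq0 //; exact: root1.
- exact: root2.
- rewrite coprimepZl //; apply/Pdiv.ClosedField.coprimepP => s.
  by have [Ps|Ps _] := pselect (P s); [rewrite (negPf (root1 _ Ps))|exact: root2].
Qed.

(** Partial fractions with respect to a set of points. Bezout coefficients separate the two coprime
    factors of the denominator; reduction modulo [q1] makes the first summand strictly proper, and
    the second is so as a difference. *)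
Lemma ev_split (P : C -> Prop) x : ev None x 0 ->
  exists x1 x2, [/\ x = x1 + x2, ev None x1 0 /\ ev None x2 0,
    forall s, P s -> reg (Some s) x1 & forall s, ~ P s -> reg (Some s) x2].
Proof.
move=> x0; have [p [q [q0 xE]]] := fracP x.
have [q1 [q2 [qE h1 h2 /Bezout_eq1_coprimepP[[u1 u2] /= uE]]]] := poly_split P q0.
have q10 : q1 != 0 by apply: contraNneq q0; rewrite qE => ->; rewrite mul0r.
have q20 : q2 != 0 by apply: contraNneq q0; rewrite qE => ->; rewrite mulr0.
pose r := (p * u2) %% q1; pose w := p * u1 + (p * u2) %/ q1 * q2.
have e1 : ev None (r%:F / q1%:F) 0 by apply: ev_inf0; rewrite ltn_modp.
have xE2 : x = r%:F / q1%:F + w%:F / q2%:F.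
  rewrite addf_div ?ff_io_eq0 // xE qE -!rmorphM -rmorphD; congr (_%:F / _).
  have -> : r = p * u2 - (p * u2) %/ q1 * q1.
    by apply: (addrI ((p * u2) %/ q1 * q1)); rewrite -divp_eq addrC subrK.
  rewrite /w -[LHS]mulr1 -uE; ring.
exists (r%:F / q1%:F), (w%:F / q2%:F); split=> //.
- split=> //; have -> : w%:F / q2%:F = x - r%:F / q1%:F by rewrite xE2 addrAC subrr add0r.
  by rewrite -[0]subr0; apply: evB.
- by move=> s Ps; apply: (@regP _ _ (r.[s] / q1.[s])); exists r, q1; split=> //; split=> //; exact: h1.
- by move=> s Ps; apply: (@regP _ _ (w.[s] / q2.[s])); exists w, q2; split=> //; split=> //; exact: h2.
Qed.

Local Notation kM M := (map_mx (io \o polyC) M).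
Definition evm a m n (M : 'M[K]_(m, n)) (N : 'M[C]_(m, n)) :=
  forall i j, ev a (M i j) (N i j).
Definition regm a m n (M : 'M[K]_(m, n)) := forall i j, reg a (M i j).

Lemma evm_reg a m n (M : 'M[K]_(m, n)) N : evm a M N -> regm a M.
Proof. by move=> H i j; exact: regP (H i j). Qed.

Lemma regm_ev a m n (M : 'M[K]_(m, n)) : regm a M -> exists N, evm a M N.
Proof.
move=> H; have [f fP] := choice (fun ij => H ij.1 ij.2).
by exists (\matrix_(i, j) f (i, j)) => i j; rewrite mxE; exact: (fP (i, j)).
Qed.

Lemma evm_const a m n (N : 'M[C]_(m, n)) : evm a (kM N) N.
Proof. by move=> i j; rewrite mxE; exact: ev_const. Qed.

Lemma evm0 a m n : evm a (0 : 'M[K]_(m, n)) 0.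
Proof. by move=> i j; rewrite !mxE; exact: ev0. Qed.

Lemma evmD a m n (M M' : 'M[K]_(m, n)) N N' :
  evm a M N -> evm a M' N' -> evm a (M + M') (N + N').
Proof. by move=> H H' i j; rewrite !mxE; exact: evD. Qed.

Lemma evmN a m n (M : 'M[K]_(m, n)) N : evm a M N -> evm a (- M) (- N).
Proof. by move=> H i j; rewrite !mxE; exact: evN. Qed.

Lemma evmM a m n r (M : 'M[K]_(m, n)) (M' : 'M[K]_(n, r)) N N' :
  evm a M N -> evm a M' N' -> evm a (M *m M') (N *m N').
Proof. by move=> H H' i j; rewrite !mxE; apply: ev_sum => k _; exact: evM. Qed.

Lemma evmZ a m n x v (M : 'M[K]_(m, n)) N : ev a x v -> evm a M N -> evm a (x *: M) (v *: N).
Proof. by move=> H H' i j; rewrite !mxE; exact: evM. Qed.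

Lemma evm_scalar a n x v : ev a x v -> evm a (x%:M : 'M[K]_n) v%:M.
Proof. by move=> H i j; rewrite !mxE; case: eqP => _; rewrite ?mulr1n ?mulr0n //; exact: ev0. Qed.

Lemma regmD a m n (M M' : 'M[K]_(m, n)) : regm a M -> regm a M' -> regm a (M + M').
Proof. by move=> H H' i j; rewrite mxE; exact: regD. Qed.
Lemma regmN a m n (M : 'M[K]_(m, n)) : regm a M -> regm a (- M).
Proof. by move=> H i j; rewrite mxE; exact: regN. Qed.
Lemma regmM a m n r (M : 'M[K]_(m, n)) (M' : 'M[K]_(n, r)) :
  regm a M -> regm a M' -> regm a (M *m M').
Proof. by move=> H H' i j; rewrite mxE; apply: reg_sum => k _; exact: regM. Qed.
Lemma regm_const a m n (N : 'M[C]_(m, n)) : regm a (kM N).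
Proof. exact: evm_reg (evm_const a N). Qed.

Lemma ev_det a n (M : 'M[K]_n) N : evm a M N -> ev a (\det M) (\det N).
Proof.
move=> H; apply: ev_sum => s _; apply: evM; last by apply: ev_prod.
by case: (odd_perm s); rewrite ?expr1 ?expr0; [apply: evN|]; exact: ev1.
Qed.

(** A determinant that is nonzero at one point is nonzero in the field, and by Cramer's rule the
    inverse has no pole at that point. *)
Lemma evm_inv a n (M : 'M[K]_n) N : evm a M N -> N \in unitmx ->
  M \in unitmx /\ regm a (invmx M).
Proof.
move=> H; have dM := ev_det H; rewrite !unitmxE !unitfE => dN.
have M0 : \det M != 0.
  by apply: contraNneq dN => d0; move: dM; rewrite d0 => /(ev_uniq (ev0 a)) ->.
split=> //; rewrite /invmx unitmxE unitfE M0 => i j; rewrite !mxE.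
apply: regM; first exact: regP (evV dN dM).
apply: (@regP _ _ (cofactor N j i)); apply: evM.
  by elim: (_ + _)%N => [|k IH]; rewrite ?expr0 ?exprS; [exact: ev1|apply: evM => //; exact: evN (ev1 a)].
by apply: ev_det => k l; rewrite !mxE.
Qed.

Definition resolvent n (A : 'M[C]_n) : 'M[K]_n := invmx (('X)%:F%:M - kM A).

Lemma resolvent_unit n (A : 'M[C]_n) : ('X)%:F%:M - kM A \in unitmx.
Proof.
have -> : ('X)%:F%:M - kM A = map_mx io (char_poly_mx A).
  by rewrite map_mxB map_scalar_mx -map_mx_comp.
by rewrite unitmxE det_map_mx unitfE ff_io_eq0 monic_neq0 // char_poly_monic.
Qed.

Lemma mul_resolvent n (A : 'M[C]_n) : (('X)%:F%:M - kM A) *m resolvent A = 1%:M.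
Proof. by rewrite mulmxV // resolvent_unit. Qed.
Lemma resolvent_mul n (A : 'M[C]_n) : resolvent A *m (('X)%:F%:M - kM A) = 1%:M.
Proof. by rewrite mulVmx // resolvent_unit. Qed.

Lemma regm_resolvent n (A : 'M[C]_n) s : s%:M - A \in unitmx -> regm (Some s) (resolvent A).
Proof.
move=> sA; apply: (proj2 (evm_inv _ sA)).
by apply: evmD; [exact: evm_scalar (evX s)|apply: evmN; exact: evm_const].
Qed.

(** With x the variable, [(x - A)^-1 = x^-1 (1 - x^-1 A)^-1]; the last factor is regular at infinity
    because its inverse has the value 1 there. *)
Lemma resolvent_inf n (A : 'M[C]_n) : evm None (resolvent A) 0.
Proof.
have X0 : ('X)%:F != 0 :> K by rewrite ff_io_eq0 polyX_eq0.
have e1 : evm None (1%:M - ('X)%:F^-1 *: kM A) (1%:M - 0 *: A).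
  apply: evmD; first exact: evm_scalar (ev1 _).
  by apply: evmN; apply: evmZ; [exact: ev_infV|exact: evm_const].
have [u r] : 1%:M - ('X)%:F^-1 *: kM A \in unitmx /\ regm None (invmx (1%:M - ('X)%:F^-1 *: kM A)).
  by apply: evm_inv e1 _; rewrite scale0r subr0 unitmx1.
rewrite /resolvent (invmx_scalarB X0 u).
have [N eN] := regm_ev r.
have E : evm None (('X)%:F^-1 *: invmx (1%:M - ('X)%:F^-1 *: kM A)) (0 *: N).
  by apply: evmZ => //; exact: ev_infV.
by rewrite scale0r in E.
Qed.

End RationalFunctions.

Arguments ev_const {C F}.
Arguments ev0 {C F}.
Arguments ev1 {C F}.
Arguments evX {C F}.
Arguments ev_poly {C F}.
Arguments ev_infV {C F}.
Arguments reg0 {C F}.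
Arguments reg_const {C F}.
Arguments evm_const {C F}.
Arguments evm0 {C F}.
Arguments regm_const {C F}.

(** * Existence of Wiener-Hopf factorizations *)

Section FieldIdentities.
Variable F : fieldType.
Implicit Types u v x y z : F.

Lemma scalemxE p q x (M : 'M[F]_(p, q)) i j : (x *: M) i j = x * M i j.
Proof. by rewrite mxE. Qed.

Lemma zeromxE p q i j : (0 : 'M[F]_(p, q)) i j = 0.
Proof. by rewrite mxE. Qed.

Lemma clear_pole u v x y : u != 0 -> v != 0 -> x / u * y * (u / v) = x * y / v.
Proof. by move=> u0 v0; field; rewrite u0 v0. Qed.

Lemma move_zero u v x y : u != 0 -> v != 0 -> x * y / u = x * (y * (v / u) / v).
Proof. by move=> u0 v0; field; rewrite u0 v0. Qed.

Lemma common_den x y z : y != 0 -> y * z * (x / y) = x * z.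
Proof. by move=> y0; field. Qed.

End FieldIdentities.

Section Factorization.
Variables (C : closedFieldType) (FF : fracfield C).
Local Notation K := (ff_sort FF).
Local Notation io := (ff_io FF).
Local Notation fracP := (@ff_frac C FF).
Local Notation "p %:F" := (io p).
Local Notation kM M := (map_mx (io \o polyC) M).
Local Notation mu := (mu FF).
(** The closed right and left half planes, given by three facts: they cover the plane, the pole -1
    of zeta is not in the right one, and its zero 1 is not in the left one. *)
Variables Hp Hm : C -> Prop.
Hypotheses (half_planes_cover : forall s, Hp s \/ Hm s) (right_excludes_N1 : ~ Hp (-1)) (left_excludes_1 : ~ Hm 1).
Implicit Types (a b : option C) (x y : K) (p q : {poly C}).

(** Infinity belongs to both domains, so their intersection is the extended imaginary axis. *)
Definition dom (H : C -> Prop) a := if a is Some s then H s else True.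

Definition zt : K := (1 - 'X)%:F / (1 + 'X)%:F.

Lemma dom_or a : dom Hp a \/ dom Hm a.
Proof. by case: a => [s|]; [exact: half_planes_cover|left]. Qed.

Lemma size_1addX (e : C) : e != 0 -> size (1 + e *: 'X : {poly C}) = 2%N.
Proof.
move=> e0; rewrite addrC size_polyDl ?size_scale ?size_polyX ?size_poly1 //.
Qed.

Lemma size_1mX : size (1 - 'X : {poly C}) = 2%N.
Proof. by rewrite -scaleN1r size_1addX // oppr_eq0 oner_neq0. Qed.
Lemma size_1pX : size (1 + 'X : {poly C}) = 2%N.
Proof. by rewrite -(scale1r 'X) size_1addX // oner_neq0. Qed.

Lemma size_1pXn n : size ((1 + 'X) ^+ n : {poly C}) = n.+1.
Proof.
have /prednK <- : (0 < size ((1 + 'X) ^+ n : {poly C}))%N.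
  by rewrite size_poly_gt0 expf_neq0 // -size_poly_eq0 size_1pX.
by rewrite size_exp size_1pX mul1n.
Qed.

Lemma X1p_neq0 : (1 + 'X)%:F != 0 :> K.
Proof. by rewrite ff_io_eq0 -size_poly_gt0 size_1pX. Qed.
Lemma X1m_neq0 : (1 - 'X)%:F != 0 :> K.
Proof. by rewrite ff_io_eq0 -size_poly_gt0 size_1mX. Qed.

Lemma zt_neq0 : zt != 0.
Proof. by rewrite mulf_neq0 ?invr_neq0 ?X1p_neq0 ?X1m_neq0. Qed.

Lemma regV_poly s p : p.[s] != 0 -> reg (Some s) (p%:F^-1).
Proof. by move=> ps; exact: regP (evV ps (ev_poly s p)). Qed.

Lemma reg_div a p q : q != 0 -> (size p <= size q)%N ->
  (forall s, a = Some s -> q.[s] != 0) -> reg a (p%:F / q%:F).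
Proof.
move=> q0 pq; case: a => [s|] h.
  by apply: regM; [exact: regP (ev_poly s p)|exact: regV_poly (h s erefl)].
by apply: (@regP _ _ _ _ (p`_(size q).-1 / lead_coef q)); exists p, q.
Qed.

Lemma reg_zt a : dom Hp a -> reg a zt.
Proof.
move=> Ha; apply: reg_div; rewrite -?size_poly_eq0 ?size_1pX ?size_1mX // => s aE.
rewrite hornerD hornerC hornerX addrC addr_eq0; apply/eqP => sE.
by move: Ha; rewrite aE /= sE.
Qed.

Lemma reg_ztV a : dom Hm a -> reg a zt^-1.
Proof.
move=> Ha; rewrite /zt invf_div.
apply: reg_div; rewrite -?size_poly_eq0 ?size_1pX ?size_1mX // => s aE.
rewrite hornerD hornerC hornerN hornerX subr_eq0; apply/eqP => sE.
by move: Ha; rewrite aE /= -sE.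
Qed.

Lemma reg1 a : reg a (1 : K). Proof. exact: regP (ev1 a). Qed.

Lemma reg_exp a x n : reg a x -> reg a (x ^+ n).
Proof.
by move=> ax; elim: n => [|n IH]; rewrite ?expr0 ?exprS; [exact: reg1|exact: regM].
Qed.

Lemma reg_ztX a (k : int) : dom Hp a -> 0 <= k -> reg a (zt ^ k).
Proof. by case: k => // k Ha _; apply: reg_exp; exact: reg_zt. Qed.

Lemma reg_ztXN a (k : int) : dom Hm a -> k <= 0 -> reg a (zt ^ k).
Proof.
case: k => [[|k]|k] // Ha _; first by rewrite expr0z; exact: reg1.
by rewrite NegzE -exprnN -exprVn; apply: reg_exp; exact: reg_ztV.
Qed.

Lemma reg_ztX_axis a (k : int) : dom Hp a -> dom Hm a -> reg a (zt ^ k).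
Proof. by move=> ap am; case: (leP 0 k) => [|/ltW] h; [exact: reg_ztX|exact: reg_ztXN]. Qed.

(** This pairs a new pole at [a] with one more power of zeta: the factor [1 + X] absorbs the pole of
    zeta at -1, and the product again has no pole except at [a]. *)
Lemma zt_mu a : zt * mu a (1 + 'X) = mu a (1 - 'X).
Proof.
have u := X1p_neq0.
by case: a => [s|] /=; rewrite /zt; [rewrite mulrA; congr (_ / _)|]; rewrite divfK.
Qed.

Lemma mu_neq0 a (l : {poly C}) : l != 0 -> mu a l != 0.
Proof.
move=> l0; case: a => [s|] /=; last by rewrite ff_io_eq0.
by rewrite mulf_neq0 ?invr_neq0 // ff_io_eq0 // polyXsubC_eq0.
Qed.

Definition regO (H : C -> Prop) m n (M : 'M[K]_(m, n)) :=
  forall a, dom H a -> regm a M.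

Section Existence.
Variables (m : nat) (S : 'M[K]_m).
Hypotheses (Su : S \in unitmx)
  (Sr : forall a, dom Hp a -> dom Hm a -> regm a S)
  (SVr : forall a, dom Hp a -> dom Hm a -> regm a (invmx S)).

Lemma common_denominator : exists2 q, q != 0 &
  exists N : 'M[{poly C}]_m, forall i j, q%:F * S i j = (N i j)%:F.
Proof.
have [f fP] := choice (fun ij : 'I_m * 'I_m => fracP (S ij.1 ij.2)).
have [g gP] := choice fP.
pose q := \prod_ij g ij.
exists q; first by apply/prodf_neq0 => ij _; case: (gP ij).
exists (\matrix_(i, j) (f (i, j) * \prod_(ij | ij != (i, j)) g ij)) => i j.
case: (gP (i, j)) => g0 /= ->; rewrite mxE /q (bigD1 (i, j)) //= !rmorphM.
have g0' : (g (i, j))%:F != 0 :> K by rewrite ff_io_eq0.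
exact: common_den.
Qed.

Definition admissible (F : 'M[K]_m) (k : 'I_m -> int) :=
  [/\ F \in unitmx, regO Hp F & regO Hm (S *m F *m diag_mx (\row_i zt ^ k i))].

Lemma diag_col n (F : 'M[K]_(n, m)) (d : 'I_m -> K) i j :
  (F *m diag_mx (\row_l d l)) i j = F i j * d j.
Proof.
rewrite mxE (bigD1 j) //= !mxE eqxx mulr1n big1 ?addr0 // => l lj.
by rewrite !mxE (negPf lj) mulr0n mulr0.
Qed.

(** As [zeta^-n = (1+x)^n / (1-x)^n], the denominator [(1+x)^n], harmless on the right, is traded
    for [(1-x)^n], harmless on the left, while [q] clears the poles of [S]. The choice [n = size q]
    keeps the scalar regular at infinity. *)
Lemma admissible_start q (N : 'M[{poly C}]_m) : q != 0 ->
  (forall i j, q%:F * S i j = (N i j)%:F) ->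
  admissible (q%:F / (1 + 'X)%:F ^+ size q)%:M (fun _ => - (size q)%:Z).
Proof.
move=> q0 qN.
have xp0 : (1 + 'X)%:F ^+ size q != 0 :> K by rewrite expf_neq0 // X1p_neq0.
have xm0 : (1 - 'X)%:F ^+ size q != 0 :> K by rewrite expf_neq0 // X1m_neq0.
have q0' : q%:F != 0 :> K by rewrite ff_io_eq0.
have dinf : reg None (q%:F / (1 + 'X)%:F ^+ size q).
  rewrite -rmorphXn; apply: reg_div => //; first by rewrite expf_neq0 // -size_poly_eq0 size_1pX.
  by rewrite size_1pXn.
split.
- by rewrite unitmxE det_scalar unitrX // unitfE mulf_neq0 ?invr_neq0.
- move=> a Ha i j; rewrite mxE; case: eqP => _; rewrite ?mulr1n ?mulr0n; last exact: reg0.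
  case: a Ha => [s|] //= Hs; apply: regM; first exact: regP (ev_poly s q).
  rewrite -rmorphXn; apply: regV_poly; rewrite horner_exp expf_neq0 //.
  rewrite hornerD hornerC hornerX addrC addr_eq0; apply/eqP => sE; by move: Hs; rewrite sE.
- move=> a Ha i j; rewrite diag_col.
  rewrite mul_mx_scalar mxE.
  case: a Ha => [s|] //= Hs; last first.
    apply: regM; last exact: reg_ztX_axis.
    by apply: regM => //; exact: Sr.
  have -> : q%:F / (1 + 'X)%:F ^+ size q * S i j * zt ^ (- (size q)%:Z) =
            (N i j)%:F * ((1 - 'X) ^+ size q)%:F^-1.
    rewrite -qN -exprnN -exprVn /zt invf_div expr_div_n rmorphXn.
    exact: clear_pole.
  apply: regM; first exact: regP (ev_poly s _).
  apply: regV_poly; rewrite horner_exp expf_neq0 //.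
  rewrite hornerD hornerC hornerN hornerX subr_eq0; apply/eqP => sE; by move: Hs; rewrite -sE.
Qed.

(** If [k_i = n] exceeds the bound, [q (S F)_ji / (1+x)^n] is regular on the right since [q S] is
    polynomial, on the left since it equals [q (S F)_ji zeta^n / (1-x)^n], and zero at infinity. By
    Liouville column [i] of [S F] vanishes, against invertibility. *)
Lemma admissible_le q (N : 'M[{poly C}]_m) F k i : q != 0 ->
  (forall i j, q%:F * S i j = (N i j)%:F) ->
  admissible F k -> k i <= (size q)%:Z.
Proof.
move=> q0 qN [Fu Fr Gr]; rewrite leNgt; apply/negP => ki.
have [n [kE nq]] : exists n : nat, k i = n%:Z /\ (size q < n)%N.
  by move: ki; case: (k i) => // n; exists n.
have xp0 : (1 + 'X)%:F != 0 :> K by exact: X1p_neq0.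
have xm0 : (1 - 'X)%:F != 0 :> K by exact: X1m_neq0.
suff h0 j : (S *m F) j i = 0.
  have : S *m F *m delta_mx i 0 = 0 :> 'cV_m.
    by rewrite -colE; apply/matrixP => r c; rewrite !mxE -[RHS](h0 r) mxE.
  move/(congr1 (mulmx (invmx (S *m F)))); rewrite mulKmx ?unitmx_mul ?Su // mulmx0.
  by move/matrixP/(_ i 0); rewrite !mxE !eqxx => /eqP; rewrite oner_eq0.
pose y := q%:F * (S *m F) j i * ((1 + 'X)%:F ^+ n)^-1.
suff y0 : y = 0.
  move/eqP: y0; rewrite /y mulf_eq0 invr_eq0 expf_eq0 (negPf xp0) andbF orbF.
  by rewrite mulf_eq0 ff_io_eq0 (negPf q0) => /eqP.
have qr : ev None (q%:F / (1 + 'X)%:F ^+ n) 0.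
  rewrite -rmorphXn; apply: ev_inf0.
  by rewrite size_1pXn ltnS ltnW.
have rinf : reg None ((S *m F) j i) by apply: (@regmM _ _ None); [exact: Sr|exact: Fr].
have yE : y = (q%:F / (1 + 'X)%:F ^+ n) * (S *m F) j i by rewrite /y mulrAC.
have einf : ev None y 0.
  by case: rinf => v rv; rewrite yE -[0](mul0r v); exact: evM.
apply: (reg_everywhere0 _ einf) => -[s|]; last exact: regP einf.
have [Hs|Hs] := half_planes_cover s.
  apply: regM; last first.
    rewrite -rmorphXn; apply: regV_poly; rewrite horner_exp expf_neq0 //.
    rewrite hornerD hornerC hornerX addrC addr_eq0; apply/eqP => sE; by move: Hs; rewrite sE.
  rewrite mxE mulr_sumr; apply: reg_sum => l _; rewrite mulrA qN.
  by apply: regM; [exact: regP (ev_poly s _)|exact: Fr].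
have -> : y = q%:F * ((S *m F *m diag_mx (\row_i zt ^ k i)) j i * ((1 - 'X) ^+ n)%:F^-1).
  rewrite diag_col kE /y /zt -exprnP expr_div_n rmorphXn.
  by apply: move_zero; rewrite expf_neq0.
apply: regM; first exact: regP (ev_poly s _).
apply: regM; first exact: Gr.
apply: regV_poly; rewrite horner_exp expf_neq0 //.
rewrite hornerD hornerC hornerN hornerX subr_eq0; apply/eqP => sE; by move: Hs; rewrite -sE.
Qed.

Definition col_subst (F : 'M[K]_m) j (w : 'cV[K]_m) : 'M[K]_m :=
  \matrix_(r, i) if i == j then (F *m w) r 0 else F r i.

(** The substitution multiplies [F] by [1 + (w - e_j) e_j^T], a rank one change of the identity with
    inverse [1 - w_j^-1 (w - e_j) e_j^T]. *)
Lemma col_subst_unit F j (w : 'cV[K]_m) : F \in unitmx -> w j 0 != 0 -> col_subst F j w \in unitmx.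
Proof.
move=> Fu wj; pose e : 'cV[K]_m := delta_mx j 0.
have -> : col_subst F j w = F *m (1%:M + (w - e) *m e^T).
  apply/matrixP => r i; rewrite mulmxDr mulmx1 mulmxA mulmxBr -colE.
  rewrite [LHS]mxE [RHS]mxE [X in _ + X]mxE big_ord1.
  have -> : (F *m w - col j F) r 0 = (F *m w) r 0 - F r j by rewrite !mxE.
  have -> : e^T 0 i = (i == j)%:R by rewrite !mxE andbT.
  by case: eqP => [->|_]; rewrite ?mulr0 ?addr0 // mulr1 addrC subrK.
rewrite unitmx_mul Fu /=.
suff /mulmx1_unit[] : (1%:M + (w - e) *m e^T) *m (1%:M - (w j 0)^-1 *: ((w - e) *m e^T)) = 1%:M by [].
have E : e^T *m (w - e) = (w j 0 - 1)%:M.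
  rewrite [LHS]mx11_scalar; congr (_%:M).
  rewrite mxE (bigD1 j) //= big1 => [|l lj]; last by rewrite !mxE (negPf lj) mul0r.
  by rewrite !mxE !eqxx mul1r addr0.
set T := (w - e) *m e^T.
have TT : T *m T = (w j 0 - 1) *: T.
  by rewrite /T mulmxA -(mulmxA (w - e)) E mul_mx_scalar -scalemxAl.
rewrite mulmxDl mul1mx mulmxBr mulmx1 -scalemxAr TT scalerA.
rewrite addrA -[RHS]addr0 -!addrA; congr (_ + _).
rewrite -scaleNr -{2}[T]scale1r -scaleNr -!scalerDl.
by apply/eqP; rewrite scaler_eq0; apply/orP; left; apply/eqP; field.
Qed.

Lemma admissible_subst F k j (w : 'cV[K]_m) : admissible F k -> w j 0 != 0 ->
  regO Hp (F *m w) -> regO Hm (zt ^ (k j + 1) *: (S *m (F *m w))) ->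
  admissible (col_subst F j w) (fun i => if i == j then k j + 1 else k i).
Proof.
move=> [Fu Fr Gr] wj hr gr; split.
- exact: col_subst_unit.
- by move=> a Ha r i; rewrite mxE; case: eqP => _; [exact: hr|exact: Fr].
- move=> a Ha r i; rewrite diag_col.
  have -> : (S *m col_subst F j w) r i = if i == j then (S *m (F *m w)) r 0 else (S *m F) r i.
    by rewrite mxE; case: eqP => ij; rewrite [RHS]mxE; apply: eq_bigr => l _;
      rewrite [in LHS]mxE; case: eqP.
  have := gr a Ha r 0; have := Gr a Ha r i; rewrite diag_col scalemxE.
  by case: eqP => [-> _|//]; rewrite mulrC.
Qed.

(** The future factor [W_-]: with this matrix G, [S = G diag(zeta^-k) F^-1]. *)
Definition wh_right (F : 'M[K]_m) (k : 'I_m -> int) := S *m F *m diag_mx (\row_i zt ^ k i).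

Lemma singular_kernel (N : 'M[C]_m) : N \notin unitmx -> exists2 c : 'cV_m, c != 0 & N *m c = 0.
Proof.
rewrite unitmxE unitfE negbK -det_tr => /det0P[v v0 vN].
exists v^T; first by apply: contraNneq v0 => vT; rewrite -(trmxK v) vT trmx0.
by apply: trmx_inj; rewrite trmx_mul trmxK trmx0.
Qed.

(** The column to replace is one of smallest exponent among those occurring in the relation [c]:
    then [zeta^(k_j - k_i)] is regular on the left, and its inverse on the right, for every column
    involved. *)
Lemma exists_min_support (c : 'cV[C]_m) (k : 'I_m -> int) : c != 0 ->
  exists2 j, c j 0 != 0 & forall i, c i 0 != 0 -> k j <= k i.
Proof.
move=> c0; have [i0 ci0] : exists i, c i 0 != 0.
  apply/existsP; apply: contraNT c0; rewrite negb_exists => /forallP H.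
  apply/eqP/matrixP => i j; rewrite mxE ord1; apply/eqP; move: (H i); by rewrite negbK.
by case: (@arg_minP _ _ _ i0 (fun i => c i 0 != 0) k ci0) => j cj jmin; exists j.
Qed.

Lemma ev_reg0 a x y : reg a x -> ev a y 0 -> ev a (x * y) 0.
Proof. by move=> [v xv] y0; rewrite -(mulr0 v); exact: evM. Qed.

Lemma evm_reg0 a n1 n r (M : 'M[K]_(n1, n)) (M' : 'M[K]_(n, r)) :
  regm a M -> evm a M' 0 -> evm a (M *m M') 0.
Proof. by move=> /regm_ev[N MN] M0; rewrite -(mulmx0 _ N); exact: evmM. Qed.

Lemma reg_mu_scale (l : {poly C}) a (H : C -> Prop) (z : 'cV[K]_m) : (size l <= 2)%N ->
  regO H z -> (dom H a -> evm a z 0) -> regO H (mu a l *: z).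
Proof.
move=> sl zr z0 b Hb r s; rewrite mxE.
have [ab|ab] := pselect (a = b); last by apply: regM; [exact: reg_mu|exact: zr].
by subst b; apply: ev_mu => //; have := z0 Hb r s; rewrite zeromxE.
Qed.

(** Since [F(a) c = 0], the column [F c] can be divided by a local parameter at [a] and stays
    regular on the right. The division leaves room for one more power of zeta on the left. *)
Lemma improve_right a F k (N : 'M[C]_m) : admissible F k -> dom Hp a ->
  evm a F N -> N \notin unitmx ->
  exists F' j, admissible F' (fun i => if i == j then k j + 1 else k i).
Proof.
move=> adm Ha FN /singular_kernel[c c0 Nc]; have [Fu Fr Gr] := adm.
have [j cj jmin] := exists_min_support k c0.
pose w := mu a (1 + 'X) *: kM c.
exists (col_subst F j w), j; apply: admissible_subst adm _ _ _.
- by rewrite !mxE mulf_neq0 ?mu_neq0 -?size_poly_eq0 ?size_1pX ?ff_io_eq0 ?polyC_eq0.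
- rewrite -scalemxAr; apply: reg_mu_scale; first by rewrite size_1pX.
    by move=> b Hb; apply: regmM; [exact: Fr|exact: regm_const].
  by move=> _; rewrite -Nc; apply: evmM => //; exact: evm_const.
(* By [zt_mu] the extra zeta turns [1 + X] into [1 - X]. What remains is [zeta^k_j S F c], a
   combination of columns of [wh_right] with powers [zeta^(k_j - k_i)], all of exponent at most
   0. *)
- rewrite -!scalemxAr scalerA exprzDr ?unitfE ?zt_neq0 // expr1z -mulrA zt_mu mulrC -scalerA.
  apply: reg_mu_scale; first by rewrite size_1mX.
    move=> b Hb r s; rewrite mulmxA !mxE mulr_sumr; apply: reg_sum => i _; rewrite [kM c _ _]mxE ord1.
    have [->|ci] := eqVneq (c i 0) 0; first by rewrite /= polyC0 rmorph0 !mulr0; exact: reg0.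
    have -> : zt ^ k j * ((S *m F) r i * (io \o polyC) (c i 0)) =
        zt ^ (k j - k i) * (wh_right F k r i * (io \o polyC) (c i 0)).
      have -> : zt ^ k j = zt ^ (k j - k i) * zt ^ k i.
        by rewrite -exprzDr ?unitfE ?zt_neq0 // subrK.
      by rewrite /wh_right diag_col -!mulrA; congr (_ * _); rewrite mulrCA.
    apply: regM; first by apply: reg_ztXN => //; rewrite subr_le0 jmin.
    by apply: regM; [exact: Gr|exact: reg_const].
  move=> Ha'; have : evm a (S *m (F *m kM c)) 0.
    by apply: evm_reg0; [exact: Sr|rewrite -Nc; apply: evmM => //; exact: evm_const].
  by move=> e r s; rewrite scalemxE zeromxE; apply: ev_reg0; [exact: reg_ztX_axis|have := e r s; rewrite zeromxE].
Qed.

(** The same exchange starting from a relation [c] between the columns of [wh_right] at [a]. The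
    vector [d] carries the powers [zeta^(k_i - k_j)], so that [zeta^k_j S F d] is exactly
    [wh_right c]. *)
Lemma improve_left a F k (N : 'M[C]_m) : admissible F k -> dom Hm a ->
  evm a (wh_right F k) N -> N \notin unitmx ->
  exists F' j, admissible F' (fun i => if i == j then k j + 1 else k i).
Proof.
move=> adm Ha GN /singular_kernel[c c0 Nc]; have [Fu Fr Gr] := adm.
have [j cj jmin] := exists_min_support k c0.
pose d : 'cV[K]_m := \col_i ((io \o polyC) (c i 0) * zt ^ (k i - k j)).
have dE : diag_mx (\row_i zt ^ k i) *m kM c = zt ^ k j *: d.
  apply/matrixP => i s; rewrite mul_diag_mx !mxE ord1 mulrCA.
  by rewrite -exprzDr ?unitfE ?zt_neq0 // addrC subrK mulrC.
have GE : wh_right F k *m kM c = zt ^ k j *: (S *m (F *m d)).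
  by rewrite /wh_right -mulmxA dE -scalemxAr mulmxA.
have G0 : evm a (wh_right F k *m kM c) 0.
  by rewrite -Nc; apply: evmM => //; exact: evm_const.
pose w := mu a (1 + 'X) *: d.
exists (col_subst F j w), j; apply: admissible_subst adm _ _ _.
- rewrite !mxE subrr expr0z mulr1.
  by rewrite mulf_neq0 ?mu_neq0 -?size_poly_eq0 ?size_1pX ?ff_io_eq0 ?polyC_eq0.
- rewrite -scalemxAr; apply: reg_mu_scale; first by rewrite size_1pX.
    move=> b Hb r s; rewrite mxE; apply: reg_sum => i _; rewrite mxE.
    have [->|ci] := eqVneq (c i 0) 0; first by rewrite /= polyC0 rmorph0 mul0r mulr0; exact: reg0.
    apply: regM; first exact: Fr.
    apply: regM; first exact: reg_const.
    by apply: reg_ztX => //; rewrite subr_ge0 jmin.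
  move=> Ha'.
  (* If [a] also lies on the right it is on the extended axis, where [S^-1] is regular; hence [F d]
     inherits the zero of [wh_right c] at [a]. *)
  have -> : F *m d = zt ^ (- k j) *: (invmx S *m (wh_right F k *m kM c)).
    rewrite GE -scalemxAr mulKmx // scalerA -exprzDr ?unitfE ?zt_neq0 //.
    by rewrite addNr expr0z scale1r.
  have e : evm a (invmx S *m (wh_right F k *m kM c)) 0 by apply: evm_reg0 => //; exact: SVr.
  move=> r s; rewrite scalemxE zeromxE; apply: ev_reg0; first exact: reg_ztX_axis.
  by have := e r s; rewrite zeromxE.
- rewrite -!scalemxAr scalerA exprzDr ?unitfE ?zt_neq0 // expr1z -mulrA zt_mu mulrC -scalerA -GE.
  apply: reg_mu_scale => //; first by rewrite size_1mX.
  by move=> b Hb; apply: regmM; [exact: Gr|exact: regm_const].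
Qed.

Theorem wh_factorization_exists : exists (lam : 'I_m -> int) (Wm Wp : 'M[K]_m),
  [/\ Wm \in unitmx /\ Wp \in unitmx, regO Hm Wm /\ regO Hm (invmx Wm),
     regO Hp Wp /\ regO Hp (invmx Wp)
   & S = Wm *m diag_mx (\row_i zt ^ lam i) *m Wp].
Proof.
have [q q0 [N qN]] := common_denominator.
(* All exponents stay at most [size q] by [admissible_le], so raising one of them lowers this
   distance. *)
pose meas (k : 'I_m -> int) := (\sum_i `|(size q)%:Z - k i|)%N.
have step F k : admissible F k ->
    ~ ((forall a, dom Hp a -> exists2 N, evm a F N & N \in unitmx) /\
       (forall a, dom Hm a -> exists2 N, evm a (wh_right F k) N & N \in unitmx)) ->
    exists F' k', admissible F' k' /\ (meas k' < meas k)%N.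
  move=> adm bad; have [F' [j adm']] : exists F' j,
      admissible F' (fun i => if i == j then k j + 1 else k i).
    have [_ Fr Gr] := adm.
    case/not_andP: bad => /existsNP[a] /not_implyP[Ha /forall2NP bad].
      have [M aM] := regm_ev (Fr a Ha).
      by have [//|/negP Mu] := bad M; exact: improve_right aM Mu.
    have [M aM] := regm_ev (Gr a Ha).
    by have [//|/negP Mu] := bad M; exact: improve_left aM Mu.
  exists F', (fun i => if i == j then k j + 1 else k i); split=> //.
  have := admissible_le j q0 qN adm'; rewrite eqxx => kj.
  rewrite /meas (bigD1 j) //= [X in (_ < X)%N](bigD1 j) //= eqxx.
  set A := (X in (_ + X < _)%N); set B := (X in (_ < _ + X)%N).
  have -> : A = B by apply: eq_bigr => i /negPf ->.
  by rewrite ltn_add2r; move: kj; move: (Posz (size q)) (k j) => u v; lia.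
suff H n F k : admissible F k -> (meas k <= n)%N -> exists F' k', admissible F' k' /\
    (forall a, dom Hp a -> exists2 N, evm a F' N & N \in unitmx) /\
    (forall a, dom Hm a -> exists2 N, evm a (wh_right F' k') N & N \in unitmx).
  have [F [k [[Fu Fr Gr] [Fg Gg]]]] := H _ _ _ (admissible_start q0 qN) (leqnn _).
  have dk l : diag_mx (\row_i zt ^ l i) *m diag_mx (\row_i zt ^ (- l i)) = 1%:M :> 'M[K]_m.
    rewrite mul_diag_mx; apply/matrixP => i j; rewrite !mxE.
    case: eqP => [->|_]; last by rewrite !mulr0n mulr0.
    by rewrite !mulr1n -exprzDr ?unitfE ?zt_neq0 // subrr expr0z.
  have dku : diag_mx (\row_i zt ^ k i) \in unitmx by case: (mulmx1_unit (dk k)).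
  (* The indices are the negatives of the maximal exponents. *)
  exists (fun i => - k i), (wh_right F k), (invmx F); split.
  - by rewrite unitmx_inv Fu !unitmx_mul Su Fu.
  - by split=> // a /Gg[M GM Mu]; case: (evm_inv GM Mu).
  - by split; [move=> a /Fg[M FM Mu]; case: (evm_inv FM Mu)|rewrite invmxK].
  - by rewrite /wh_right -(mulmxA (S *m F)) dk mulmx1 mulmxK.
elim: n F k => [|n IH] F k adm kn.
all: have [good|bad] := pselect ((forall a, dom Hp a -> exists2 N, evm a F N & N \in unitmx) /\
    (forall a, dom Hm a -> exists2 N, evm a (wh_right F k) N & N \in unitmx));
  first by exists F, k.
all: have [F' [k' [adm' lt]]] := step F k adm bad.
- by move: lt; rewrite ltnNge (leq_trans kn).
- by apply: IH adm' _; rewrite -ltnS (leq_trans lt).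
Qed.

End Existence.
End Factorization.

(** * State space calculus over the rational functions *)

Section Adjoint.
Variable C : numClosedFieldType.

Lemma adjmxM m n p (A : 'M[C]_(m, n)) (B : 'M[C]_(n, p)) : (A *m B)^t* = B^t* *m A^t*.
Proof. by rewrite trmx_mul map_mxM. Qed.
Lemma adjmxD m n (A B : 'M[C]_(m, n)) : (A + B)^t* = A^t* + B^t*.
Proof. by rewrite linearD /= map_mxD. Qed.
Lemma adjmxN m n (A : 'M[C]_(m, n)) : (- A)^t* = - A^t*.
Proof. by rewrite linearN /= map_mxN. Qed.
Lemma adjmx0 m n : (0 : 'M[C]_(m, n))^t* = 0.
Proof. by rewrite trmx0 map_mx0. Qed.
Lemma adjmx_scalar n a : (a%:M : 'M[C]_n)^t* = (a^*)%:M.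
Proof. by rewrite tr_scalar_mx map_scalar_mx. Qed.
Lemma adjmx1 n : (1%:M : 'M[C]_n)^t* = 1%:M.
Proof. by rewrite adjmx_scalar rmorph1. Qed.
Lemma adjmx_inj m n (A B : 'M[C]_(m, n)) : A^t* = B^t* -> A = B.
Proof. by move=> h; rewrite -[A]trmxCK h trmxCK. Qed.
Lemma adjmx_unit n (A : 'M[C]_n) : (A^t* \in unitmx) = (A \in unitmx).
Proof. by rewrite map_unitmx unitmx_tr. Qed.

Lemma unitmxN n (A : 'M[C]_n) : (- A \in unitmx) = (A \in unitmx).
Proof. by rewrite -scaleN1r unitmxZ // unitrN1. Qed.

Lemma unitary_adj n (D : 'M[C]_n) : D \is unitarymx -> D *m D^t* = 1%:M /\ D^t* *m D = 1%:M.
Proof. by move=> /unitarymxP DD; split=> //; apply: mulmx1C. Qed.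

Definition dissipative m n (A : 'M[C]_n) (B : 'M[C]_(n, m)) (K : 'M[C]_(m, n)) (D : 'M[C]_m) :=
  [/\ A + A^t* + K^t* *m K = 0, D \is unitarymx & B = - (K^t* *m D)].

Section Dissipative.
Variables (m n : nat) (A : 'M[C]_n) (B : 'M[C]_(n, m)) (K : 'M[C]_(m, n)) (D : 'M[C]_m).
Hypothesis dABKD : dissipative A B K D.

Lemma dissKK : K^t* *m K = - (A + A^t*).
Proof. by case: dABKD => /eqP; rewrite addrC addr_eq0 => /eqP. Qed.
Lemma dissBD : B *m D^t* = - K^t*.
Proof. by case: dABKD => _ /unitary_adj[DD _] ->; rewrite mulNmx -mulmxA DD mulmx1. Qed.
Lemma dissDB : D *m B^t* = - K.
Proof. by apply: adjmx_inj; rewrite adjmxM adjmxN trmxCK dissBD. Qed.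
Lemma dissKD : K^t* *m D = - B.
Proof. by case: dABKD => _ _ ->; rewrite opprK. Qed.
Lemma dissDK : D^t* *m K = - B^t*.
Proof. by apply: adjmx_inj; rewrite adjmxM adjmxN !trmxCK dissKD. Qed.
Lemma dissBB : B *m B^t* = - (A + A^t*).
Proof. by rewrite -dissKK; case: dABKD => _ /unitary_adj[DD _] ->;
  rewrite adjmxN mulmxN mulNmx opprK adjmxM trmxCK -mulmxA (mulmxA D) DD mul1mx. Qed.
End Dissipative.

End Adjoint.

Section StateSpace.
Variables (C : numClosedFieldType) (FF : fracfield C).
Local Notation K := (ff_sort FF).
Local Notation io := (ff_io FF).
Local Notation "p %:F" := (io p).
Local Notation kM M := (map_mx (io \o polyC) M).
Local Notation res := (resolvent FF).
Local Notation x := (io 'X).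

Lemma kMM m n p (A : 'M[C]_(m, n)) (B : 'M[C]_(n, p)) : kM (A *m B) = kM A *m kM B.
Proof. exact: map_mxM. Qed.
Lemma kMD m n (A B : 'M[C]_(m, n)) : kM (A + B) = kM A + kM B.
Proof. exact: map_mxD. Qed.
Lemma kMN m n (A : 'M[C]_(m, n)) : kM (- A) = - kM A.
Proof. exact: map_mxN. Qed.
Lemma kM0 m n : kM (0 : 'M[C]_(m, n)) = 0.
Proof. exact: map_mx0. Qed.
Lemma kM1 n : kM (1%:M : 'M[C]_n) = 1%:M.
Proof. exact: map_mx1. Qed.

Variables Hp Hm : C -> Prop.
Hypotheses (half_planes_cover : forall s, Hp s \/ Hm s) (right_excludes_N1 : ~ Hp (-1)) (left_excludes_1 : ~ Hm 1)
  (reflect_left : forall s, Hm s -> Hp (- s^*)).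

Definition stab n (A : 'M[C]_n) := forall s, Hp s -> s%:M - A \in unitmx.

(** The spectrum of [-A^*] is the mirror image of that of [A] in the imaginary axis. *)
Lemma stab_adj n (A : 'M[C]_n) s : stab A -> Hm s -> s%:M - (- A^t*) \in unitmx.
Proof.
move=> sA /reflect_left/sA; rewrite -adjmx_unit -unitmxN.
by rewrite adjmxD adjmxN adjmx_scalar rmorphN /= conjCK opprB raddfN /= opprK addrC opprK.
Qed.

Lemma regO_res n (A : 'M[C]_n) : stab A -> regO Hp (res A).
Proof.
by move=> sA [s|] Hs; [apply: regm_resolvent; exact: sA|exact: evm_reg (resolvent_inf _ _)].
Qed.

Lemma regO_resN n (A : 'M[C]_n) : stab A -> regO Hm (res (- A^t*)).
Proof.
by move=> sA [s|] Hs; [apply: regm_resolvent; exact: stab_adj|exact: evm_reg (resolvent_inf _ _)].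
Qed.

Lemma regOM (H : C -> Prop) m n p (M : 'M[K]_(m, n)) (N : 'M[K]_(n, p)) :
  regO H M -> regO H N -> regO H (M *m N).
Proof. by move=> h h' a Ha; apply: regmM; [exact: h|exact: h']. Qed.
Lemma regOD (H : C -> Prop) m n (M N : 'M[K]_(m, n)) :
  regO H M -> regO H N -> regO H (M + N).
Proof. by move=> h h' a Ha; apply: regmD; [exact: h|exact: h']. Qed.
Lemma regON (H : C -> Prop) m n (M : 'M[K]_(m, n)) : regO H M -> regO H (- M).
Proof. by move=> h a Ha; apply: regmN; exact: h. Qed.
Lemma regO_const (H : C -> Prop) m n (N : 'M[C]_(m, n)) : regO H (kM N : 'M[K]__).
Proof. by move=> a _; exact: regm_const. Qed.
Lemma regO_inf (H : C -> Prop) m n (M : 'M[K]_(m, n)) : regO H M -> regm None M.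
Proof. exact. Qed.

Lemma evm0_mulr m n p (M : 'M[K]_(m, n)) (N : 'M[K]_(n, p)) :
  evm None M 0 -> regm None N -> evm None (M *m N) 0.
Proof. by move=> h /regm_ev[N' NN]; rewrite -(mul0mx _ N'); exact: evmM. Qed.

Lemma evm0D m n (M N : 'M[K]_(m, n)) : evm None M 0 -> evm None N 0 -> evm None (M + N) 0.
Proof. by move=> h h'; rewrite -(addr0 0); exact: evmD. Qed.
Lemma evm0N m n (M : 'M[K]_(m, n)) : evm None M 0 -> evm None (- M) 0.
Proof. by move=> h; rewrite -oppr0; exact: evmN. Qed.

Lemma liouville_mx m n (M : 'M[K]_(m, n)) : regO Hp M -> regO Hm M -> evm None M 0 -> M = 0.
Proof.
move=> hp hm h0; apply/matrixP => i j; rewrite mxE.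
have := h0 i j; rewrite mxE => /reg_everywhere0; apply=> a.
by case: (dom_or half_planes_cover a) => Ha; [exact: hp|exact: hm].
Qed.

Lemma resD n (A : 'M[C]_n) : (x%:M + kM A) *m res (- A) = 1%:M.
Proof. by rewrite -(mul_resolvent FF (- A)) kMN opprK. Qed.
Lemma resDr n (A : 'M[C]_n) : res (- A) *m (x%:M + kM A) = 1%:M.
Proof. by rewrite -(resolvent_mul FF (- A)) kMN opprK. Qed.

(** The equation says [Z = (x - A) Y - Y (x + B)]. A product of two resolvents around [Z] thus
    splits into a part with the poles of each, the partial fractions of the state space calculus. *)
Lemma sylvester n p (A : 'M[C]_n) (B : 'M[C]_p) (Y Z : 'M[C]_(n, p)) :
  A *m Y + Y *m B + Z = 0 ->
  res A *m kM Z *m res (- B) = kM Y *m res (- B) - res A *m kM Y.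
Proof.
move=> /(congr1 (fun M => kM M : 'M[K]__)); rewrite kM0 !kMD !kMM => /eqP.
rewrite addrC addr_eq0 => /eqP ->.
have -> : - (kM A *m kM Y + kM Y *m kM B) =
    (x%:M - kM A) *m kM Y - kM Y *m (x%:M + kM B).
  rewrite mulmxBl mulmxDr mul_scalar_mx mul_mx_scalar.
  by rewrite [in RHS]opprD [in RHS]addrACA subrr add0r opprD.
rewrite mulmxBr mulmxA resolvent_mul mul1mx mulmxBl; congr (_ - _).
by rewrite -!mulmxA resD mulmx1.
Qed.

(** For [Z = 0] the splitting gives [(x - A)^-1 Y = Y (x + B^* )^-1], with one side regular on the
    right and the other on the left; Liouville makes it 0. *)
Lemma sylvester_uniq n p (A : 'M[C]_n) (B : 'M[C]_p) (Y : 'M[C]_(n, p)) :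
  stab A -> stab B -> A *m Y + Y *m B^t* = 0 -> Y = 0.
Proof.
move=> sA sB AY.
have := @sylvester _ _ A (B^t*) Y 0; rewrite addr0 => /(_ AY).
rewrite kM0 mulmx0 mul0mx => /esym/eqP; rewrite subr_eq0 => /eqP E.
have E0 : res A *m kM Y = 0.
  apply: liouville_mx.
  - by apply: regOM; [exact: regO_res|exact: regO_const].
  - by rewrite -E; apply: regOM; [exact: regO_const|exact: regO_resN].
  - by apply: evm0_mulr; [exact: resolvent_inf|exact: regm_const].
have : kM Y = 0 :> 'M[K]__ by rewrite -[kM Y]mul1mx -(mul_resolvent FF A) -mulmxA E0 mulmx0.
move/matrixP => Y0; apply/matrixP => i j; have := Y0 i j; rewrite !mxE /= => /eqP.
by rewrite ff_io_eq0 polyC_eq0 => /eqP.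
Qed.

Definition transfer m n (A : 'M[C]_n) (B : 'M[C]_(n, m)) (L : 'M[C]_(m, n)) (D : 'M[C]_m) : 'M[K]_m :=
  kM D + kM L *m res A *m kM B.
(** The field counterpart of [para_adj]: reflecting s and taking adjoints turns [(s - A)^-1] into
    [-(s + A^* )^-1], whence the minus sign. *)
Definition transfer_adj m n (A : 'M[C]_n) (B : 'M[C]_(n, m)) (L : 'M[C]_(m, n)) (D : 'M[C]_m) : 'M[K]_m :=
  kM (D^t*) - kM (B^t*) *m res (- A^t*) *m kM (L^t*).

Section One.
Variables (m n : nat) (A : 'M[C]_n) (B : 'M[C]_(n, m)) (L : 'M[C]_(m, n)) (D : 'M[C]_m).
Hypotheses (sA : stab A) (dA : dissipative A B L D).

Lemma regO_transfer : regO Hp (transfer A B L D).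
Proof.
apply: regOD; first exact: regO_const.
by apply: regOM; [apply: regOM; [exact: regO_const|exact: regO_res]|exact: regO_const].
Qed.

Lemma regO_transfer_adj : regO Hm (transfer_adj A B L D).
Proof.
apply: regOD; first exact: regO_const; apply: regON.
by apply: regOM; [apply: regOM; [exact: regO_const|exact: regO_resN]|exact: regO_const].
Qed.

(** Dissipativity writes [L^* L] as [(x - A) - (x + A^* )], which telescopes between the resolvents.
    Thus the para-adjoint moves all poles of [L (x - A)^-1] across the axis. *)
Lemma transfer_adj_obs : transfer_adj A B L D *m kM L *m res A = - (kM (B^t*) *m res (- A^t*)).
Proof.
rewrite /transfer_adj mulmxBl mulmxBl -kMM (dissDK dA) -(mulmxA _ (kM (L^t*))) -kMM (dissKK dA).
rewrite !kMN mulNmx mulmxN mulNmx opprK -!mulmxA.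
have -> : res (- A^t*) *m (kM (A + A^t*) *m res A) = res A - res (- A^t*).
  have -> : kM (A + A^t*) = (x%:M + kM (A^t*)) - (x%:M - kM A).
    by rewrite kMD opprB [kM A - _]addrC addrACA subrr add0r addrC.
  by rewrite mulmxBl mul_resolvent mulmxBr mulmx1 mulmxA resDr mul1mx.
by rewrite mulmxBr addrA addNr add0r.
Qed.

Lemma transfer_adjK : transfer_adj A B L D *m transfer A B L D = 1%:M.
Proof.
rewrite /transfer mulmxDr !mulmxA transfer_adj_obs mulNmx.
rewrite /transfer_adj mulmxBl -kMM.
case: (dA) => _ /unitary_adj[_ ->] _; rewrite kM1 -(mulmxA _ (kM (L^t*))) -kMM (dissKD dA).
by rewrite kMN mulmxN opprK addrK.
Qed.

Lemma transferK : transfer A B L D *m transfer_adj A B L D = 1%:M.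
Proof. exact: mulmx1C transfer_adjK. Qed.

(** Multiplying by [L^*] gives [(x + A^* )^-1 y = (x - A)^-1 y]. The sides are regular on opposite
    half planes, so both are 0. *)
Lemma observability (y : 'cV[C]_n) : kM L *m res A *m kM y = 0 -> y = 0.
Proof.
move=> h; have /(congr1 (mulmx (transfer_adj A B L D))) := h.
rewrite mulmx0 !mulmxA transfer_adj_obs mulNmx => /eqP; rewrite oppr_eq0 => /eqP h'.
have : kM (L^t*) *m (kM L *m res A *m kM y) = 0 by rewrite h mulmx0.
rewrite !mulmxA -kMM (dissKK dA).
have -> : kM (- (A + A^t*)) = (x%:M - kM A) - (x%:M + kM (A^t*)).
  by rewrite kMN kMD opprD [in RHS]opprD addrACA addrN add0r.
rewrite (mulmxBl (x%:M - kM A) _ (res A)) mul_resolvent mulmxBl mul1mx => /eqP; rewrite subr_eq0 => /eqP E.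
have E' : res (- A^t*) *m kM y = res A *m kM y.
  by rewrite {1}E !mulmxA resDr mul1mx.
have E0 : res A *m kM y = 0.
  apply: liouville_mx.
  - by apply: regOM; [exact: regO_res|exact: regO_const].
  - by rewrite -E'; apply: regOM; [exact: regO_resN|exact: regO_const].
  - by apply: evm0_mulr; [exact: resolvent_inf|exact: regm_const].
have : kM y = 0 :> 'M[K]__ by rewrite -[kM y]mul1mx -(mul_resolvent FF A) -mulmxA E0 mulmx0.
move/matrixP => Y0; apply/matrixP => i j; have := Y0 i j; rewrite !mxE /= => /eqP.
by rewrite ff_io_eq0 polyC_eq0 => /eqP.
Qed.

(* Partial fractions: all poles of [res A *m (kM B *m u)] in the open left half
   plane come from [res A], so this part is [res A] times a constant vector. *)
Lemma resolvent_split (u : 'cV[K]_m) : regO Hm u -> evm None u 0 ->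
  exists x0 : 'cV[C]_n, regO Hm (res A *m (kM B *m u) - res A *m kM x0).
Proof.
move=> um u0; pose b := res A *m (kM B *m u).
have b0 : evm None b 0.
  apply: evm0_mulr; first exact: resolvent_inf.
  by apply: regmM; [exact: regm_const|exact: evm_reg u0].
have b0' i : ev None (b i 0) 0 by have := b0 i 0; rewrite zeromxE.
have [f fP] := choice (fun i => ev_split Hp (b0' i)).
have [g gP] := choice fP.
pose a := \col_i f i; pose h := \col_i g i.
have bE : b = a + h.
  by apply/matrixP => i j; rewrite [RHS]mxE [a i j]mxE [h i j]mxE ord1; case: (gP i).
have a0 : evm None a 0 by move=> i j; rewrite !mxE; case: (gP i) => _ [].
have ar s : Hp s -> regm (Some s) a by move=> Hs i j; rewrite mxE; case: (gP i) => _ _ /(_ s Hs).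
have hr : regO Hm h.
  move=> [s|] Hs; last by move=> i j; rewrite mxE; case: (gP i) => _ [_ /regP].
  have [Hps|Hps] := pselect (Hp s); last by move=> i j; rewrite mxE; case: (gP i) => _ _ _ /(_ s Hps).
  have -> : h = b - a by rewrite bE addrAC subrr add0r.
  apply: regmD; last by apply: regmN; exact: ar.
  apply: regmM; first exact: (@regO_res _ A sA (Some s) Hps).
  by apply: regmM; [exact: regm_const|exact: (um (Some s) Hs)].
have xr s : regm (Some s) (x%:M - kM A).
  apply: regmD; last by apply: regmN; exact: regm_const.
  exact: (evm_reg (evm_scalar (evX s))).
have xaE : (x%:M - kM A) *m a = kM B *m u - (x%:M - kM A) *m h.
  have -> : a = b - h by rewrite bE addrK.
  by rewrite mulmxBr mulmxA mul_resolvent mul1mx.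
have cst i : exists c, ((x%:M - kM A) *m a) i 0 = io c%:P.
  apply: reg_everywhere => -[s|].
    have [Hs|Hs] := half_planes_cover s; first by apply: regmM; [exact: xr|exact: ar].
    rewrite xaE; apply: regmD.
      by apply: regmM; [exact: regm_const|exact: (um (Some s) Hs)].
    by apply: regmN; apply: regmM; [exact: xr|exact: (hr (Some s) Hs)].
  rewrite mulmxBl mxE; apply: regD; last first.
    rewrite mxE; apply: regN.
    by apply: (@regmM _ _ None); [exact: regm_const|exact: evm_reg a0].
  rewrite mul_scalar_mx mxE; apply: (@ev_mu _ _ None 'X); first by rewrite size_polyX.
  by have := a0 i 0; rewrite zeromxE.
have [c cP] := choice cst.
exists (\col_i c i).
have -> : kM (\col_i c i) = (x%:M - kM A) *m a.
  by apply/matrixP => i j; rewrite ord1 cP !mxE.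
by rewrite (mulmxA (res A) (x%:M - kM A) a) resolvent_mul mul1mx -/b bE addrAC subrr add0r.
Qed.

End One.

Section Symbol.
Variables (m nv nw : nat).
Variables (Av : 'M[C]_nv) (Bv : 'M[C]_(nv, m)) (Cv : 'M[C]_(m, nv)) (Dv : 'M[C]_m).
Variables (Aw : 'M[C]_nw) (Bw : 'M[C]_(nw, m)) (Cw : 'M[C]_(m, nw)) (Dw : 'M[C]_m).
Variables (Om : 'M[C]_(nv, nw)).
Hypotheses (sv : stab Av) (dv : dissipative Av Bv Cv Dv).
Hypotheses (sw : stab Aw) (dw : dissipative Aw Bw Cw Dw).
Hypothesis (lyapO : Av *m Om + Om *m Aw^t* + Bv *m Bw^t* = 0).
Let Co := Dv *m Bw^t* + Cv *m Om.

Definition symbolK : 'M[K]_m := transfer Av Bv Cv Dv *m transfer_adj Aw Bw Cw Dw.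

Lemma symbolK_inv : symbolK *m (transfer Aw Bw Cw Dw *m transfer_adj Av Bv Cv Dv) = 1%:M.
Proof.
rewrite mulmxA -(mulmxA (transfer Av _ _ _)) transfer_adjK // mulmx1.
exact: transferK.
Qed.

Lemma symbolK_unit : symbolK \in unitmx.
Proof. by case: (mulmx1_unit symbolK_inv). Qed.

Lemma symbolK_reg a : dom Hp a -> dom Hm a -> regm a symbolK.
Proof. by move=> ap am; apply: regmM; [exact: regO_transfer|exact: regO_transfer_adj]. Qed.

Lemma symbolK_inv_reg a : dom Hp a -> dom Hm a -> regm a (invmx symbolK).
Proof.
move=> ap am.
have -> : invmx symbolK = transfer Aw Bw Cw Dw *m transfer_adj Av Bv Cv Dv.
  by rewrite -[LHS]mulmx1 -symbolK_inv mulKmx // symbolK_unit.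
by apply: regmM; [exact: regO_transfer|exact: regO_transfer_adj].
Qed.

(** The difference [1 - Q - Omega^* Omega] solves the homogeneous Lyapunov equation of the stable
    [A_w]: after expanding [C_o^* C_o] by dissipativity of [V], every term cancels. *)
Lemma I_minus_Q (Q : 'M[C]_nw) : Aw *m Q + Q *m Aw^t* + Co^t* *m Co = 0 ->
  1%:M - Q = Om^t* *m Om.
Proof.
move=> lyapQ; apply/eqP; rewrite -subr_eq0; apply/eqP; apply: (sylvester_uniq sw sw).
have lyapO' : Om^t* *m Av^t* + Aw *m Om^t* + Bw *m Bv^t* = 0.
  by rewrite -[RHS](adjmx0 C nv nw) -lyapO !adjmxD !adjmxM !trmxCK.
have AO : Aw *m Om^t* = - (Om^t* *m Av^t*) - Bw *m Bv^t*.
  by move/eqP: lyapO'; rewrite addrAC addrC addr_eq0 opprD => /eqP ->; rewrite addrC.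
have OA : Om *m Aw^t* = - (Av *m Om) - Bv *m Bw^t*.
  by move/eqP: lyapO; rewrite addrAC addrC addr_eq0 opprD => /eqP ->; rewrite addrC.
have QE : Aw *m Q + Q *m Aw^t* = - (Co^t* *m Co) by move/eqP: lyapQ; rewrite addr_eq0 => /eqP.
have CC : Co^t* *m Co = Bw *m Bw^t* - Bw *m Bv^t* *m Om - Om^t* *m Bv *m Bw^t*
    - Om^t* *m (Av + Av^t*) *m Om.
  rewrite /Co adjmxD !adjmxM trmxCK mulmxDl !mulmxDr.
  have -> : Bw *m Dv^t* *m (Dv *m Bw^t*) = Bw *m Bw^t*.
    by case: dv => _ /unitary_adj[_ DD] _; rewrite -mulmxA (mulmxA (Dv^t*)) DD mul1mx.
  rewrite -(mulmxA Bw) (mulmxA (Dv^t*)) (dissDK dv) mulNmx mulmxN mulmxA.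
  rewrite -(mulmxA (Om^t*)) (mulmxA (Cv^t*)) (dissKD dv) mulNmx mulmxN !mulmxA.
  rewrite -(mulmxA (Om^t*) (Cv^t*)) (dissKK dv) mulmxN mulNmx.
  by rewrite !(mulmxDr, mulmxDl) addrA.
have -> : Aw *m (1%:M - Q - Om^t* *m Om) + (1%:M - Q - Om^t* *m Om) *m Aw^t* =
   (Aw + Aw^t*) - (Aw *m Q + Q *m Aw^t*) - (Aw *m Om^t* *m Om + Om^t* *m (Om *m Aw^t*)).
  rewrite !mulmxBr !mulmxBl mulmx1 mul1mx -!mulmxA.
  move: Aw (Aw^t*) (Aw *m Q) (Q *m Aw^t*) (Aw *m (Om^t* *m Om)) (Om^t* *m (Om *m Aw^t*)) => a b c d e f.
  by rewrite addrACA -opprD addrACA -opprD.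
rewrite QE CC AO OA opprK.
have -> : Aw + Aw^t* = - (Bw *m Bw^t*) by rewrite (dissBB dw) opprK.
rewrite !(mulmxBl, mulmxBr, mulmxDl, mulmxDr, mulNmx, mulmxN) !mulmxA.
move: (Bw *m Bw^t*) (Bw *m Bv^t* *m Om) (Om^t* *m Bv *m Bw^t*) (Om^t* *m Av *m Om)
  (Om^t* *m Av^t* *m Om) => a b c d e.
apply/matrixP => i j; rewrite !mxE; ring.
Qed.

(** The first term has its poles in the left half plane, the second in the right one. For
    [Omega y = 0] only the second survives, so such [y] give elements of the kernel. *)
Lemma symbolK_obs : symbolK *m kM Cw *m res Aw =
  kM Cv *m res Av *m kM Om - kM Co *m res (- Aw^t*).
Proof.
rewrite /symbolK -!mulmxA [_ *m (kM Cw *m _)]mulmxA transfer_adj_obs //.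
rewrite mulmxN /transfer mulmxDl opprD.
have -> : kM Cv *m res Av *m kM Bv *m (kM (Bw^t*) *m res (- Aw^t*)) =
   kM Cv *m (kM Om *m res (- Aw^t*) - res Av *m kM Om).
  by rewrite -(sylvester lyapO) kMM !mulmxA.
by rewrite mulmxBr opprB addrC addrAC -addrA -opprD /Co kMD !kMM mulmxDl !mulmxA.
Qed.

Lemma symbolK_kernel (f : 'cV[K]_m) :
  (regO Hp f /\ evm None f 0) /\ (regO Hm (symbolK *m f) /\ evm None (symbolK *m f) 0) <->
  exists2 x0 : 'cV[C]_nw, Om *m x0 = 0 & f = kM Cw *m res Aw *m kM x0.
Proof.
split=> [[[fr f0] [gr g0]]|[x0 Ox0 ->]]; last first.
  have e : symbolK *m (kM Cw *m res Aw *m kM x0) = - (kM Co *m res (- Aw^t*) *m kM x0).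
    by rewrite !mulmxA symbolK_obs mulmxBl -(mulmxA _ (kM Om)) -kMM Ox0 kM0 mulmx0 sub0r.
  have r0 n (A : 'M[C]_n) p (M : 'M[C]_(p, n)) (y : 'cV[C]_n) : evm None (kM M *m res A *m kM y : 'M[K]__) 0.
    by apply: evm0_mulr; [apply: evm_reg0; [exact: regm_const|exact: resolvent_inf]|exact: regm_const].
  split; split.
  - by apply: regOM; [apply: regOM; [exact: regO_const|exact: regO_res]|exact: regO_const].
  - exact: r0.
  - rewrite e; apply: regON.
    by apply: regOM; [apply: regOM; [exact: regO_const|exact: regO_resN]|exact: regO_const].
  - by rewrite e; apply: evm0N; exact: r0.
(* Besides [u = W^* f] one has [u = V^* (R f)], which shows that [u] is regular on the left and zero
   at infinity. *)
pose u := transfer_adj Aw Bw Cw Dw *m f.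
have uE : u = transfer_adj Av Bv Cv Dv *m (symbolK *m f).
  by rewrite /symbolK !mulmxA transfer_adjK // mul1mx.
have um : regO Hm u by rewrite uE; apply: regOM => //; exact: regO_transfer_adj.
have u0 : evm None u 0.
  by rewrite uE; apply: evm_reg0 => //; apply: (regO_inf (H := Hm)); exact: regO_transfer_adj.
have fE : f = kM Dw *m u + kM Cw *m (res Aw *m (kM Bw *m u)).
  have <- : transfer Aw Bw Cw Dw *m u = f by rewrite /u mulmxA transferK // mul1mx.
  by rewrite /transfer mulmxDl -!mulmxA.
have [x0 x0P] := resolvent_split Bw sw um u0.
have r0 : evm None (res Aw *m kM x0) 0.
  by apply: evm0_mulr; [exact: resolvent_inf|exact: regm_const].
(* On the right [f] is regular by assumption; on the left [f = W u], and [x0] was chosen to remove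
   the poles that [(x - A_w)^-1 B_w u] has there. *)
have f1 : f - kM Cw *m (res Aw *m kM x0) = 0.
  apply: liouville_mx.
  - apply: regOD => //; apply: regON; apply: regOM; first exact: regO_const.
    by apply: regOM; [exact: regO_res|exact: regO_const].
  - rewrite fE -addrA -mulmxBr; apply: regOD; apply: regOM => //; exact: regO_const.
  - by apply: evm0D => //; apply: evm0N; apply: evm_reg0 => //; exact: regm_const.
have fx0 : f = kM Cw *m res Aw *m kM x0 by rewrite -mulmxA; apply/eqP; rewrite -subr_eq0 f1.
exists x0 => //.
apply: (observability sv dv).
(* The left side is regular on the right half plane, the right side on the left one, so both vanish
   and observability of [V] gives [Omega x0 = 0]. *)
have E : kM Cv *m res Av *m kM (Om *m x0) = symbolK *m f + kM Co *m res (- Aw^t*) *m kM x0.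
  by rewrite fx0 !mulmxA symbolK_obs mulmxBl subrK kMM mulmxA.
apply: liouville_mx.
- by apply: regOM; [apply: regOM; [exact: regO_const|exact: regO_res]|exact: regO_const].
- rewrite E; apply: regOD => //.
  by apply: regOM; [apply: regOM; [exact: regO_const|exact: regO_resN]|exact: regO_const].
- apply: evm0_mulr; last exact: regm_const.
  by apply: evm_reg0; [exact: regm_const|exact: resolvent_inf].
Qed.

End Symbol.
End StateSpace.

(** * The Wiener-Hopf indices and the kernel of Omega *)

(** A total linear relation with trivial kernel contains the graph of an injective map. Working with
    relations avoids constructing an isomorphism between the solutions and their numerators. *)
Lemma linear_relation_le (F : fieldType) d d' (P : 'rV[F]_d -> 'rV[F]_d' -> Prop) :
  (forall a x y x' y', P x y -> P x' y' -> P (a *: x + x') (a *: y + y')) ->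
  (forall x, exists y, P x y) -> (forall x, P x 0 -> x = 0) -> (d <= d')%N.
Proof.
move=> lin tot inj0.
have P00 : P 0 0.
  have [y Py] := tot 0; have := lin (-1) 0 y 0 y Py Py.
  by rewrite scaler0 addr0 scaleN1r addNr.
have [f fP] := choice (fun i : 'I_d => tot (delta_mx 0 i)).
pose M := \matrix_i f i.
suff PM x : P x (x *m M).
  rewrite -[X in (X <= _)%N](_ : \rank M = d); first exact: rank_leq_col.
  apply/eqP; rewrite -[_ == _]/(row_free M) -kermx_eq0.
  apply/rowV0P => v /sub_kermxP vM; apply: inj0; rewrite -vM; exact: PM.
rewrite mulmx_sum_row [X in P X _](row_sum_delta x).
elim/big_ind2: _ => //.
- by move=> x1 y1 x2 y2 h1 h2; have := lin 1 _ _ _ _ h1 h2; rewrite !scale1r.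
- by move=> i _; have := lin (x 0 i) _ _ _ _ (fP i) P00; rewrite !addr0 rowK.
Qed.

Lemma linear_relation_dim (F : fieldType) d d' (P : 'rV[F]_d -> 'rV[F]_d' -> Prop) :
  (forall a x y x' y', P x y -> P x' y' -> P (a *: x + x') (a *: y + y')) ->
  (forall x, exists y, P x y) -> (forall y, exists x, P x y) ->
  (forall x, P x 0 -> x = 0) -> (forall y, P 0 y -> y = 0) -> d = d'.
Proof.
move=> lin tot1 tot2 inj1 inj2; apply/eqP; rewrite eqn_leq (linear_relation_le lin) //=.
by apply: (linear_relation_le (P := fun y x => P x y)) => // *; exact: lin.
Qed.

Lemma gram_eq0 (C : numClosedFieldType) q (y : 'cV[C]_q) : y^t* *m y = 0 -> y = 0.
Proof.
move=> /matrixP/(_ 0 0); rewrite !mxE => /eqP.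
rewrite psumr_eq0 => [/allP H|i _]; last by rewrite !mxE mulrC mul_conjC_ge0.
apply/matrixP => i j; rewrite ord1 [RHS]mxE.
by have := H i (mem_index_enum _); rewrite !mxE /= mulrC mul_conjC_eq0 => /eqP.
Qed.

Lemma gram_kernel (C : numClosedFieldType) p q (M : 'M[C]_(p, q)) (x : 'cV[C]_q) :
  M^t* *m M *m x = 0 <-> M *m x = 0.
Proof.
split=> [h|h]; last by rewrite -mulmxA h mulmx0.
by apply: gram_eq0; rewrite adjmxM -mulmxA (mulmxA (M^t*)) h mulmx0.
Qed.

Definition negpart (l : int) : nat := if l < 0 then `|l|%N else 0%N.

Section Dimension.
Variables (C : numClosedFieldType) (FF : fracfield C).
Local Notation K := (ff_sort FF).
Local Notation io := (ff_io FF).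
Local Notation "p %:F" := (io p).
Local Notation kM M := (map_mx (io \o polyC) M).
Local Notation res := (resolvent FF).
Local Notation ztF := (zt FF).
Variables Hp Hm : C -> Prop.
Hypotheses (half_planes_cover : forall s, Hp s \/ Hm s) (right_excludes_N1 : ~ Hp (-1)) (left_excludes_1 : ~ Hm 1)
  (reflect_left : forall s, Hm s -> Hp (- s^*)).

Let regP1 s : Hp s -> forall n, ((1 + 'X) ^+ n).[s] != 0.
Proof.
move=> Hs n; rewrite horner_exp expf_neq0 //.
by rewrite hornerD hornerC hornerX addrC addr_eq0; apply: contra_notN right_excludes_N1 => /eqP <-.
Qed.

Let regM1 s : Hm s -> forall n, ((1 - 'X) ^+ n).[s] != 0.
Proof.
move=> Hs n; rewrite horner_exp expf_neq0 //.
by rewrite hornerD hornerC hornerN hornerX subr_eq0; apply: contra_notN left_excludes_1 => /eqP ->.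
Qed.

Lemma size_1mXn n : size ((1 - 'X) ^+ n : {poly C}) = n.+1.
Proof.
have /prednK <- : (0 < size ((1 - 'X) ^+ n : {poly C}))%N.
  by rewrite size_poly_gt0 expf_neq0 // -size_poly_eq0 size_1mX.
by rewrite size_exp size_1mX mul1n.
Qed.

(** The scalar problem with symbol [zeta^l]. For [l = -n < 0] the product [(1+x)^n g] has no finite
    pole, and the zero of [g] at infinity bounds its degree below n; for [l >= 0] Liouville gives
    0. *)
Lemma wh_componentP (l : int) (g : K) :
  (forall a, dom Hp a -> reg a g) -> ev None g 0 ->
  (forall a, dom Hm a -> reg a (ztF ^ l * g)) -> ev None (ztF ^ l * g) 0 ->
  exists2 p : {poly C}, (size p <= negpart l)%N & g = p%:F / (1 + 'X)%:F ^+ negpart l.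
Proof.
move=> gr g0 hr h0; rewrite /negpart; case: ltP => l0; last first.
  exists 0; rewrite ?size_poly0 // rmorph0 mul0r.
  apply: (reg_everywhere0 _ g0) => a; case: (dom_or half_planes_cover a) => Ha; first exact: gr.
  have -> : g = ztF ^ (- l) * (ztF ^ l * g).
    by rewrite mulrA -exprzDr ?unitfE ?zt_neq0 // addNr expr0z mul1r.
  by apply: regM; [apply: (reg_ztXN _ left_excludes_1) => //; rewrite oppr_le0|exact: hr].
have xp0 n : (1 + 'X)%:F ^+ n != 0 :> K by rewrite expf_neq0 // X1p_neq0.
have xm0 n : (1 - 'X)%:F ^+ n != 0 :> K by rewrite expf_neq0 // X1m_neq0.
have [n lE] : exists n, l = - (n%:Z) by exists `|l|%N; move: l0; clear; case: l => //; lia.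
subst l; rewrite abszN /=.
have [p pE] : exists p : {poly C}, (1 + 'X)%:F ^+ n * g = p%:F.
  apply: reg_finite_poly => s; case: (half_planes_cover s) => Hs.
    by apply: regM; [rewrite -rmorphXn; exact: regP (ev_poly _ _)|exact: gr].
  have -> : (1 + 'X)%:F ^+ n * g = (1 - 'X)%:F ^+ n * (ztF ^ (- n%:Z) * g).
    rewrite mulrA; congr (_ * _); rewrite -exprnN -exprVn /zt invf_div expr_div_n.
    by rewrite mulrC divfK.
  by apply: regM; [rewrite -rmorphXn; exact: regP (ev_poly _ _)|exact: hr].
have gE : g = p%:F / (1 + 'X)%:F ^+ n by rewrite -pE mulrC mulKf.
exists p => //; rewrite -ltnS -(size_1pXn C n).
apply: (ev_inf_size (F := FF)); first by rewrite -size_poly_gt0 size_1pXn.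
by rewrite rmorphXn -gE.
Qed.

Lemma wh_component_reg (l : int) (p : {poly C}) : (size p <= negpart l)%N ->
  let g := p%:F / (1 + 'X)%:F ^+ negpart l in
  [/\ forall a, dom Hp a -> reg a g, ev None g 0,
      forall a, dom Hm a -> reg a (ztF ^ l * g) & ev None (ztF ^ l * g) 0].
Proof.
rewrite /negpart; case: ltP => l0; last first.
  rewrite leqn0 size_poly_eq0 => /eqP ->.
  by rewrite rmorph0 mul0r mulr0; split=> *; (exact: reg0 || exact: ev0).
have xp0 n : (1 + 'X)%:F ^+ n != 0 :> K by rewrite expf_neq0 // X1p_neq0.
have [n lE] : exists n, l = - (n%:Z) by exists `|l|%N; move: l0; clear; case: l => //; lia.
subst l; rewrite abszN /= => sp.
have e1 : ev None (p%:F / (1 + 'X)%:F ^+ n) 0.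
  by rewrite -rmorphXn; apply: ev_inf0; rewrite size_1pXn.
have e2 : ztF ^ (- n%:Z) * (p%:F / (1 + 'X)%:F ^+ n) = p%:F / (1 - 'X)%:F ^+ n.
  rewrite -exprnN -exprVn /zt invf_div expr_div_n mulrCA; congr (_ * _).
  by rewrite mulrAC divff // mul1r.
have e3 : ev None (p%:F / (1 - 'X)%:F ^+ n) 0.
  by rewrite -rmorphXn; apply: ev_inf0; rewrite size_1mXn.
split=> //; rewrite ?e2 // => -[s|] Hs; try exact: regP e1; try exact: regP e3.
- by apply: regM; [exact: regP (ev_poly _ _)|rewrite -rmorphXn; apply: regV_poly; exact: regP1].
- by apply: regM; [exact: regP (ev_poly _ _)|rewrite -rmorphXn; apply: regV_poly; exact: regM1].
Qed.

Section Count.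
Variables (m nv nw : nat).
Variables (Av : 'M[C]_nv) (Bv : 'M[C]_(nv, m)) (Cv : 'M[C]_(m, nv)) (Dv : 'M[C]_m).
Variables (Aw : 'M[C]_nw) (Bw : 'M[C]_(nw, m)) (Cw : 'M[C]_(m, nw)) (Dw : 'M[C]_m).
Variables (Om : 'M[C]_(nv, nw)).
Hypotheses (sv : stab Hp Av) (dv : dissipative Av Bv Cv Dv).
Hypotheses (sw : stab Hp Aw) (dw : dissipative Aw Bw Cw Dw).
Hypothesis (lyapO : Av *m Om + Om *m Aw^t* + Bv *m Bw^t* = 0).
Local Notation S := (symbolK FF Av Bv Cv Dv Aw Bw Cw Dw).
Variables (lam : 'I_m -> int) (Wm Wp : 'M[K]_m).
Hypotheses (Wmu : Wm \in unitmx) (Wpu : Wp \in unitmx).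
Hypotheses (Wmr : regO Hm Wm) (WmVr : regO Hm (invmx Wm)).
Hypotheses (Wpr : regO Hp Wp) (WpVr : regO Hp (invmx Wp)).
Hypothesis (fact : S = Wm *m diag_mx (\row_i ztF ^ lam i) *m Wp).

Let N := (kermx (Om^t* *m Om)^T).
Let state (x : 'rV[C]_(\rank N)) : 'cV[C]_nw := (x *m row_base N)^T.
Let sol (x : 'rV[C]_(\rank N)) : 'cV[K]_m := kM Cw *m res Aw *m kM (state x).
(** The vector [y] lists the coefficients of one numerator for each index: block [i] is a polynomial
    of size at most [negpart (lam i)]. *)
Let ps (y : 'rV[C]_(\sum_i negpart (lam i))) i : {poly C} := rVpoly (submxrow y i).
Let P x y := forall i, (Wp *m sol x) i 0 = (ps y i)%:F / (1 + 'X)%:F ^+ negpart (lam i).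

Lemma state_ker x : Om *m state x = 0.
Proof.
apply/gram_kernel; apply: trmx_inj; rewrite trmx_mul trmx0 /state trmxK.
by apply/sub_kermxP; rewrite -[X in (_ <= X)%MS]/N; apply: submx_trans (submxMl _ _) _; rewrite eq_row_base.
Qed.

Lemma state_surj (x0 : 'cV[C]_nw) : Om *m x0 = 0 -> exists x, state x = x0.
Proof.
move=> Ox0; have : (x0^T <= row_base N)%MS.
  rewrite eq_row_base; apply/sub_kermxP; rewrite -trmx_mul -mulmxA Ox0 mulmx0 trmx0 //.
by move=> /submxP[x xE]; exists x; rewrite /state -xE trmxK.
Qed.

Lemma sol_eq0 x : sol x = 0 -> x = 0.
Proof.
move=> /(observability half_planes_cover reflect_left sw dw) /(congr1 trmx); rewrite /state trmxK trmx0.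
by move=> h; apply: (row_free_inj (row_base_free N)); rewrite h mul0mx.
Qed.

Lemma stateL a x x' : state (a *: x + x') = a *: state x + state x'.
Proof. by rewrite /state mulmxDl -scalemxAl linearD linearZ. Qed.

Lemma psL a y y' i : ps (a *: y + y') i = a *: ps y i + ps y' i.
Proof.
rewrite /ps -linearP; congr (rVpoly _).
by apply/matrixP => k l; rewrite !mxE.
Qed.

Lemma ps0 i : ps 0 i = 0.
Proof. by have := psL (-1) 0 0 i; rewrite scaler0 addr0 scaleN1r addNr. Qed.

(** In the variable [g = W_+ f] the problem decouples into the scalar problems with symbols
    [zeta^lam_i], because [W_-], [W_+] and their inverses preserve regularity on their half
    planes. *)
Theorem wh_dimension : \rank N = (\sum_i negpart (lam i))%N.
Proof.
apply: (linear_relation_dim (P := P)).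
- move=> a x y x' y' h h' i; rewrite /sol stateL map_mxD map_mxZ /= !mulmxDr -!scalemxAr.
  rewrite mxE scalemxE h h' psL (rmorphD io (a *: ps y i)) /= -mul_polyC (rmorphM io a%:P).
  by rewrite mulrDl mulrA.
- move=> x.
  have [_ /(_ _)] := symbolK_kernel half_planes_cover reflect_left sv dv sw dw lyapO (sol x).
  move=> /(_ (ex_intro2 _ _ (state x) (state_ker x) erefl)) [[fr f0] [gr g0]].
  pose g := Wp *m sol x.
  have gE : diag_mx (\row_i ztF ^ lam i) *m g = invmx Wm *m (S *m sol x).
    by rewrite fact -!mulmxA mulKmx.
  have cE i : ztF ^ lam i * g i 0 = (invmx Wm *m (S *m sol x)) i 0.
    by rewrite -gE mul_diag_mx !mxE.
  have gOr : regO Hp g by apply: regOM.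
  have g0' : evm None g 0 by apply: evm_reg0 => //; exact: (Wpr (a := None)).
  have hOr : regO Hm (invmx Wm *m (S *m sol x)) by apply: regOM.
  have h0 : evm None (invmx Wm *m (S *m sol x)) 0 by apply: evm_reg0 => //; exact: (WmVr (a := None)).
  have H i : exists2 p : {poly C}, (size p <= negpart (lam i))%N &
       g i 0 = p%:F / (1 + 'X)%:F ^+ negpart (lam i).
    apply: wh_componentP.
    - by move=> a Ha; exact: gOr.
    - by have := g0' i 0; rewrite zeromxE.
    - by move=> a Ha; rewrite cE; exact: hOr.
    - by rewrite cE; have := h0 i 0; rewrite zeromxE.
  have [p pP] := choice (fun i => let: ex_intro2 p h1 h2 := H i in ex_intro _ p (conj h1 h2)).
  exists (\mxrow_i poly_rV (p i)) => i; rewrite /ps mxrowK.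
  by case: (pP i) => sp; rewrite poly_rV_K.
- move=> y.
  pose g : 'cV[K]_m := \col_i ((ps y i)%:F / (1 + 'X)%:F ^+ negpart (lam i)).
  have H i := @wh_component_reg (lam i) (ps y i) (size_poly _ _).
  have gr : regO Hp g by move=> a Ha i j; rewrite mxE; case: (H i) => /(_ a Ha).
  have g0 : evm None g 0 by move=> i j; rewrite !mxE; case: (H i).
  have hE i j : (diag_mx (\row_i ztF ^ lam i) *m g) i j = ztF ^ lam i * g i 0.
    by rewrite mul_diag_mx !mxE.
  have hr : regO Hm (diag_mx (\row_i ztF ^ lam i) *m g).
    by move=> a Ha i j; rewrite hE mxE; case: (H i) => _ _ /(_ a Ha).
  have h0 : evm None (diag_mx (\row_i ztF ^ lam i) *m g) 0.
    by move=> i j; rewrite hE !mxE; case: (H i).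
  pose f := invmx Wp *m g.
  have SfE : S *m f = Wm *m (diag_mx (\row_i ztF ^ lam i) *m g).
    by rewrite /f fact -!mulmxA mulKVmx.
  have [x0 Ox0 fx0] : exists2 x0 : 'cV[C]_nw, Om *m x0 = 0 & f = kM Cw *m res Aw *m kM x0.
    apply/(symbolK_kernel half_planes_cover reflect_left sv dv sw dw lyapO).
    rewrite SfE; split; split.
    - exact: regOM.
    - by apply: evm_reg0 => //; exact: (WpVr (a := None)).
    - exact: regOM.
    - by apply: evm_reg0 => //; exact: (Wmr (a := None)).
  have [x xE] := state_surj Ox0; exists x => i.
  by rewrite /sol xE -fx0 /f mulKVmx // mxE.
- move=> x h; apply: sol_eq0; rewrite -[LHS](mulKmx Wpu).
  suff -> : Wp *m sol x = 0 by rewrite mulmx0.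
  apply/matrixP => i j; by rewrite ord1 h mxE ps0 rmorph0 mul0r.
- move=> y h; rewrite -[y]submxrowK -[RHS]submxrowK; apply: eq_mxrow => i.
  have := h i; rewrite (_ : sol 0 = 0); last first.
    by rewrite /sol /state mul0mx trmx0 map_mx0 mulmx0.
  rewrite mulmx0 zeromxE => /esym/eqP; rewrite mulf_eq0 invr_eq0 expf_eq0.
  rewrite (negPf (X1p_neq0 _)) andbF orbF ff_io_eq0 => /eqP psy0.
  apply: (can_inj rVpolyK); rewrite -/(ps y i) -/(ps 0 i) psy0 ps0 //.
Qed.

End Count.
End Dimension.

(** * Analytic functions and elements of the rational function field *)

Section PolyTopology.
Variable C : numFieldType.
Implicit Types (p q : {poly C}) (s : C).

Lemma horner_derivable p (s : C^o) : derivable (horner p : C^o -> C^o) s 1.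
Proof.
elim/poly_ind: p => [|p c IH].
  by rewrite (_ : horner 0 = cst 0) ?funeqE => [|x]; [exact: derivable_cst|rewrite horner0].
rewrite (_ : horner _ = (horner p : C^o -> C^o) * id + cst c).
  by apply: derivableD; [apply: derivableM => //; exact: derivable_id|exact: derivable_cst].
by apply/funext => x; rewrite hornerMXaddC.
Qed.

Lemma derivable_continuous1 (f : C^o -> C^o) s : derivable f s 1 -> {for s, continuous f}.
Proof. by move/derivable1_diffP; exact: differentiable_continuous. Qed.

Lemma horner_continuous p : continuous (horner p : C^o -> C^o).
Proof. by move=> s; apply: derivable_continuous1; exact: horner_derivable. Qed.

Lemma near_horner p s : p.[s] != 0 -> \forall z \near (s : C^o), p.[z] != 0.
Proof.
move=> ps; have H : {for (s : C^o), continuous (horner p : C^o -> C^o)} by exact: horner_continuous.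
exact: (@cvgr_neq0 _ (C^o) _ _ _ _ _ H ps).
Qed.

Lemma near_horner' p s : p != 0 -> \forall z \near (s : C^o)^', p.[z] != 0.
Proof.
move=> p0; have [q [k [qs pE]]] : exists q k, q.[s] != 0 /\ p = q * ('X - s%:P) ^+ k.
  have [k [q qs ->]] := multiplicity_XsubC p s; exists q, k; split => //.
  by move: qs; rewrite p0 /= /root.
have : \forall z \near (s : C^o)^', q.[z] != 0 by apply: cvg_within; exact: near_horner.
have : \forall z \near (s : C^o)^', z != s by exact: nbhs_dnbhs_neq.
apply: filter_app2; near=> z => zs qz.
by rewrite pE hornerM horner_exp hornerXsubC mulf_neq0 // expf_neq0 // subr_eq0.
Unshelve. all: by end_near. Qed.

Lemma cont_eq_punctured (f g : C^o -> C^o) (s : C^o) :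
  {for s, continuous f} -> {for s, continuous g} -> (\forall z \near s^', f z = g z) -> f s = g s.
Proof.
move=> cf cg fg.
have h1 : f z @[z --> s^'] --> f s by apply: cvg_trans cf; apply: cvg_app; exact: cvg_within.
have h2 : g z @[z --> s^'] --> g s by apply: cvg_trans cg; apply: cvg_app; exact: cvg_within.
have h3 : f z @[z --> s^'] --> g s.
  by apply: cvg_trans h2; apply: near_eq_cvg; near=> z; apply/esym; near: z.
exact: (cvg_unique _ h1 h3).
Unshelve. all: by end_near. Qed.

Lemma continuous_mul1 (f g : C^o -> C^o) (s : C^o) : {for s, continuous f} ->
  {for s, continuous g} -> {for s, continuous (fun z => f z * g z)}.
Proof. move=> cf cg. exact: (@cvgM C (C^o) (nbhs s) _ f g). Qed.

End PolyTopology.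

Section Bridge.
Variable R : realType.
Local Notation C := R[i].
Variable FF : fracfield C.
Local Notation K := (ff_sort FF).
Local Notation io := (ff_io FF).
Local Notation "p %:F" := (io p).

Lemma near_dnbhs0 (P : C -> Prop) :
  (\forall z \near (0 : C^o)^', P z) -> \forall z \near (0 : C^o), z != 0 -> P z.
Proof. by []. Qed.

Lemma ratio_derivable (g : C^o -> C^o) (p q : {poly C}) (s : C^o) : q.[s] != 0 ->
  (\forall z \near s, g z = p.[z] / q.[z]) -> \forall z \near s, derivable g z 1.
Proof.
move=> qs /near_join gE; near=> z.
apply: (@near_eq_derivable _ (C^o) (C^o) ((horner p : C^o -> C^o) * (fun u => (q.[u])^-1))).
  have : \forall u \near z, g u = p.[u] / q.[u] by near: z.
  by apply: filterS => u ->.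
apply: derivableM; first exact: horner_derivable.
apply: derivableV; last exact: horner_derivable.
by near: z; exact: near_horner.
Unshelve. all: by end_near. Qed.

Lemma holo_of_ev m (M : 'M[K]_m) (G : C -> 'M[C]_m) (s : C) :
  (\forall z \near (s : C^o), evm (Some z) M (G z)) -> holo_at G s.
Proof.
move=> H i j; have [p [q [ME [qs _]]]] := nbhs_singleton H i j.
apply: (@ratio_derivable _ p q) => //.
have := near_horner qs; apply: filter_app; move: H; apply: filterS => z Gz qz.
by apply: ev_uniq (Gz i j) _; exists p, q; rewrite ME.
Qed.

(** The polynomial [z^n p(1/z)], that is [p] in the coordinate at infinity; [n] may exceed the
    degree, so that numerator and denominator share it. *)
Definition revp n (p : {poly C}) := \poly_(k < n.+1) p`_(n - k).

Lemma revpE n (p : {poly C}) (z : C) : (size p <= n.+1)%N -> z != 0 ->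
  (revp n p).[z] = z ^+ n * p.[z^-1].
Proof.
move=> sp z0; rewrite horner_poly (horner_coef_wide _ sp) mulr_sumr.
rewrite (reindex_inj rev_ord_inj) /=; apply: eq_bigr => k _.
have kn : (k <= n)%N by rewrite -ltnS.
rewrite subSS subKn // mulrCA; congr (_ * _).
by rewrite exprVn expfB_cond ?(negPf z0) ?leq_subr // subKn.
Qed.

Lemma revp0 n (p : {poly C}) : (revp n p).[0] = p`_n.
Proof. by rewrite horner_coef0 coef_poly subn0. Qed.

Lemma near_infty_horner (q : {poly C}) : q != 0 -> \forall z \near (0 : C^o)^', q.[z^-1] != 0.
Proof.
move=> q0; pose nq := (size q).-1.
have sq : (size q <= nq.+1)%N by rewrite /nq; case: (size q).
have rq0 : revp nq q != 0.
  have : (revp nq q).[0] != 0 by rewrite revp0 lead_coef_eq0.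
  by apply: contraNneq => ->; rewrite horner0.
move: (nbhs_dnbhs_neq (0 : C^o)) (near_horner' 0 rq0); apply: filter_app2; near=> z => z0.
by apply: contraNneq => qz; rewrite revpE // qz mulr0.
Unshelve. all: by end_near. Qed.

Lemma ev_inf_near (x : K) v : ev None x v -> exists p q : {poly C}, [/\ q.[0] != 0, v = p.[0] / q.[0] &
  forall z, z != 0 -> q.[z] != 0 -> ev (Some z^-1) x (p.[z] / q.[z])].
Proof.
move=> [p [q [-> [q0 pq ->]]]]; pose n := (size q).-1.
have sq : (size q <= n.+1)%N by rewrite /n; case: (size q).
have sp : (size p <= n.+1)%N by exact: leq_trans pq sq.
exists (revp n p), (revp n q); rewrite !revp0; split=> //; first by rewrite lead_coef_eq0.
move=> z z0; rewrite !revpE // mulf_eq0 negb_or => /andP[zn qz].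
by exists p, q; split=> //; split=> //; rewrite -mulf_div divff // mul1r.
Qed.

Lemma reg_near (x : K) (s : C) : reg (Some s) x -> \forall z \near (s : C^o), reg (Some z) x.
Proof.
move=> [v [p [q [-> [qs _]]]]]; have := near_horner qs; apply: filterS => z qz.
by apply: (@regP _ _ _ _ (p.[z] / q.[z])); exists p, q.
Qed.

Lemma reg_near_inf (x : K) : reg None x -> \forall z \near (0 : C^o)^', reg (Some z^-1) x.
Proof.
move=> [v /ev_inf_near[p [q [q0 _ H]]]].
have : \forall z \near (0 : C^o)^', q.[z] != 0 by apply: cvg_within; exact: near_horner.
apply: filter_app2 (nbhs_dnbhs_neq (0 : C^o)); near=> z => z0 qz.
exact: regP (H z z0 qz).
Unshelve. all: by end_near. Qed.

Lemma holo_inf_of_ev m (M : 'M[K]_m) (G : C -> 'M[C]_m) : regm None M ->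
  (\forall z \near (0 : C^o)^', evm (Some z^-1) M (G z^-1)) -> holo_at_infty G.
Proof.
move=> /regm_ev[D MD] /near_dnbhs0 H; exists D => i j.
have [p [q [q0 DE pqE]]] := ev_inf_near (MD i j).
apply: (@ratio_derivable _ p q) => //.
have := near_horner q0; apply: filter_app; move: H; apply: filterS => z Gz qz.
have [->|z0] := eqVneq z 0; first exact: DE.
by apply: ev_uniq (Gz z0 i j) _; exact: pqE.
Qed.

Lemma lim_infty_of_ev m (M : 'M[K]_m) (G : C -> 'M[C]_m) D : evm None M D ->
  (\forall z \near (0 : C^o)^', evm (Some z^-1) M (G z^-1)) -> lim_infty G D.
Proof.
move=> MD H i j; have [p [q [q0 DE pqE]]] := ev_inf_near (MD i j).
have : (p.[z] / q.[z] : C^o) @[z --> (0 : C^o)^'] --> (D i j : C^o).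
  rewrite DE; apply: cvgM; last apply: cvgV => //.
  1,2: by apply: cvg_trans (@horner_continuous _ _ (0 : C^o)); apply: cvg_app; exact: cvg_within.
apply: cvg_trans; apply: near_eq_cvg.
have : \forall z \near (0 : C^o)^', q.[z] != 0 by apply: cvg_within; exact: near_horner.
move: (nbhs_dnbhs_neq (0 : C^o)) H; apply: filter_app3; near=> z => z0 Gz qz.
by apply: ev_uniq (pqE z z0 qz) (Gz i j).
Unshelve. all: by end_near. Qed.

(** At a pole of an entry the value is the default 0. *)
Definition evalm m (M : 'M[K]_m) (s : C) : 'M[C]_m :=
  \matrix_(i, j) xget 0 [set v | ev (Some s) (M i j) v].

Lemma evalmP m (M : 'M[K]_m) s : regm (Some s) M -> evm (Some s) M (evalm M s).
Proof.
move=> H i j; rewrite mxE; have [v vP] := H i j.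
exact: (xgetPex 0 (ex_intro [set v | ev (Some s) (M i j) v] v vP)).
Qed.

(** The zeros of [q] are the finitely many points where [F] may have a pole or an arbitrary
    value. *)
Definition agree m (F : C -> 'M[C]_m) (M : 'M[K]_m) :=
  exists2 q : {poly C}, q != 0 & forall s, q.[s] != 0 -> evm (Some s) M (F s).

Lemma rational_agree m (F : C -> 'M[C]_m) : rational_mx F -> exists M, agree F M.
Proof.
move=> [N [q [q0 FE]]]; exists (\matrix_(i, j) ((N i j)%:F / q%:F)), q => // s qs i j.
by rewrite FE // !mxE; exists (N i j), q; split=> //; split=> //; rewrite mulrC.
Qed.

Lemma agree_evalm m (M : 'M[K]_m) : agree (evalm M) M /\ rational_mx (evalm M).
Proof.
have [q q0 [N NE]] := common_denominator M.
have ME i j : M i j = (N i j)%:F / q%:F.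
  by rewrite -NE mulrAC divff ?mul1r // ff_io_eq0.
have qM s : q.[s] != 0 -> evm (Some s) M (\matrix_(i, j) ((N i j).[s] / q.[s])).
  by move=> qs i j; rewrite ME mxE; exists (N i j), q.
have qM' s : q.[s] != 0 -> evm (Some s) M (evalm M s).
  by move=> qs; apply: evalmP; exact: evm_reg (qM s qs).
split; first by exists q.
exists N, q; split=> // s qs; apply/matrixP => i j; rewrite [RHS]mxE [X in _ * X]mxE.
by apply: ev_uniq (qM' s qs i j) _; have := qM s qs i j; rewrite mxE mulrC.
Qed.

Lemma agree_mul m (F G : C -> 'M[C]_m) M N : agree F M -> agree G N ->
  agree (fun s => F s *m G s) (M *m N).
Proof.
move=> [q q0 h] [q' q'0 h']; exists (q * q'); first by rewrite mulf_neq0.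
by move=> s; rewrite hornerM mulf_eq0 negb_or => /andP[/h ? /h' ?]; exact: evmM.
Qed.

Lemma regm_near m (M : 'M[K]_m) (s : C) :
  regm (Some s) M -> \forall z \near (s : C^o), regm (Some z) M.
Proof.
move=> H; apply: (@filter_forall C _ (fun i z => forall j, reg (Some z) (M i j)) (nbhs (s : C^o)) _) => i.
by apply: (@filter_forall C _ (fun j z => reg (Some z) (M i j)) (nbhs (s : C^o)) _) => j; exact: reg_near.
Qed.

Lemma regm_near_inf m (M : 'M[K]_m) :
  regm None M -> \forall z \near (0 : C^o)^', regm (Some z^-1) M.
Proof.
move=> H; apply: (@filter_forall C _ (fun i z => forall j, reg (Some z^-1) (M i j)) ((0 : C^o)^') _) => i.
by apply: (@filter_forall C _ (fun j z => reg (Some z^-1) (M i j)) ((0 : C^o)^') _) => j; exact: reg_near_inf.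
Qed.

(** Evaluating [M M^-1 = 1] at [a] shows that the value of the inverse inverts the value. *)
Lemma evm_invmx a m (M : 'M[K]_m) N : evm a M N -> M \in unitmx -> regm a (invmx M) ->
  N \in unitmx /\ evm a (invmx M) (invmx N).
Proof.
move=> MN Mu /regm_ev[N' MN'].
have NN : N *m N' = 1%:M.
  apply/matrixP => i j; apply: (@ev_uniq _ _ a ((M *m invmx M) i j)); first exact: evmM.
  by rewrite mulmxV //; apply: evm_scalar; exact: ev1.
have [Nu _] := mulmx1_unit NN; split=> //.
by have -> : invmx N = N' by rewrite -[LHS]mulmx1 -NN mulKmx.
Qed.

Lemma holo_unit_evalm m (H : C -> Prop) (M : 'M[K]_m) : M \in unitmx ->
  regO H M -> regO H (invmx M) -> holo_unit_on H (evalm M).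
Proof.
move=> Mu Mr MVr; split.
- by move=> s Hs; case: (evm_invmx (evalmP (Mr (Some s) Hs)) Mu (MVr (Some s) Hs)).
- split=> [s Hs|].
    apply: (@holo_of_ev _ M); have := regm_near (Mr (Some s) Hs).
    by apply: filterS => z; exact: evalmP.
  apply: (@holo_inf_of_ev _ M); first exact: (Mr None).
  have := regm_near_inf (Mr None I).
  by apply: filterS => z; exact: evalmP.
- split=> [s Hs|].
    apply: (@holo_of_ev _ (invmx M)).
    move: (regm_near (Mr (Some s) Hs)) (regm_near (MVr (Some s) Hs)).
    apply: filter_app2; near=> z => h1 h2.
    by case: (evm_invmx (evalmP h1) Mu h2).
  apply: (@holo_inf_of_ev _ (invmx M)); first exact: (MVr None).
  move: (regm_near_inf (Mr None I)) (regm_near_inf (MVr None I)).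
  apply: filter_app2; near=> z => h1 h2.
  by case: (evm_invmx (evalmP h1) Mu h2).
Unshelve. all: by end_near. Qed.

Lemma ev_cross (p q : {poly C}) s v : q != 0 -> ev (Some s) (p%:F / q%:F : K) v -> p.[s] = v * q.[s].
Proof.
move=> q0 [p' [q' [E [q's ->]]]].
have q'0 : q' != 0 by apply: contraNneq q's => ->; rewrite horner0.
have /(congr1 (horner^~ s)) := fracE q0 q'0 E; rewrite !hornerM => EE.
by rewrite mulrAC -EE mulfK.
Qed.

Lemma holo_at_continuous m (F : C -> 'M[C]_m) s i j : holo_at F s ->
  {for (s : C^o), continuous (fun z : C^o => F z i j : C^o)}.
Proof. by move=> /(_ i j)/nbhs_singleton; exact: derivable_continuous1. Qed.

(** With an entry [p / d] in lowest terms, [p = F d] holds near [s] off the exceptional points and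
    extends to [s] by continuity. If [d(s) = 0] then also [p(s) = 0], against coprimality. *)
Lemma ev_of_holo m (F : C -> 'M[C]_m) (M : 'M[K]_m) s : agree F M -> holo_at F s ->
  evm (Some s) M (F s).
Proof.
move=> [q q0 qF] Fs i j.
have [p [d [d0 pd ME]]] := frac_coprimeP (M i j).
have ps : p.[s] = F s i j * d.[s].
  apply: (@cont_eq_punctured _ (horner p) (fun z => F z i j * d.[z])).
  - exact: horner_continuous.
  - by apply: continuous_mul1; [exact: (@holo_at_continuous _ F s i j Fs)|exact: horner_continuous].
  - have := near_horner' s q0; apply: filterS => z qz.
    by apply: ev_cross d0 _; rewrite -ME; exact: qF.
have ds : d.[s] != 0.
  apply/negP => /eqP ds; have := coprimep_root pd (x := s).
  by rewrite /root ps ds mulr0 eqxx => /(_ isT).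
by exists p, d; rewrite ME; split=> //; split=> //; rewrite ps mulfK.
Qed.

(** The argument of [ev_of_holo] at 0 for the reversed polynomials: a numerator of larger degree
    would have a nonzero leading coefficient equal to a multiple of 0. *)
Lemma reg_of_holo_inf m (F : C -> 'M[C]_m) (M : 'M[K]_m) : agree F M -> holo_at_infty F ->
  regm None M.
Proof.
move=> [q q0 qF] [D DF] i j.
have [p [d [d0 pd ME]]] := frac_coprimeP (M i j).
pose n := (maxn (size p) (size d)).-1.
have sn : maxn (size p) (size d) = n.+1.
  by rewrite prednK // (leq_trans _ (leq_maxr _ _)) // size_poly_gt0.
have sp : (size p <= n.+1)%N by rewrite -sn leq_maxl.
have sd : (size d <= n.+1)%N by rewrite -sn leq_maxr.
pose G z := (if z == 0 then D else F z^-1) i j.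
have E0 : (revp n p).[0] = G 0 * (revp n d).[0].
  apply: (@cont_eq_punctured _ (horner (revp n p)) (fun z => G z * (revp n d).[z])).
  - exact: horner_continuous.
  - by apply: continuous_mul1; [exact: (@holo_at_continuous _ _ 0 i j DF)|exact: horner_continuous].
  - move: (nbhs_dnbhs_neq (0 : C^o)) (near_infty_horner q0); apply: filter_app2; near=> z => z0 qz.
    rewrite !revpE // /G (negPf z0) mulrCA; congr (_ * _).
    by apply: ev_cross d0 _; rewrite -ME; exact: qF.
rewrite !revp0 in E0.
suff spd : (size p <= size d)%N.
  by apply: (@regP _ _ _ _ (p`_(size d).-1 / lead_coef d)); exists p, d; rewrite ME.
rewrite leqNgt; apply/negP => lt.
move: E0; rewrite [d`__]nth_default; last by rewrite -ltnS -sn (maxn_idPl (ltnW lt)).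
have p0 : p != 0 by rewrite -size_poly_gt0 (leq_ltn_trans _ lt).
rewrite mulr0 /n (maxn_idPl (ltnW lt)) -lead_coefE => /eqP.
by rewrite lead_coef_eq0 (negPf p0).
Unshelve. all: by end_near. Qed.

Lemma poly_nonroot (p : {poly C}) : p != 0 -> exists s, p.[s] != 0.
Proof.
move=> p0; apply: contrapT => /forallNP H.
have /= := @max_poly_roots _ p [seq n%:R | n <- iota 0 (size p)] p0.
rewrite size_map size_iota ltnn => h; suff : false by [].
apply: h.
  by apply/allP => z _; rewrite /root; apply/negPn/negP; exact: H.
rewrite map_inj_uniq ?iota_uniq // => a b /eqP; by rewrite eqr_nat => /eqP.
Qed.

(** If [M - N] had a nonzero entry [a / b], some point would avoid the zeros of [a], both
    exceptional sets and the finite set of disagreement, which is a contradiction. *)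
Lemma agree_eq m (F G : C -> 'M[C]_m) M N : agree F M -> agree G N ->
  finite_set [set s | F s <> G s] -> M = N.
Proof.
move=> [q q0 qF] [q' q'0 qG] /finite_seqP[l lE].
apply/matrixP => i j; have [a [b [b0 abE]]] := ff_frac (M i j - N i j).
apply/eqP; rewrite -subr_eq0 abE mulf_eq0 invr_eq0 !ff_io_eq0 (negPf b0) orbF.
apply/negPn/negP => a0.
pose r := \prod_(z <- l) ('X - z%:P).
have [s] : exists s, (q * q' * r * a).[s] != 0.
  apply: poly_nonroot; rewrite !mulf_neq0 //.
  by rewrite /r prodf_seq_neq0; apply/allP => z _; rewrite polyXsubC_eq0.
rewrite !hornerM !mulf_eq0 !negb_or => /andP[/andP[/andP[qs q's] rs] as0].
have FG : F s = G s.
  apply: contrapT => FGs; move: rs; rewrite -[_ == 0]/(root r s) root_prod_XsubC => /negP; apply.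
  by have : [set s | F s <> G s] s by []; rewrite lE.
have : ev (Some s) (a%:F / b%:F) (F s i j - G s i j).
  by rewrite -abE; apply: evB; [exact: qF|exact: qG].
by move/(ev_cross b0); rewrite FG subrr mul0r => /eqP; rewrite (negPf as0).
Qed.

Lemma agree_finite m (F G : C -> 'M[C]_m) M : agree F M -> agree G M ->
  finite_set [set s | F s <> G s].
Proof.
move=> [q q0 qF] [q' q'0 qG].
have qq0 : q * q' != 0 by rewrite mulf_neq0.
have [r rE] := closed_field_poly_normal (q * q').
apply: (@sub_finite_set _ _ [set` r]); last exact: finite_seq.
move=> s /= FG; apply/negPn/negP => sr; apply: FG.
have : ~~ root (q * q') s.
  by rewrite rE rootZ ?lead_coef_eq0 // root_prod_XsubC.
rewrite /root hornerM mulf_eq0 negb_or => /andP[qs q's].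
by apply/matrixP => i j; apply: ev_uniq (qF s qs i j) (qG s q's i j).
Qed.

End Bridge.

(** The quotient construction is opened here only; writing an element as a fraction amounts to
    unfolding its representative. *)
Lemma fracfield_exists (C : closedFieldType) : inhabited (fracfield C).
Proof.
have fracP (x : {fraction {poly C}}) :
    exists p q : {poly C}, q != 0 /\ x = FracField.tofrac p / FracField.tofrac q.
  elim/quotW: x => r; exists ((frac r).1), ((frac r).2); split; first exact: denom_ratioP.
  have qN0 : FracField.tofrac ((frac r).2) != 0 by rewrite tofrac_eq0 denom_ratioP.
  apply: (mulIf qN0); rewrite divfK //.
  unlock FracField.tofrac; rewrite -[LHS]FracField.pi_mul.
  rewrite /FracField.mulf /= !numden_Ratio ?oner_neq0 //.
  apply/eqmodP/eqP => /=; rewrite !numden_Ratio ?oner_neq0 ?mulf_neq0 ?oner_neq0 ?denom_ratioP //.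
  by rewrite !mulr1 mulrC.
have inj : injective (@FracField.tofrac {poly C}).
  by move=> p q /eqP; rewrite tofrac_eq => /eqP.
exact: (inhabits (@Fracfield C _ (@FracField.tofrac {poly C}) inj fracP)).
Qed.

(** * Realizations and factorizations, as functions and over the rational function field *)

Section WHIndices.
Variable R : realType.
Local Notation C := R[i].
Variable FF : fracfield C.
Local Notation K := (ff_sort FF).
Local Notation io := (ff_io FF).
Local Notation "p %:F" := (io p).
Local Notation kM M := (map_mx (io \o polyC) M).
Local Notation Hp := (fun s : C => 0 <= complex.Re s).
Local Notation Hm := (fun s : C => complex.Re s <= 0).

Lemma half_planes_cover (s : C) : Hp s \/ Hm s.
Proof. by case: (leP 0 (complex.Re s)) => [|/ltW]; [left|right]. Qed.
Lemma right_excludes_N1 : ~ Hp (-1 : C).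
Proof. by rewrite /= oppr_ge0 ler10. Qed.
Lemma left_excludes_1 : ~ Hm (1 : C).
Proof. by rewrite /= ler10. Qed.
Lemma reflect_left (s : C) : Hm s -> Hp (- s^*).
Proof. by case: s => a b; rewrite /= oppr_ge0. Qed.

Lemma eigenvalue_unit n (A : 'M[C]_n) a : eigenvalue A a = (a%:M - A \notin unitmx).
Proof.
by rewrite /eigenvalue /eigenspace kermx_eq0 row_free_unit -unitmxN opprB.
Qed.

Lemma stable_stab n (A : 'M[C]_n) : stable A -> stab Hp A.
Proof.
move=> sA s Hs; case: (boolP (s%:M - A \in unitmx)) => // u.
by have := sA s; rewrite eigenvalue_unit u ltNge Hs => /(_ isT).
Qed.

Lemma evm_resolvent n (A : 'M[C]_n) s : s%:M - A \in unitmx ->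
  evm (Some s) (resolvent FF A) (invmx (s%:M - A)).
Proof.
move=> u; have e : evm (Some s) ((io 'X)%:M - kM A) (s%:M - A).
  by apply: evmD; [exact: evm_scalar (evX s)|apply: evmN; exact: evm_const].
by case: (evm_invmx e (resolvent_unit FF A) (regm_resolvent FF u)).
Qed.

Lemma char_poly_unit n (A : 'M[C]_n) s : (char_poly A).[s] != 0 -> s%:M - A \in unitmx.
Proof. by rewrite -[_ == 0]/(root _ _) -eigenvalue_root_char eigenvalue_unit negbK. Qed.

Section Realiz.
Variables (m n : nat) (A : 'M[C]_n) (B : 'M[C]_(n, m)) (L : 'M[C]_(m, n)) (D : 'M[C]_m).
Variable F : C -> 'M[C]_m.
Hypothesis F_real : realization A B L D F.

Lemma realization_ev s : s%:M - A \in unitmx ->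
  evm (Some s) (transfer FF A B L D) (F s).
Proof.
move=> u; rewrite F_real ?eigenvalue_unit ?u //.
apply: evmD; first exact: evm_const.
apply: evmM; last exact: evm_const.
by apply: evmM; [exact: evm_const|exact: evm_resolvent].
Qed.

(** The pencil of [A] at the reflected point is minus the adjoint of the pencil of [-A^*] at [s]. *)
Lemma para_adj_ev s : s%:M - (- A^t*) \in unitmx ->
  evm (Some s) (transfer_adj FF A B L D) (para_adj F s).
Proof.
move=> u; have uE : (- s^*)%:M - A = - (s%:M - (- A^t*))^t*.
  by rewrite !opprK adjmxD trmxCK adjmx_scalar opprD raddfN.
rewrite /para_adj F_real; last by rewrite eigenvalue_unit negbK uE unitmxN adjmx_unit.
rewrite uE adjmxD !adjmxM.
have -> : (invmx (- (s%:M - (- A^t*))^t*))^t* = - invmx (s%:M - (- A^t*)).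
  have invN (M : 'M[C]_n) : invmx (- M) = - invmx M.
    have [Mu|Mu] := boolP (M \in unitmx); last by rewrite /invmx unitmxN (negPf Mu).
    by rewrite -scaleN1r invmxZ ?unitmxZ ?unitrN1 // invrN1 scaleN1r.
  rewrite invN adjmxN; congr (- _).
  apply: (can_inj (mulKmx u)); rewrite mulmxV //.
  by rewrite -[X in X *m _]trmxCK -adjmxM mulVmx ?adjmx_unit // adjmx1.
rewrite mulNmx mulmxN.
apply: evmD; first exact: evm_const.
rewrite mulmxA; apply: evmN; apply: evmM; last exact: evm_const.
by apply: evmM; [exact: evm_const|exact: evm_resolvent].
Qed.

Lemma realization_agree : agree F (transfer FF A B L D).
Proof.
exists (char_poly A); first by rewrite monic_neq0 // char_poly_monic.
by move=> s /char_poly_unit; exact: realization_ev.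
Qed.

Lemma para_adj_agree : agree (para_adj F) (transfer_adj FF A B L D).
Proof.
exists (char_poly (- A^t*)); first by rewrite monic_neq0 // char_poly_monic.
by move=> s /char_poly_unit; exact: para_adj_ev.
Qed.
End Realiz.

Lemma ev_zeta s (l : int) : 1 - s != 0 -> 1 + s != 0 -> ev (Some s) (zt FF ^ l) (zeta s ^ l).
Proof.
move=> m0 p0; have e : ev (Some s) (zt FF) (zeta s).
  apply: evM.
    by have := ev_poly (F := FF) s (1 - 'X); rewrite hornerD hornerN hornerC hornerX.
  have := ev_poly (F := FF) s (1 + 'X); rewrite hornerD hornerC hornerX; exact: evV.
have eX n : ev (Some s) (zt FF ^+ n) (zeta s ^+ n).
  by elim: n => [|n IH]; rewrite ?expr0 ?exprS; [exact: ev1|exact: evM].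
case: l => n; first exact: eX.
apply: evV; last exact: eX.
by rewrite expf_neq0 // mulf_neq0 // invr_eq0.
Qed.

Lemma agree_zeta m (lam : 'I_m -> int) :
  agree (fun s => diag_mx (\row_j (zeta s ^ lam j))) (diag_mx (\row_j (zt FF ^ lam j))).
Proof.
exists ((1 - 'X) * (1 + 'X)).
  by rewrite mulf_neq0 // -size_poly_eq0 ?size_1mX ?size_1pX.
move=> s; rewrite hornerM mulf_eq0 negb_or !hornerD hornerN !hornerC hornerX => /andP[s1 s2] i j.
rewrite !mxE; case: eqP => _; last exact: ev0.
exact: ev_zeta.
Qed.

Lemma WH_exists m (F : C -> 'M[C]_m) (S : 'M[K]_m) : agree F S -> S \in unitmx ->
  (forall a, dom Hp a -> dom Hm a -> regm a S) ->
  (forall a, dom Hp a -> dom Hm a -> regm a (invmx S)) ->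
  exists lam, WH_indices F lam.
Proof.
move=> FS Su Sr SVr.
have [lam [Wm [Wp [[Wmu Wpu] [Wmr WmVr] [Wpr WpVr] fact]]]] :=
  wh_factorization_exists half_planes_cover right_excludes_N1 left_excludes_1 Su Sr SVr.
exists lam, (evalm Wm), (evalm Wp); split.
- by split; apply: (proj2 (agree_evalm _)).
- exact: holo_unit_evalm.
- exact: holo_unit_evalm.
- apply: agree_finite FS _; rewrite fact.
  apply: agree_mul; last exact: (proj1 (agree_evalm _)).
  by apply: agree_mul; [exact: (proj1 (agree_evalm _))|exact: agree_zeta].
Qed.

(** Analyticity forces the rational function behind [W] to be regular with the value [W s] on [H].
    One point of [H] suffices to see that it is invertible over the field. *)
Lemma WH_factor_lift m (H : C -> Prop) (W : C -> 'M[C]_m) : rational_mx W -> (exists s, H s) ->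
  holo_unit_on H W -> exists M : 'M[K]_m, [/\ agree W M, M \in unitmx, regO H M & regO H (invmx M)].
Proof.
move=> /(rational_agree FF)[M WM] [s0 Hs0] [Wu [Wh Winf] [_ WVinf]]; exists M.
have e s : H s -> evm (Some s) M (W s) by move=> /Wh; exact: ev_of_holo.
have [Mu _] := evm_inv (e s0 Hs0) (Wu s0 Hs0).
(* The exceptional points now include the zeros of the numerator of [det M], where [invmx (W z)]
   need not be the value of the inverse. *)
have WVM : agree (fun z => invmx (W z)) (invmx M).
  have [p [d [d0 dE]]] := ff_frac (\det M).
  have p0 : p != 0.
    apply: contraTneq Mu => p0; rewrite unitmxE dE p0 rmorph0 mul0r unitr0 //.
  have [q q0 qW] := WM; exists (q * p); first by rewrite mulf_neq0.
  move=> s; rewrite hornerM mulf_eq0 negb_or => /andP[qs ps].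
  have Wsu : W s \in unitmx.
    rewrite unitmxE unitfE; apply: contraNneq ps => dW.
    have := ev_det (qW s qs); rewrite dE dW => /(ev_cross d0) ->.
    by rewrite mul0r.
  have [_ MVr] := evm_inv (qW s qs) Wsu.
  by case: (evm_invmx (qW s qs) Mu MVr).
split=> // -[s|] Hs.
- exact: evm_reg (e s Hs).
- exact: reg_of_holo_inf WM Winf.
- by case: (evm_inv (e s Hs) (Wu s Hs)).
- exact: reg_of_holo_inf WVM WVinf.
Qed.

Lemma WH_lift m (F : C -> 'M[C]_m) (S : 'M[K]_m) lam : agree F S -> WH_indices F lam ->
  exists Wm Wp : 'M[K]_m,
  [/\ Wm \in unitmx /\ Wp \in unitmx, regO Hm Wm /\ regO Hm (invmx Wm),
     regO Hp Wp /\ regO Hp (invmx Wp)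
   & S = Wm *m diag_mx (\row_i zt FF ^ lam i) *m Wp].
Proof.
move=> FS [Wm [Wp [[rm rp] um up fin]]].
have [M [WM Mu Mr MVr]] := WH_factor_lift rm (ex_intro (fun s => complex.Re s <= 0) 0 (lexx _)) um.
have [N [WN Nu Nr NVr]] := WH_factor_lift rp (ex_intro (fun s => 0 <= complex.Re s) 0 (lexx _)) up.
exists M, N; split=> //; apply: (agree_eq FS _ fin).
by apply: agree_mul => //; apply: agree_mul => //; exact: agree_zeta.
Qed.

Lemma WH_shift m (F : C -> 'M[C]_m) lam k : WH_indices F lam ->
  WH_indices (fun s => zeta s ^+ k *: F s) (fun j => lam j + k%:Z).
Proof.
move=> [Wm [Wp [r um up fin]]]; exists Wm, Wp; split; [exact: r|exact: um|exact: up|].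
(* The points 1 and -1 are added because [zeta] is 0 there, at -1 by division by zero, and the law
   of exponents may fail for negative indices. *)
apply: (@sub_finite_set _ _ ([set s | F s <> Wm s *m diag_mx (\row_j (zeta s ^ lam j)) *m Wp s] `|` [set 1] `|` [set -1])); last first.
  by rewrite !finite_setU; do !split=> //; exact: finite_set1.
move=> s /= H; apply: contrapT => /not_orP[/not_orP[/contrapT FE s1] s2]; apply: H.
rewrite FE scalemxAl; congr (_ *m _); rewrite scalemxAr; congr (_ *m _).
apply/matrixP => i j; rewrite !mxE; case: eqP => _; last by rewrite !mulr0n mulr0.
have z0 : zeta s != 0.
  rewrite mulf_neq0 ?invr_eq0 // ?subr_eq0.
    by apply/eqP => sE; apply: s1.
  by rewrite addrC addr_eq0; apply/eqP => sE; apply: s2.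
by rewrite !mulr1n exprzDr ?unitfE // mulrC.
Qed.

End WHIndices.

(** * The spectrum of Q *)

Section DiagRank.
Variable F : fieldType.

Lemma rank_diag_mx n (d : 'rV[F]_n) : \rank (diag_mx d) = #|[pred i | d 0 i != 0]|.
Proof.
set S := [pred i | d 0 i != 0].
(* [P] selects the coordinates with nonzero entry: [P diag(d) P^T] is invertible of size [#|S|], and
   [diag(d)] factors through [P]. *)
pose P : 'M[F]_(#|S|, n) := \matrix_(k, j) (enum_val k == j)%:R.
have Pd : P *m diag_mx d = \matrix_(k, j) (d 0 j *+ (enum_val k == j)).
  apply/matrixP => k j; rewrite mul_mx_diag !mxE.
  by case: eqP => _; rewrite ?mul1r ?mul0r ?mulr1n ?mulr0n.
have PdP : P *m diag_mx d *m P^T = diag_mx (\row_k d 0 (enum_val k)).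
  rewrite Pd; apply/matrixP => k l; rewrite !mxE (bigD1 (enum_val k)) //= big1 => [|j jk].
    by rewrite !mxE eqxx addr0 (inj_eq enum_val_inj) eq_sym; case: eqP => [->|_];
      rewrite ?mulr1n ?mulr1 ?mulr0n ?mulr0.
  by rewrite !mxE eq_sym (negPf jk) mulr0n mul0r.
apply/eqP; rewrite eqn_leq; apply/andP; split.
  have -> : diag_mx d = diag_mx d *m (P^T *m P).
    apply/matrixP => i j; rewrite mul_diag_mx !mxE.
    have [di|di] := eqVneq (d 0 i) 0; first by rewrite di mul0rn mul0r.
    have iS : i \in S by [].
    rewrite (bigD1 (enum_rank_in iS i)) //= !mxE enum_rankK_in // eqxx mul1r big1 ?addr0.
      by rewrite mulr_natr.
    move=> k ki; rewrite !mxE; case: eqP => [ki'|_]; last by rewrite mul0r.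
    case/eqP: ki; apply: enum_val_inj; by rewrite enum_rankK_in.
  by rewrite (leq_trans (mxrankM_maxr _ _)) // (leq_trans (mxrankM_maxr _ _)) // rank_leq_row.
have : \rank (P *m diag_mx d *m P^T) = #|S|.
  apply/eqP; rewrite PdP -[_ == _]/(row_free _) row_free_unit unitmxE det_diag unitfE.
  by apply/prodf_neq0 => k _; rewrite mxE; have := enum_valP k.
by move=> <-; rewrite (leq_trans (mxrankM_maxl _ _)) // mxrankM_maxr.
Qed.

End DiagRank.

Section Hermitian.
Variable R : realType.
Local Notation C := R[i].

Lemma unitary_diag n (Q : 'M[C]_n) : Q^t* = Q ->
  exists (U : 'M[C]_n) (d : 'rV[C]_n), [/\ U^t* *m U = 1%:M, U *m U^t* = 1%:M, d \is a realmx &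
    Q = U^t* *m diag_mx d *m U].
Proof.
move=> QQ; have hQ : Q \is hermsymmx by apply/is_hermitianmxP; rewrite expr0 scale1r QQ.
have /hermitian_normalmx /orthomx_spectralP QE := hQ.
have [UU UU'] := unitary_adj (spectral_unitarymx Q).
exists (spectralmx Q), (spectral_diag Q); split=> //; first exact: hermitian_spectral_diag_real.
by rewrite {1}QE invmx_unitary // spectral_unitarymx.
Qed.

(** A hermitian matrix is unitarily diagonalizable, and for a diagonal matrix both numbers count the
    entries equal to 1. *)
Lemma mup_nullity n (Q : 'M[C]_n) : Q^t* = Q -> mup 1 (char_poly Q) = nullity (1%:M - Q).
Proof.
move=> /unitary_diag[U [d [UU UU' _ QE]]].
have -> : char_poly Q = char_poly (diag_mx d).
  rewrite /char_poly /char_poly_mx QE.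
  have -> : 'X%:M - map_mx polyC (U^t* *m diag_mx d *m U) =
    map_mx polyC (U^t*) *m ('X%:M - map_mx polyC (diag_mx d)) *m map_mx polyC U.
    rewrite mulmxBr mulmxBl !map_mxM; congr (_ - _).
    by rewrite mul_mx_scalar -scalemxAl -map_mxM UU map_mx1 scalemx1.
  by rewrite !det_mulmx mulrC mulrA -det_mulmx -map_mxM UU' map_mx1 det1 mul1r.
rewrite char_poly_trig; last exact: diag_mx_is_trig.
have -> : \prod_(i < n) ('X - (diag_mx d i i)%:P) = \prod_(y <- [seq d 0 i | i <- enum 'I_n]) ('X - y%:P).
  by rewrite big_map big_enum; apply: eq_bigr => i _; rewrite mxE eqxx mulr1n.
rewrite mu_prod_XsubC /nullity mxrank_ker mxrank_tr.
have -> : 1%:M - Q = U^t* *m diag_mx (\row_i (1 - d 0 i)) *m U.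
  have -> : diag_mx (\row_i (1 - d 0 i)) = 1%:M - diag_mx d.
    by apply/matrixP => i j; rewrite !mxE; case: eqP => [->|_]; rewrite ?mulr1n ?mulr0n ?subr0.
  by rewrite mulmxBr mulmxBl mulmx1 UU -QE.
have Uu : U \in unitmx by case: (mulmx1_unit UU).
have Uu' : U^t* \in unitmx by case: (mulmx1_unit UU).
rewrite mxrankMfree ?row_free_unit // eqmxMfull ?row_full_unit // rank_diag_mx.
have E := cardC [pred i | (\row_i (1 - d 0 i)) 0 i != 0]; rewrite card_ord in E.
rewrite count_map -[X in (X - _)%N]E addKn.
rewrite -size_filter cardE enumT; congr (size _); apply: eq_filter => i.
by rewrite !inE mxE negbK subr_eq0 eq_sym.
Qed.

Lemma normsq_ge0 n (y : 'cV[C]_n) : 0 <= (y^t* *m y) 0 0.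
Proof. by rewrite mxE; apply: sumr_ge0 => i _; rewrite !mxE mulrC mul_conjC_ge0. Qed.

(* On the row kernel N of Q + c the two Lyapunov equations force N Co^* = 0 and
   N B = 0.  Hence N is A-invariant with N A = - N A^*, and a basis X of N solves a
   homogeneous Sylvester equation T X + X A^* = 0 with T and A stable. *)
Lemma lyapunov_no_negative n m (A : 'M[C]_n) (B : 'M[C]_(n, m)) (Co : 'M[C]_(m, n)) (Q : 'M[C]_n) c :
  stable A -> A + A^t* + B *m B^t* = 0 -> Q^t* = Q -> A *m Q + Q *m A^t* + Co^t* *m Co = 0 ->
  0 < c -> row_free (Q + c%:M).
Proof.
move=> sA AB QQ lyap c0; rewrite -kermx_eq0 -submx0.
set N := kermx _; have [FF] := fracfield_exists C.
have Nker p (v : 'M[C]_(p, n)) : (v <= N)%MS = (v *m (Q + c%:M) == 0) by rewrite sub_kermx.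
clearbody N.
have cR : Num.conj c = c by apply: CrealP; rewrite gtr0_real.
have key : A *m (Q + c%:M) + (Q + c%:M) *m A^t* = - (Co^t* *m Co) - c *: (B *m B^t*).
  rewrite mulmxDr mulmxDl mul_mx_scalar mul_scalar_mx addrACA -scalerDr.
  move/eqP: AB; rewrite addr_eq0 => /eqP ->; move/eqP: lyap; rewrite addr_eq0 => /eqP ->.
  by rewrite scalerN.
have NQ : N *m (Q + c%:M) = 0 by apply/eqP; rewrite -Nker.
have QN : (Q + c%:M) *m N^t* = 0.
  by rewrite -[RHS](adjmx0 C n n) -NQ adjmxM adjmxD adjmx_scalar cR QQ.
have z (v : 'rV[C]_n) : (v <= N)%MS -> v *m Co^t* = 0 /\ v *m B = 0.
  move=> /submxP[w vE]; have vQ : v *m (Q + c%:M) = 0 by rewrite vE -mulmxA NQ mulmx0.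
  have Qv : (Q + c%:M) *m v^t* = 0 by rewrite vE adjmxM mulmxA QN mul0mx.
  have : v *m (A *m (Q + c%:M) + (Q + c%:M) *m A^t*) *m v^t* = 0.
    by rewrite mulmxDr mulmxDl -!mulmxA Qv !mulmx0 add0r mulmxA vQ mul0mx.
  rewrite key mulmxBr mulmxBl mulmxN mulNmx -opprD => /eqP; rewrite oppr_eq0 -scalemxAr -scalemxAl => /eqP E.
  have e1 : v *m (Co^t* *m Co) *m v^t* = (Co *m v^t*)^t* *m (Co *m v^t*).
    by rewrite adjmxM trmxCK !mulmxA.
  have e2 : v *m (B *m B^t*) *m v^t* = (B^t* *m v^t*)^t* *m (B^t* *m v^t*).
    by rewrite adjmxM !trmxCK !mulmxA.
  move: E; rewrite e1 e2 => /matrixP/(_ 0 0); rewrite [LHS]mxE [X in _ + X]mxE [RHS]mxE => /eqP.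
  rewrite paddr_eq0 ?mulr_ge0 ?normsq_ge0 // ?ltW // mulf_eq0 (gt_eqF c0) /= => /andP[/eqP h1 /eqP h2].
  have g p (y : 'cV[C]_p) : (y^t* *m y) 0 0 = 0 -> y = 0.
    by move=> h; apply: gram_eq0; apply/matrixP => i j; rewrite !ord1 h mxE.
  by split; apply: adjmx_inj; rewrite adjmxM adjmx0 ?trmxCK; apply: g.
have NCo : N *m Co^t* = 0.
  by apply/row_matrixP => i; rewrite row_mul row0; case: (z (row i N)); rewrite ?row_sub.
have NB : N *m B = 0.
  by apply/row_matrixP => i; rewrite row_mul row0; case: (z (row i N)); rewrite ?row_sub.
have NA : (N *m A <= N)%MS.
  rewrite Nker -mulmxA; apply/eqP.
  have -> : A *m (Q + c%:M) = - (Co^t* *m Co) - c *: (B *m B^t*) - (Q + c%:M) *m A^t*.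
    by rewrite -key addrK.
  by rewrite !mulmxBr mulmxN -scalemxAr !mulmxA NCo NB NQ !mul0mx scaler0 oppr0 !addr0.
have [X [fX XN NX]] : exists X : 'M[C]_(\rank N, n), [/\ row_free X, (X <= N)%MS & (N <= X)%MS].
  by exists (row_base N); rewrite row_base_free !eq_row_base.
have [T XA] : exists T, X *m A = T *m X.
  by apply/submxP; rewrite (submx_trans (submxMr A XN)) // (submx_trans NA).
have [w XE] : exists w, X = w *m N by apply/submxP.
have XB : X *m B = 0 by rewrite XE -mulmxA NB mulmx0.
have TX : T *m X + X *m A^t* = 0.
  rewrite -XA -mulmxDr; move/eqP: AB; rewrite addr_eq0 => /eqP ->.
  by rewrite mulmxN mulmxA XB mul0mx oppr0.
have sT : stab (fun s : C => 0 <= complex.Re s) T.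
  move=> s Hs; rewrite -row_free_unit -kermx_eq0; apply/rowV0P => v /sub_kermxP vT.
  apply: (row_free_inj fX); rewrite mul0mx.
  have vX : v *m X *m (s%:M - A) = 0.
    have vTE : v *m T = s *: v.
      by move/eqP: vT; rewrite mulmxBr mul_mx_scalar subr_eq0 => /eqP <-.
    by rewrite mulmxBr mul_mx_scalar -(mulmxA v X A) XA mulmxA vTE -scalemxAl subrr.
  by rewrite -[LHS](mulmxK (stable_stab sA Hs)) vX mul0mx.
have X0 : X = 0.
  apply: (sylvester_uniq FF (@half_planes_cover R) (@reflect_left R) sT (stable_stab sA) TX).
by rewrite (submx_trans NX) // X0 sub0mx.
Qed.

(** A negative eigenvalue [d_i] would give [Q + c] with [c = -d_i > 0] the left null vector
    [e_i^T U], which [lyapunov_no_negative] excludes. *)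
Lemma spectrum_ge0 n m (A : 'M[C]_n) (B : 'M[C]_(n, m)) (Co : 'M[C]_(m, n)) (Q : 'M[C]_n) U (d : 'rV[C]_n) :
  stable A -> A + A^t* + B *m B^t* = 0 -> Q^t* = Q -> A *m Q + Q *m A^t* + Co^t* *m Co = 0 ->
  U^t* *m U = 1%:M -> U *m U^t* = 1%:M -> d \is a realmx -> Q = U^t* *m diag_mx d *m U ->
  forall i, 0 <= d 0 i.
Proof.
move=> sA AB QQ lyap UU UU' dR QE i.
have := mxOverP dR 0 i; rewrite realE => /orP[//|di].
move: di; rewrite le_eqVlt => /orP[/eqP -> //|dlt]; suff : False by [].
have c0 : 0 < - d 0 i by rewrite oppr_gt0.
have fr := lyapunov_no_negative sA AB QQ lyap c0.
have : delta_mx 0 i *m U *m (Q + (- d 0 i)%:M) = 0 *m (Q + (- d 0 i)%:M) :> 'rV_n.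
  rewrite mul0mx mulmxDr QE !mulmxA -(mulmxA (delta_mx 0 i) U) UU' mulmx1.
  rewrite mul_mx_scalar; have -> : delta_mx 0 i *m diag_mx d = d 0 i *: delta_mx 0 i :> 'rV_n.
    apply/matrixP => k l; rewrite mul_mx_diag !mxE ord1 eqxx /= mulrC.
    by case: eqP => [->|_]; rewrite ?mulr0.
  by rewrite -scalemxAl scaleNr subrr.
move=> /(row_free_inj fr) /(congr1 (fun M => M *m U^t*)).
rewrite -mulmxA UU' mulmx1 mul0mx => /matrixP/(_ 0 i); rewrite !mxE !eqxx => /eqP.
by rewrite oner_eq0.
Qed.

Lemma positive_contraction n m p (A : 'M[C]_n) (B : 'M[C]_(n, m)) (Co : 'M[C]_(m, n)) (Q : 'M[C]_n)
    (Om : 'M[C]_(p, n)) :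
  stable A -> A + A^t* + B *m B^t* = 0 -> A *m Q + Q *m A^t* + Co^t* *m Co = 0 ->
  1%:M - Q = Om^t* *m Om -> positive_op Q /\ contraction_op Q.
Proof.
move=> sA AB lyap QO.
have QQ : Q^t* = Q.
  have -> : Q = 1%:M - Om^t* *m Om by rewrite -QO opprB addrC subrK.
  by rewrite adjmxD adjmxN adjmx1 adjmxM trmxCK.
have [U [d [UU UU' dR QE]]] := unitary_diag QQ.
have d0 := spectrum_ge0 sA AB QQ lyap UU UU' dR QE.
(* For the eigenvector [v = U^* e_i] the identity [1 - Q = Omega^* Omega] reads
   [1 - d_i = |Omega v|^2]. *)
have d1 i : d 0 i <= 1.
  pose w : 'cV[C]_n := delta_mx i 0.
  have [v Uv] : exists v, U *m v = w by exists (U^t* *m w); rewrite mulmxA UU' mul1mx.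
  have := normsq_ge0 (Om *m v).
  have -> : (Om *m v)^t* *m (Om *m v) = w^t* *m w - w^t* *m diag_mx d *m w.
    rewrite adjmxM -!mulmxA (mulmxA (Om^t*)) -QO mulmxBl mul1mx mulmxBr; congr (_ - _).
      by rewrite -Uv adjmxM -(mulmxA (v^t*)) (mulmxA (U^t*)) UU mul1mx.
    by rewrite -Uv QE adjmxM !mulmxA.
  have -> : w^t* = delta_mx 0 i by apply/matrixP => k l; rewrite !mxE andbC rmorph_nat.
  rewrite mxE [X in _ + X]mxE -mulmxA mul_diag_mx !mxE (bigD1 i) //= big1 => [|k ki]; last first.
    by rewrite !mxE eqxx (negPf ki) mul0r.
  rewrite (bigD1 i) //= big1 => [|k ki]; last by rewrite !mxE eqxx (negPf ki) mul0r.
  by rewrite !mxE !eqxx !mul1r !addr0 mulr1 subr_ge0.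
have nE (x : 'cV[C]_n) : (x^t* *m x) 0 0 = ((U *m x)^t* *m (U *m x)) 0 0.
  by rewrite adjmxM -mulmxA (mulmxA (U^t*)) UU mul1mx.
have dE (e : 'rV[C]_n) (y : 'cV[C]_n) : (y^t* *m diag_mx e *m y) 0 0 = \sum_i e 0 i * `|y i 0| ^+ 2.
  rewrite mxE; apply: eq_bigr => i _; rewrite mul_mx_diag !mxE normCK mulrAC mulrC [y i 0 * _]mulrC.
  by [].
split=> x.
  have -> : x^t* *m Q *m x = (U *m x)^t* *m diag_mx d *m (U *m x) by rewrite QE adjmxM !mulmxA.
  by rewrite dE; apply: sumr_ge0 => i _; rewrite mulr_ge0 // exprn_ge0.
rewrite (nE x).
have -> : (Q *m x)^t* *m (Q *m x) = (U *m x)^t* *m diag_mx (\row_i d 0 i ^+ 2) *m (U *m x).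
  have -> : diag_mx (\row_i d 0 i ^+ 2) = diag_mx d *m diag_mx d.
    rewrite mul_diag_mx; apply/matrixP => i j; rewrite !mxE.
    by case: eqP => [->|_]; rewrite ?mulr1n ?mulr0n ?mulr0 ?expr2.
  have DD : (diag_mx d)^t* = diag_mx d by rewrite tr_diag_mx map_diag_mx (realmxC dR).
  have iso (z : 'cV[C]_n) : (U^t* *m z)^t* *m (U^t* *m z) = z^t* *m z.
    by rewrite adjmxM trmxCK -(mulmxA (z^t*)) (mulmxA U) UU' mul1mx.
  have -> : Q *m x = U^t* *m (diag_mx d *m (U *m x)) by rewrite QE !mulmxA.
  by rewrite iso adjmxM DD !mulmxA.
have -> : (U *m x)^t* *m (U *m x) = (U *m x)^t* *m diag_mx (const_mx 1) *m (U *m x).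
  by rewrite diag_const_mx mulmx1.
rewrite !dE; apply: ler_sum => i _.
by rewrite !mxE ler_wpM2r ?exprn_ge0 // expr_le1 // d0.
Qed.

End Hermitian.

(** * Multiplication of the symbol by zeta *)

Section Cascade.
Variable R : realType.
Local Notation C := R[i].

Lemma adjmxZ m n a (A : 'M[C]_(m, n)) : (a *: A)^t* = Num.conj a *: A^t*.
Proof. by rewrite linearZ /= map_mxZ. Qed.

Lemma adj_block m1 m2 n1 n2 (A : 'M[C]_(m1, n1)) (B : 'M[C]_(m1, n2))
    (K : 'M[C]_(m2, n1)) (D : 'M[C]_(m2, n2)) :
  (block_mx A B K D)^t* = block_mx (A^t*) (K^t*) (B^t*) (D^t*).
Proof. by rewrite tr_block_mx map_block_mx. Qed.

Lemma adj_row m n1 n2 (A : 'M[C]_(m, n1)) (B : 'M[C]_(m, n2)) :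
  (row_mx A B)^t* = col_mx (A^t*) (B^t*).
Proof. by rewrite tr_row_mx map_col_mx. Qed.

Lemma sdr_dissipative m n (A : 'M[C]_n) (B : 'M[C]_(n, m)) (K : 'M[C]_(m, n)) (D : 'M[C]_m) F :
  stable_dissipative_realization A B K D F -> dissipative A B K D.
Proof. by case. Qed.

(** A matrix commuting with [A] may be pulled out of the Lyapunov equation on both sides. *)
Lemma lyap_conj n m (A Z Q : 'M[C]_n) (K : 'M[C]_(m, n)) : A *m Z = Z *m A ->
  A *m Q + Q *m A^t* + K^t* *m K = 0 ->
  A *m (Z *m Q *m Z^t*) + Z *m Q *m Z^t* *m A^t* + (K *m Z^t*)^t* *m (K *m Z^t*) = 0.
Proof.
move=> AZ lyap; have ZA : Z^t* *m A^t* = A^t* *m Z^t* by rewrite -!adjmxM AZ.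
rewrite adjmxM trmxCK !mulmxA AZ -(mulmxA _ (Z^t*)) ZA.
have -> : Z *m A *m Q *m Z^t* + Z *m Q *m (A^t* *m Z^t*) + Z *m K^t* *m K *m Z^t* =
    Z *m (A *m Q + Q *m A^t* + K^t* *m K) *m Z^t*.
  by rewrite !mulmxDr !mulmxDl !mulmxA.
by rewrite lyap mulmx0 mul0mx.
Qed.

Section Step.
Variables (m nv nw : nat) (V : C -> 'M[C]_m).
Variables (Av : 'M[C]_nv) (Bv : 'M[C]_(nv, m)) (Cv : 'M[C]_(m, nv)) (Dv : 'M[C]_m).
Variables (Aw : 'M[C]_nw) (Bw : 'M[C]_(nw, m)) (Om : 'M[C]_(nv, nw)) (Q : 'M[C]_nw).
Hypotheses (sdV : stable_dissipative_realization Av Bv Cv Dv V) (sw : stable Aw).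
Hypothesis lyapO : Av *m Om + Om *m Aw^t* + Bv *m Bw^t* = 0.
Let Co := Dv *m Bw^t* + Cv *m Om.
Hypothesis lyapQ : Aw *m Q + Q *m Aw^t* + Co^t* *m Co = 0.

(** As [zeta(s) = -1 + 2/(s+1)], the scalar data (-1, r, r, -1) realize zeta, and [-1 - 1 + r^2 = 0]
    is dissipativity. [A'], [B'], [K'] feed the output of [V] into m copies of this section. *)
Let r : C := sqrtC 2.
Let rr : r * r = 2. Proof. by rewrite -expr2 sqrtCK. Qed.
Let rc : Num.conj r = r. Proof. by apply: geC0_conj; rewrite sqrtC_ge0 ler0n. Qed.

Let A' : 'M[C]_(nv + m) := block_mx Av 0 (r *: Cv) (- 1%:M).
Let B' : 'M[C]_(nv + m, m) := col_mx Bv (r *: Dv).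
Let K' : 'M[C]_(m, nv + m) := row_mx (- Cv) (r%:M).
Let Z := zeta_opp Aw.
Let W1 : 1%:M - Aw \in unitmx.
Proof. by apply: (stable_stab sw); rewrite /= ler01. Qed.
(** The lower block of the new Lyapunov equation is [O2 (1 - A_w^* ) = r C_o], which determines
    [O2]. *)
Let O2 : 'M[C]_(m, nw) := r *: (Co *m invmx (1%:M - Aw^t*)).
Let Om' : 'M[C]_(nv + m, nw) := col_mx Om O2.

Lemma cascade_pencil (s : C) : s%:M - A' = block_mx (s%:M - Av) 0 (- (r *: Cv)) ((s + 1)%:M).
Proof.
rewrite (scalar_mx_block nv m s) /A' opp_block_mx add_block_mx !oppr0 !add0r opprK.
by rewrite -raddfD.
Qed.

(** For [m = 0] the lower diagonal block is empty and has determinant 1 at every s. *)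
Lemma cascade_pencil_unit s : (s%:M - A' \in unitmx) = (s%:M - Av \in unitmx) && ((s + 1 != 0) || (m == 0)%N).
Proof.
rewrite cascade_pencil !unitmxE det_lblock det_scalar unitrM; congr (_ && _).
case: m => [|p]; first by rewrite expr0 unitr1 orbT.
by rewrite unitrX_pos // unitfE orbF.
Qed.

Lemma cascade_stable : stable A'.
Proof.
move=> a; rewrite eigenvalue_unit cascade_pencil_unit negb_and -eigenvalue_unit => /orP[|].
  by case: sdV => _ sA _ _ _; exact: sA.
rewrite negb_or negbK => /andP[]; rewrite addr_eq0 => /eqP -> _.
by rewrite /= oppr_lt0 ltr01.
Qed.

Lemma cascade_realization : realization A' B' K' (- Dv) (fun s => zeta s *: V s).
Proof.
move=> s; rewrite eigenvalue_unit negbK cascade_pencil_unit => /andP[su].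
have [m0 _|m0] := posnP m.
  by apply/matrixP => i; case: (ltnP i 0) => // _; have := ltn_ord i; rewrite {2}m0.
rewrite orbF => s1.
have [rV _ _ _ _] := sdV; rewrite rV ?eigenvalue_unit ?su //.
pose a := invmx (s%:M - Av) *m Bv; pose y := Cv *m a + Dv.
rewrite -(mulmxA K').
(* The upper state is that of [V]; the lower one is its output [y = V(s)] passed through
   [r / (s+1)]. *)
have -> : invmx (s%:M - A') *m B' = col_mx a ((r / (s + 1)) *: y).
  have uA : s%:M - A' \in unitmx by rewrite cascade_pencil_unit su s1.
  apply: (can_inj (mulKmx uA)); rewrite mulKVmx //.
  rewrite cascade_pencil mul_block_col mul0mx addr0 /a mulKVmx // -/a.
  congr (col_mx _ _); rewrite mul_scalar_mx scalerA mulrCA divff // mulr1.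
  by rewrite mulNmx -scalemxAl /y scalerDr addrA addNr add0r.
rewrite mul_row_col mul_scalar_mx scalerA mulrA rr mulNmx -mulmxA -/a.
have -> : Dv + Cv *m a = y by rewrite addrC.
have -> : - Dv + (- (Cv *m a) + (2 / (s + 1)) *: y) = (2 / (s + 1) - 1) *: y.
  by rewrite scalerBl scale1r addrA -opprD [Dv + _]addrC -/y addrC.
congr (_ *: _); rewrite /zeta [1 + s]addrC; field; exact: s1.
Qed.

Lemma cascade_sdr : stable_dissipative_realization A' B' K' (- Dv) (fun s => zeta s *: V s).
Proof.
have [_ _ dA dD dB] := sdV; split.
- exact: cascade_realization.
- exact: cascade_stable.
- rewrite /A' /K' adj_block adj_row add_block_mx mul_col_row add_block_mx.
  rewrite !adjmxN adjmxZ rc adjmx0 adjmx1 adjmx_scalar rc add0r addr0.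
  rewrite mulNmx mulmxN opprK dA mulNmx mul_mx_scalar subrr.
  rewrite mul_scalar_mx scalerN subrr -scalar_mxM rr -!raddfN -!raddfD /=.
  rewrite (_ : _ + 2 = 0 :> C); last by ring.
  by rewrite raddf0 block_mx0.
- apply/unitarymxP; rewrite adjmxN mulNmx mulmxN opprK; exact/unitarymxP.
- rewrite /B' /K' adj_row adjmxN adjmx_scalar rc mulmxN opprK mul_col_mx.
  by rewrite mulNmx dB mul_scalar_mx.
Qed.

Let W1' : 1%:M - Aw^t* \in unitmx.
Proof. by rewrite -(adjmx1 C nw) -adjmxN -adjmxD adjmx_unit. Qed.

Lemma cascade_lyap : A' *m Om' + Om' *m Aw^t* + B' *m Bw^t* = 0.
Proof.
rewrite /A' /Om' /B' mul_block_col mul0mx addr0 !mul_col_mx !add_col_mx lyapO.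
suff -> : r *: Cv *m Om + - 1%:M *m O2 + O2 *m Aw^t* + r *: Dv *m Bw^t* = 0 by rewrite col_mx0.
have E : O2 *m (1%:M - Aw^t*) = r *: Co by rewrite /O2 -scalemxAl mulmxKV.
have -> : r *: Cv *m Om + - 1%:M *m O2 + O2 *m Aw^t* + r *: Dv *m Bw^t* =
    r *: Co - O2 *m (1%:M - Aw^t*).
  rewrite /Co mulmxBr mulmx1 mulNmx mul1mx scalerDr -!scalemxAl opprB.
  move: (r *: (Cv *m Om)) (r *: (Dv *m Bw^t*)) (O2 *m Aw^t*) O2 => a b c d.
  by apply/matrixP => i j; rewrite !mxE; ring.
by rewrite E subrr.
Qed.

Lemma zeta_opp_adj : Z^t* = invmx (1%:M - Aw^t*) *m (1%:M + Aw^t*).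
Proof.
have E : (invmx (1%:M - Aw))^t* = invmx (1%:M - Aw^t*).
  apply: (can_inj (mulKmx W1')); rewrite mulmxV //.
  have -> : 1%:M - Aw^t* = (1%:M - Aw)^t* by rewrite adjmxD adjmxN adjmx1.
  by rewrite -adjmxM mulVmx // adjmx1.
by rewrite /Z /zeta_opp adjmxM E adjmxD adjmx1.
Qed.

(** The new [C_o] is [C_o (2 (1 - A_w^* )^-1 - 1)], and the bracket is the Cayley transform
    [zeta(-A_w)^*]. This is where the conjugation of [Q] by [zeta(-A_w)] originates. *)
Lemma cascade_Co : - Dv *m Bw^t* + K' *m Om' = Co *m Z^t*.
Proof.
have -> : Z^t* = 2 *: invmx (1%:M - Aw^t*) - 1%:M.
  rewrite zeta_opp_adj; have -> : 1%:M + Aw^t* = 2%:M - (1%:M - Aw^t*).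
    have -> : 2%:M = 1%:M + 1%:M :> 'M[C]_nw by rewrite -raddfD.
    by rewrite opprB addrACA subrr addr0.
  by rewrite mulmxBr mulVmx // mul_mx_scalar.
rewrite mul_row_col mul_scalar_mx scalerA rr !mulNmx mulmxBr mulmx1 scalemxAr.
by rewrite addrA -opprD addrC.
Qed.

Lemma zeta_opp_comm : Aw *m Z = Z *m Aw.
Proof.
have E : Aw *m (1%:M - Aw) = (1%:M - Aw) *m Aw by rewrite mulmxBl mulmxBr mul1mx mulmx1.
have EV : Aw *m invmx (1%:M - Aw) = invmx (1%:M - Aw) *m Aw.
  by apply: (can_inj (mulKmx W1)); rewrite mulmxA -E -mulmxA mulmxV // mulmx1 mulmxA mulmxV // mul1mx.
rewrite /Z /zeta_opp mulmxA -(mulmxA (1%:M + Aw)) -EV mulmxA; congr (_ *m _).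
by rewrite mulmxDr mulmxDl mulmx1 mul1mx.
Qed.

Lemma cascade_lyapQ : let Co' := Co *m Z^t* in
  Aw *m (Z *m Q *m Z^t*) + Z *m Q *m Z^t* *m Aw^t* + Co'^t* *m Co' = 0.
Proof. exact: lyap_conj zeta_opp_comm lyapQ. Qed.

Lemma cascade_step : exists nv' (A1 : 'M[C]_nv') (B1 : 'M[C]_(nv', m)) (K1 : 'M[C]_(m, nv'))
    (D1 : 'M[C]_m) (om1 : 'M[C]_(nv', nw)),
  let C1 := D1 *m Bw^t* + K1 *m om1 in let Q1 := Z *m Q *m Z^t* in
  [/\ stable_dissipative_realization A1 B1 K1 D1 (fun s => zeta s *: V s),
      A1 *m om1 + om1 *m Aw^t* + B1 *m Bw^t* = 0
    & Aw *m Q1 + Q1 *m Aw^t* + C1^t* *m C1 = 0].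
Proof.
exists (nv + m)%N, A', B', K', (- Dv), Om'; split.
- exact: cascade_sdr.
- exact: cascade_lyap.
- by rewrite cascade_Co; exact: cascade_lyapQ.
Qed.

End Step.

(** Iteration is possible because a cascade step keeps [A_w] and [B_w] and returns data of the same
    kind for [zeta V]; only the state space of [V] grows, by m each time. *)
Lemma cascade m nv nw (V : C -> 'M[C]_m) Av (Bv : 'M[C]_(nv, m)) Cv Dv (Aw : 'M[C]_nw)
    (Bw : 'M[C]_(nw, m)) Om Q k :
  let Co := Dv *m Bw^t* + Cv *m Om in
  stable_dissipative_realization Av Bv Cv Dv V -> stable Aw ->
  Av *m Om + Om *m Aw^t* + Bv *m Bw^t* = 0 -> Aw *m Q + Q *m Aw^t* + Co^t* *m Co = 0 ->
  exists nv' (A1 : 'M[C]_nv') (B1 : 'M[C]_(nv', m)) (K1 : 'M[C]_(m, nv'))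
    (D1 : 'M[C]_m) (om1 : 'M[C]_(nv', nw)),
  let C1 := D1 *m Bw^t* + K1 *m om1 in
  let Q1 := (zeta_opp Aw) ^+ k *m Q *m ((zeta_opp Aw)^t*) ^+ k in
  [/\ stable_dissipative_realization A1 B1 K1 D1 (fun s => zeta s ^+ k *: V s),
      A1 *m om1 + om1 *m Aw^t* + B1 *m Bw^t* = 0
    & Aw *m Q1 + Q1 *m Aw^t* + C1^t* *m C1 = 0].
Proof.
move=> Co sdV sw lyapO lyapQ; elim: k => [|k IH].
  exists nv, Av, Bv, Cv, Dv, Om; rewrite /= !expr0 mul1mx mulmx1; split=> //.
  by rewrite (_ : (fun s => _) = V) //; apply/funext => s; rewrite expr0 scale1r.
have [n [A1 [B1 [K1 [D1 [om1 H1]]]]]] := IH; have [h1 h2 h3] := H1.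
have [n' [A2 [B2 [K2 [D2 [om2 [g1 g2 g3]]]]]]] := cascade_step h1 sw h2 h3.
exists n', A2, B2, K2, D2, om2; split; [|exact: g2|].
  rewrite (_ : (fun s => _) = (fun s => zeta s *: (zeta s ^+ k *: V s))) //.
  by apply/funext => s; rewrite exprS scalerA.
rewrite exprS exprSr /= -!mulmxE.
by move: g3; rewrite /= !mulmxA.
Qed.

End Cascade.

(** * Conjugate partitions *)

Section Kappas.
Local Open Scope nat_scope.

(** The symmetry of a Young diagram: the k-th column has more than j boxes exactly when row j has at
    least k. *)
Lemma sorted_count_nth (s : seq nat) k j : sorted geq s -> 0 < k ->
  (j < count (leq k) s) = (k <= nth 0 s j).
Proof.
move=> ss k0; elim: s j ss => [|x s IH] j; first by rewrite /= nth_nil [RHS]leqNgt k0.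
move=> /= xs; have ss := path_sorted xs.
have [kx|xk] := leqP k x.
  by case: j => [|j] //=; rewrite add1n ltnS IH.
have sx : all (fun n => n <= x) s.
  by apply: order_path_min xs => a b c; rewrite /geq /= => h1 h2; exact: leq_trans h2 h1.
have c0 : count (leq k) s = 0.
  apply/eqP; rewrite -leqn0 leqNgt -has_count; apply/hasPn => n /(allP sx) nx.
  by rewrite -ltnNge (leq_ltn_trans nx).
rewrite c0 /= ltn0; case: j => [|j] /=; first by rewrite leqNgt xk.
by rewrite -IH // c0 ltn0.
Qed.

Lemma negpartD (l : int) (k : nat) : negpart (l + k%:Z)%R = negpart l - k.
Proof.
rewrite /negpart; case: ifP; case: ifP; lia.
Qed.

Lemma count_kappas m (lam : 'I_m -> int) k : 0 < k ->
  count (leq k) (kappas lam) = \sum_j (k <= negpart (lam j)).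
Proof.
move=> k0; rewrite /kappas count_sort count_map count_filter -sum1_count big_mkcond big_enum /=.
apply: eq_bigr => j _; rewrite /negpart.
by case: (lam j < 0)%R; rewrite ?andbT ?andbF ?leqn0 ?(gtn_eqF k0) //; case: leqP.
Qed.

Lemma kappas_sorted m (lam : 'I_m -> int) : sorted geq (kappas lam).
Proof. by apply: sort_sorted => a b; rewrite /geq /= leq_total. Qed.

Lemma size_kappas m (lam : 'I_m -> int) : size (kappas lam) = count (leq 1) (kappas lam).
Proof.
apply/esym/eqP; rewrite -all_count all_sort; apply/allP => n /mapP[j].
by rewrite mem_filter => /andP[l0 _] ->; rewrite absz_gt0 lt_eqF.
Qed.

(** Since [N k] is the sum of the truncated differences [kappa_j - k], going from [k - 1] to [k]
    loses one unit for each [kappa_j >= k]. Hence [mu k] counts these, and conjugating back recovers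
    [kappa_j]. *)
Lemma kappas_conjugate m (lam : 'I_m -> int) (N : nat -> nat) (mu : nat -> int) :
  (forall k, N k = \sum_j negpart (lam j + k%:Z)%R) ->
  (forall k, mu k = (N k.-1)%:Z - (N k)%:Z)%R ->
  ((size (kappas lam))%:Z = mu 1)%R /\
  forall j, 1 <= j <= size (kappas lam) ->
    ([set k : nat | (1 <= k)%N /\ (j%:Z <= mu k)%R] #= `I_(nth 0 (kappas lam) j.-1))%card.
Proof.
move=> NE muE.
have mu_count k : 0 < k -> mu k = Posz (count (leq k) (kappas lam)).
  move=> k0; rewrite muE !NE count_kappas //.
  have -> : \sum_j negpart (lam j + k.-1%:Z)%R =
      \sum_j (k <= negpart (lam j)) + \sum_j negpart (lam j + k%:Z)%R.
    rewrite -big_split /=; apply: eq_bigr => j _; rewrite !negpartD; move: k0; lia.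
  by rewrite PoszD addrK.
split; first by rewrite mu_count // size_kappas.
move=> [|j] // /andP[_ js] /=.
(* The set is [{1, ..., kappa_(j+1)}], the shift of the initial segment counted from 0. *)
have -> : [set k : nat | (1 <= k)%N /\ (j.+1%:Z <= mu k)%R] = succn @` `I_(nth 0 (kappas lam) j).
  apply/seteqP; split=> k /=.
    move=> [k0]; rewrite mu_count // lez_nat (sorted_count_nth _ (kappas_sorted lam)) // => kn.
    by exists k.-1; rewrite /= prednK.
  move=> [i /= ij <-]; split=> //.
  by rewrite mu_count // lez_nat (sorted_count_nth _ (kappas_sorted lam)).
by apply: inj_card_eq => a b _ _ [].
Qed.

End Kappas.

(** * Matrix exponentials *)

Section ComplexCalculus.
Variable R : realType.
Local Notation C := R[i].
Local Notation Re := complex.Re.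
Local Notation Im := complex.Im.
Implicit Types (f g : R -> C) (t : R) (z w : C).

(** Derivative along the real line of a complex valued function, taken on real and imaginary parts
    so that the real calculus applies. *)
Definition Cder f t z :=
  is_derive t (1 : R) (fun u => Re (f u)) (Re z) /\ is_derive t (1 : R) (fun u => Im (f u)) (Im z).

Lemma CRe_D z w : Re (z + w) = Re z + Re w. Proof. by case: z; case: w. Qed.
Lemma CIm_D z w : Im (z + w) = Im z + Im w. Proof. by case: z; case: w. Qed.
Lemma CRe_N z : Re (- z) = - Re z. Proof. by case: z. Qed.
Lemma CIm_N z : Im (- z) = - Im z. Proof. by case: z. Qed.
Lemma CRe_M z w : Re (z * w) = Re z * Re w - Im z * Im w. Proof. by case: z; case: w. Qed.
Lemma CIm_M z w : Im (z * w) = Re z * Im w + Im z * Re w. Proof. by case: z; case: w. Qed.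
Lemma C_eqP z w : Re z = Re w -> Im z = Im w -> z = w.
Proof. by case: z; case: w => a b c d /= -> ->. Qed.

Lemma Cder_eq f t z w : Cder f t z -> z = w -> Cder f t w.
Proof. by move=> h <-. Qed.

Lemma Cder_cst z t : Cder (fun=> z) t 0.
Proof. by split; exact: is_derive_cst. Qed.

Lemma CderD f g t z w : Cder f t z -> Cder g t w -> Cder (fun u => f u + g u) t (z + w).
Proof.
move=> [fr fi] [gr gi]; split.
  by rewrite CRe_D; under eq_fun do rewrite CRe_D; exact: is_deriveD.
by rewrite CIm_D; under eq_fun do rewrite CIm_D; exact: is_deriveD.
Qed.

Lemma CderM f g t z w : Cder f t z -> Cder g t w ->
  Cder (fun u => f u * g u) t (z * g t + f t * w).
Proof.
move=> [fr fi] [gr gi]; split.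
  under eq_fun do rewrite CRe_M.
  apply: (is_derive_eq (is_deriveB (is_deriveM fr gr) (is_deriveM fi gi))).
  rewrite CRe_D !CRe_M /GRing.scale /=; ring.
under eq_fun do rewrite CIm_M.
apply: (is_derive_eq (is_deriveD (is_deriveM fr gi) (is_deriveM fi gr))).
rewrite CIm_D !CIm_M /GRing.scale /=; ring.
Qed.

Lemma Cder_sum (I : Type) (r : seq I) (F : I -> R -> C) (d : I -> C) t :
  (forall i, Cder (F i) t (d i)) -> Cder (fun u => \sum_(i <- r) F i u) t (\sum_(i <- r) d i).
Proof.
move=> H; elim: r => [|i r IH].
  by rewrite big_nil; under eq_fun do rewrite big_nil; exact: Cder_cst.
by rewrite big_cons; under eq_fun do rewrite big_cons; exact: CderD.
Qed.

(** The l^1 norm of the two parts: real valued, submultiplicative and comparable with the modulus,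
    which is enough for all estimates. *)
Definition cn z : R := `|Re z| + `|Im z|.

Lemma cn_ge0 z : 0 <= cn z. Proof. by rewrite addr_ge0. Qed.
Lemma cn0 : cn 0 = 0. Proof. by rewrite /cn /= normr0 addr0. Qed.
Lemma cnD z w : cn (z + w) <= cn z + cn w.
Proof. by rewrite /cn CRe_D CIm_D addrACA lerD // ler_normD. Qed.
Lemma cnM z w : cn (z * w) <= cn z * cn w.
Proof.
rewrite /cn CRe_M CIm_M mulrDl !mulrDr.
apply: (@le_trans _ _ ((`|Re z * Re w| + `|Im z * Im w|) + (`|Re z * Im w| + `|Im z * Re w|))).
  by rewrite lerD // ?ler_normD // ler_normB.
by rewrite !normrM; lra.
Qed.
Lemma cn_sum (I : Type) (r : seq I) (F : I -> C) :
  cn (\sum_(i <- r) F i) <= \sum_(i <- r) cn (F i).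
Proof.
elim: r => [|i r IH]; first by rewrite !big_nil cn0.
by rewrite !big_cons (le_trans (cnD _ _)) // lerD2l.
Qed.
Lemma cn_Re z : `|Re z| <= cn z. Proof. by rewrite lerDl. Qed.
Lemma cn_Im z : `|Im z| <= cn z. Proof. by rewrite lerDr. Qed.
Lemma cn_eq0 z : cn z = 0 -> z = 0.
Proof.
move=> h; apply: C_eqP; apply/eqP; rewrite -normr_le0; [rewrite -h; exact: cn_Re|rewrite -h; exact: cn_Im].
Qed.

Definition cexp z t : C := Complex (expR (Re z * t) * cos (Im z * t)) (expR (Re z * t) * sin (Im z * t)).

Lemma cexp0 z : cexp z 0 = 1.
Proof. by rewrite /cexp !mulr0 expR0 cos0 sin0 mulr1 mulr0. Qed.

Lemma is_derive_linear (a t : R) : is_derive t (1 : R) (fun u => a * u) a.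
Proof.
apply: (is_derive_eq (is_deriveZ a (is_derive_id t (1 : R)))).
by rewrite /GRing.scale /= mulr1.
Qed.

Lemma Cder_cexp z t : Cder (cexp z) t (z * cexp z t).
Proof.
case: z => a b; rewrite /cexp /=.
have e : is_derive t (1 : R) (fun u => expR (a * u)) (expR (a * t) * a).
  exact: (is_derive1_comp (is_derive_expR (a * t)) (is_derive_linear a t)).
have c : is_derive t (1 : R) (fun u => cos (b * u)) (- sin (b * t) * b).
  exact: (is_derive1_comp (is_derive_cos (b * t)) (is_derive_linear b t)).
have s : is_derive t (1 : R) (fun u => sin (b * u)) (cos (b * t) * b).
  exact: (is_derive1_comp (is_derive_sin (b * t)) (is_derive_linear b t)).
split; rewrite /=.
  apply: (is_derive_eq (is_deriveM e c)); rewrite /GRing.scale /=; ring.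
apply: (is_derive_eq (is_deriveM e s)); rewrite /GRing.scale /=; ring.
Qed.

Lemma cn_cexp z t : cn (cexp z t) <= 2 * expR (Re z * t).
Proof.
rewrite /cn /cexp /= !normrM ger0_norm ?expR_ge0 // -mulrDr mulrC ler_wpM2r ?expR_ge0 //.
by rewrite -[2]/(1 + 1) lerD // ler_norml ?cos_geN1 ?cos_le1 ?sin_geN1 ?sin_le1.
Qed.

Lemma Cder_horner (p : {poly C}) t : Cder (fun u => p.[u%:C%C]) t (p^`().[t%:C%C]).
Proof.
elim/poly_ind: p => [|p c IH].
  by rewrite deriv0 horner0; under eq_fun do rewrite horner0; exact: Cder_cst.
have X : Cder (fun u => u%:C%C) t 1 by split; [exact: is_derive_id|exact: is_derive_cst].
under eq_fun do rewrite hornerMXaddC.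
apply: Cder_eq (CderD (CderM IH X) (Cder_cst c t)) _.
by rewrite derivD derivC derivM derivX !mulr1 !addr0 hornerD hornerM hornerX.
Qed.

(** An exponential polynomial, given by pairs of a polynomial coefficient and a frequency. *)
Definition epf (s : seq ({poly C} * C)) t : C := \sum_(x <- s) x.1.[t%:C%C] * cexp x.2 t.

(** For [z = 0] this is integration. Otherwise [p/z] solves the equation up to [p'/z], which has
    smaller degree, and induction corrects it. *)
Lemma poly_antiderivative (p : {poly C}) z : exists q : {poly C}, q^`() + z *: q = p.
Proof.
have [->|z0] := eqVneq z 0.
  exists (\poly_(i < (size p).+1) (p`_i.-1 / i%:R)); rewrite scale0r addr0.
  apply/polyP => i; rewrite coef_deriv coef_poly ltnS.
  case: ltnP => h; last by rewrite mul0rn nth_default.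
  by rewrite -[LHS]mulr_natr divfK // pnatr_eq0.
have [n] := ubnP (size p); elim: n p => // n IH p; rewrite ltnS => sp.
have [p0|p0] := eqVneq p 0; first by exists 0; rewrite p0 deriv0 scaler0 addr0.
have [q qE] := IH (z^-1 *: p^`()) (leq_trans (leq_ltn_trans (size_scale_leq _ _) (lt_size_deriv p0)) sp).
exists (z^-1 *: p - q); rewrite derivB derivZ scalerBr scalerA divff // scale1r.
by rewrite addrACA -opprD qE addrAC subrr add0r.
Qed.

(** A particular solution is found frequency by frequency; a multiple of [e^(zt)] then adjusts the
    initial value. Recording the frequencies gives the decay rate later. *)
Lemma ep_solve z (s : seq ({poly C} * C)) : exists s' : seq ({poly C} * C),
  [/\ forall t, Cder (epf s') t (z * epf s' t + epf s t), epf s' 0 = 0 &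
    {subset [seq x.2 | x <- s'] <= z :: [seq x.2 | x <- s]}].
Proof.
have [s1 [h1 h2]] : exists s1 : seq ({poly C} * C),
    (forall t, Cder (epf s1) t (z * epf s1 t + epf s t)) /\ [seq x.2 | x <- s1] = [seq x.2 | x <- s].
  elim: s => [|[p m] s [s1 [h1 h2]]].
    exists [::]; split=> // t; rewrite /epf big_nil mulr0 addr0.
    by under eq_fun do rewrite big_nil; exact: Cder_cst.
  have [q qE] := poly_antiderivative p (m - z).
  exists ((q, m) :: s1); split; last by rewrite /= h2.
  move=> t; have := CderD (CderM (Cder_horner q t) (Cder_cexp m t)) (h1 t).
  rewrite /epf !big_cons /=; under [X in _ -> Cder X _ _]eq_fun do rewrite big_cons /=.
  move=> h; apply: Cder_eq h _; rewrite -qE hornerD hornerZ; ring.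
have e : epf (rcons s1 ((- epf s1 0)%:P, z)) = fun u => epf s1 u + - epf s1 0 * cexp z u.
  by apply/funext => u; rewrite {1}/epf big_rcons /= hornerC addrC.
exists (rcons s1 ((- epf s1 0)%:P, z)); split.
- move=> t; rewrite e; apply: Cder_eq (CderD (h1 t) (CderM (Cder_cst (- epf s1 0) t) (Cder_cexp z t))) _.
  ring.
- by rewrite e cexp0 mulr1 subrr.
- move=> x; rewrite map_rcons mem_rcons inE h2 inE => /orP[->//|->]; by rewrite orbT.
Qed.

(** Each factor t costs half of the available rate, by [t <= (2/e) e^(et/2)]. *)
Lemma poly_expR_bound (p : {poly C}) (e : R) : 0 < e ->
  exists M : R, 0 <= M /\ forall t, 0 <= t -> cn p.[t%:C%C] <= M * expR (e * t).
Proof.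
elim/poly_ind: p e => [|p c IH] e e0.
  by exists 0; split=> // t _; rewrite horner0 cn0 mul0r.
have e2 : 0 < e / 2 by rewrite divr_gt0.
have [M [M0 H]] := IH _ e2; exists (M * (2 / e) + cn c); split.
  by rewrite addr_ge0 ?cn_ge0 // mulr_ge0 // divr_ge0 // ltW.
move=> t t0; rewrite hornerMXaddC (le_trans (cnD _ _)) // mulrDl lerD //; last first.
  by rewrite ler_peMr ?cn_ge0 // -expR0 ler_expR mulr_ge0 // ltW.
rewrite (le_trans (cnM _ _)) //.
have tE : cn t%:C%C <= (2 / e) * expR (e / 2 * t).
  rewrite /cn /= normr0 addr0 ger0_norm // mulrAC ler_pdivlMr // mulrC.
  by have := expR_ge1Dx (e / 2 * t); lra.
have -> : e * t = e / 2 * t + e / 2 * t by rewrite -mulrDl -splitr.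
rewrite expRD mulrACA; apply: ler_pM; rewrite ?cn_ge0 ?tE //; exact: H.
Qed.

Lemma epf_decay (s : seq ({poly C} * C)) (d : R) : (forall x, x \in s -> Re x.2 < - d) ->
  exists M : R, 0 <= M /\ forall t, 0 <= t -> cn (epf s t) <= M * expR (- d * t).
Proof.
elim: s => [|[p m] s IH] H.
  by exists 0; split=> // t _; rewrite /epf big_nil cn0 mul0r.
have [M [M0 HM]] := IH (fun x xs => H x (mem_behead (s := _ :: s) xs)).
have md : 0 < - d - Re m by rewrite subr_gt0; exact: (H (p, m) (mem_head _ _)).
have [N [N0 HN]] := poly_expR_bound p md.
exists (N * 2 + M); split; first by rewrite addr_ge0 // mulr_ge0.
move=> t t0; rewrite /epf big_cons /= (le_trans (cnD _ _)) // mulrDl lerD //; last exact: HM.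
rewrite (le_trans (cnM _ _)) //.
have -> : N * 2 * expR (- d * t) = N * expR ((- d - Re m) * t) * (2 * expR (Re m * t)).
  by rewrite mulrACA -expRD -mulrDl subrK.
by apply: ler_pM; rewrite ?cn_ge0 ?HN ?cn_cexp.
Qed.

End ComplexCalculus.

Section MatrixExponential.
Variable R : realType.
Local Notation C := R[i].
Local Notation Re := complex.Re.
Local Notation Im := complex.Im.

Definition Mder m n (F : R -> 'M[C]_(m, n)) t (D : 'M[C]_(m, n)) :=
  forall i j, Cder (fun u => F u i j) t (D i j).

Lemma Mder_eq m n (F : R -> 'M[C]_(m, n)) t D D' : Mder F t D -> D = D' -> Mder F t D'.
Proof. by move=> h <-. Qed.

Lemma Mder_cst m n (A : 'M[C]_(m, n)) t : Mder (fun=> A) t 0.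
Proof. by move=> i j; rewrite mxE; exact: Cder_cst. Qed.

Lemma MderD m n (F G : R -> 'M[C]_(m, n)) t D D' : Mder F t D -> Mder G t D' ->
  Mder (fun u => F u + G u) t (D + D').
Proof.
by move=> h h' i j; rewrite mxE; under eq_fun do rewrite mxE; exact: CderD.
Qed.

Lemma MderM m n p (F : R -> 'M[C]_(m, n)) (G : R -> 'M[C]_(n, p)) t D D' :
  Mder F t D -> Mder G t D' -> Mder (fun u => F u *m G u) t (D *m G t + F t *m D').
Proof.
move=> h h' i j; under eq_fun do rewrite mxE.
have := @Cder_sum _ _ (index_enum 'I_n) (fun k u => F u i k * G u k j) _ t
  (fun k => CderM (h i k) (h' k j)).
by move=> H; apply: Cder_eq H _; rewrite !mxE -big_split.
Qed.

Lemma MderZ m n (f : R -> C) (A : 'M[C]_(m, n)) t d : Cder f t d ->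
  Mder (fun u => f u *: A) t (d *: A).
Proof.
move=> h i j; under eq_fun do rewrite mxE.
by apply: Cder_eq (CderM h (Cder_cst _ t)) _; rewrite mulr0 addr0 mxE.
Qed.

Lemma MderMl m n p (A : 'M[C]_(m, n)) (F : R -> 'M[C]_(n, p)) t D :
  Mder F t D -> Mder (fun u => A *m F u) t (A *m D).
Proof. by move=> h; apply: Mder_eq (MderM (Mder_cst A t) h) _; rewrite mul0mx add0r. Qed.

Lemma MderMr m n p (F : R -> 'M[C]_(m, n)) (A : 'M[C]_(n, p)) t D :
  Mder F t D -> Mder (fun u => F u *m A) t (D *m A).
Proof. by move=> h; apply: Mder_eq (MderM h (Mder_cst A t)) _; rewrite mulmx0 addr0. Qed.

Lemma Mder_sub m n (F : R -> 'M[C]_(m, n)) (s t : R) D :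
  Mder F (s - t) D -> Mder (fun u => F (s - u)) t (- D).
Proof.
move=> h i j; have [h1 h2] := h i j; rewrite mxE.
have d : is_derive t (1 : R) (fun u => s - u) (-1).
  by apply: (is_derive_eq (is_deriveB (is_derive_cst s t 1) (is_derive_id t 1))); rewrite sub0r.
split; rewrite ?CRe_N ?CIm_N.
  have := @is_derive1_comp _ (fun u => Re (F u i j)) (fun u => s - u) t _ _ h1 d.
  by rewrite mulrN1.
have := @is_derive1_comp _ (fun u => Im (F u i j)) (fun u => s - u) t _ _ h2 d.
by rewrite mulrN1.
Qed.

Lemma Mder0_cst m n (F : R -> 'M[C]_(m, n)) : (forall t, Mder F t 0) -> forall s t, F s = F t.
Proof.
move=> h s t; apply/matrixP => i j; apply: C_eqP.
  by apply: (@is_derive_0_is_cst _ (fun u => Re (F u i j))) => x; have := (h x i j).1; rewrite mxE.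
by apply: (@is_derive_0_is_cst _ (fun u => Im (F u i j))) => x; have := (h x i j).2; rewrite mxE.
Qed.

Definition decays m n (F : R -> 'M[C]_(m, n)) (d : R) := exists M : R, 0 <= M /\
  forall t i j, 0 <= t -> cn (F t i j) <= M * expR (- d * t).

Lemma decays_scale m n (A : 'M[C]_(m, n)) s (d : R) : (forall x, x \in s -> Re x.2 < - d) ->
  decays (fun t => epf s t *: A) d.
Proof.
move=> /epf_decay[M [M0 H]]; pose N := \sum_i \sum_j cn (A i j).
have N0 : 0 <= N by apply: sumr_ge0 => i _; apply: sumr_ge0 => j _; exact: cn_ge0.
exists (M * N); split; first exact: mulr_ge0.
move=> t i j t0; rewrite mxE (le_trans (cnM _ _)) // mulrAC ler_pM ?cn_ge0 ?H //.
rewrite /N (bigD1 i) //= (bigD1 j) //= -addrA lerDl addr_ge0 //.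
  by apply: sumr_ge0 => k _; exact: cn_ge0.
by apply: sumr_ge0 => k _; apply: sumr_ge0 => l _; exact: cn_ge0.
Qed.

Lemma decaysD m n (F G : R -> 'M[C]_(m, n)) d : decays F d -> decays G d ->
  decays (fun t => F t + G t) d.
Proof.
move=> [M [M0 HM]] [N [N0 HN]]; exists (M + N); split; first exact: addr_ge0.
by move=> t i j t0; rewrite mxE (le_trans (cnD _ _)) // mulrDl lerD ?HM ?HN.
Qed.

(* Putzer's method *)
Lemma putzer n (A : 'M[C]_n.+1) z (l : seq C) : exists (E : R -> 'M[C]_n.+1) (s : seq ({poly C} * C)),
  [/\ E 0 = 1, forall t, Mder E t (A *m E t - epf s t *: (\prod_(w <- z :: l) (A - w%:M))),
      forall t, A *m E t = E t *m A &
      {subset [seq x.2 | x <- s] <= z :: l} /\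
      forall d, (forall w, w \in z :: l -> Re w < - d) -> decays E d].
Proof.
elim/last_ind: l => [|l w [E [s [E0 dE EA [sl dec]]]]].
  exists (fun t => epf [:: (1, z)] t *: 1), [:: (1, z)].
  have eE t : epf [:: (1, z)] t = cexp z t.
    by rewrite /epf big_seq1 /= hornerC mul1r.
  split.
  - by rewrite eE cexp0 scale1r.
  - move=> t; rewrite (_ : epf _ = cexp z); last by apply/funext.
    apply: Mder_eq (MderZ _ (Cder_cexp z t)) _.
    rewrite big_seq1 -scalemxAr mulmx1 scalerBr opprB addrCA subrr addr0.
    by rewrite -[X in _ *: X = _]/(1%:M) !scale_scalar_mx mulr1 mulrC.
  - by move=> t; rewrite -scalemxAr -scalemxAl mulmx1 mul1mx.
  - split=> // d Hd; apply: decays_scale => x; rewrite inE => /eqP -> /=; apply: Hd; exact: mem_head.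
pose P := \prod_(v <- z :: l) (A - v%:M).
have AP : A *m P = P *m A.
  apply: (@commr_prod _ _ _ _ _ A) => v _; apply: commrB; first exact: commr_refl.
  exact: scalar_mxC.
have [s' [ds' s'0 s'l]] := ep_solve w s.
exists (fun t => E t + epf s' t *: P), s'; split.
- by rewrite s'0 scale0r addr0.
- move=> t; apply: Mder_eq (MderD (dE t) (MderZ P (ds' t))) _.
  have -> : \prod_(v <- z :: rcons l w) (A - v%:M) = P *m (A - w%:M).
    by rewrite -rcons_cons -cats1 big_cat big_seq1.
  rewrite -/P mulmxDr -scalemxAr AP mulmxBr mul_mx_scalar scalerBr scalerA scalerDl.
  rewrite [_ * w]mulrC; set a := A *m E t; set b := epf s t *: P; set c := epf s' t *: (P *m A).
  set e := (w * epf s' t) *: P.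
  by move: a b c e => a b c e; apply/matrixP => i j; rewrite !mxE; ring.
- by move=> t; rewrite mulmxDl mulmxDr EA -scalemxAr -scalemxAl AP.
- split=> [x /s'l|d Hd].
    rewrite inE => /orP[/eqP->|/sl]; first by rewrite -rcons_cons mem_rcons mem_head.
    by rewrite -rcons_cons mem_rcons inE => ->; rewrite orbT.
  have Hd' x : x \in z :: l -> Re x < - d.
    by move=> xl; apply: Hd; rewrite -rcons_cons mem_rcons inE xl orbT.
  apply: decaysD; first exact: dec.
  apply: decays_scale => x xs; have := s'l x.2 (map_f _ xs).
  rewrite inE => /orP[/eqP->|/sl]; last exact: Hd'.
  by apply: Hd; rewrite -rcons_cons mem_rcons mem_head.
Qed.

(** There are finitely many eigenvalues, so their real parts lie uniformly below some [-d < 0]. *)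
Lemma stable_gap n (A : 'M[C]_n) : stable A -> exists l : seq C,
  (forall a, (a \in l) = eigenvalue A a) /\ char_poly A = \prod_(z <- l) ('X - z%:P) /\
  exists2 d : R, 0 < d & forall a, a \in l -> Re a < - d.
Proof.
move=> sA; have [l lE] := closed_field_poly_normal (char_poly A).
have cE : char_poly A = \prod_(z <- l) ('X - z%:P).
  by rewrite [LHS]lE (monicP (char_poly_monic A)) scale1r.
have le a : (a \in l) = eigenvalue A a.
  by rewrite eigenvalue_root_char cE root_prod_XsubC.
exists l; split=> //; split=> //.
have : forall a, a \in l -> Re a < 0 by move=> a; rewrite le; exact: sA.
elim: l {lE cE le} => [|b l IH] H; first by exists 1.
have [d d0 Hd] := IH (fun a al => H a (mem_behead (s := b :: l) al)).
have b0 := H b (mem_head _ _).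
exists (Num.min d (- Re b / 2)); first by rewrite lt_min d0 divr_gt0 // oppr_gt0.
move=> a; rewrite inE => /orP[/eqP->|/Hd h].
  by rewrite ltrNr gt_min; apply/orP; right; lra.
by rewrite (lt_le_trans h) // lerN2 ge_min lexx.
Qed.

(** Running Putzer's method over all roots of the characteristic polynomial makes the residual
    product vanish by Cayley-Hamilton. The size 0 is separate because the method starts from one
    root. *)
Lemma expm_exists n (A : 'M[C]_n) : exists E : R -> 'M[C]_n,
  [/\ E 0 = 1%:M, forall t, Mder E t (A *m E t), forall t, A *m E t = E t *m A &
     stable A -> exists2 d, 0 < d & decays E d].
Proof.
case: n A => [|n] A.
  exists (fun=> 0); split=> [|t|t|_]; try by apply/matrixP => -[].
  - by case.
  - by exists 1 => //; exists 0; split=> // t [].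
have [l lE] := closed_field_poly_normal (char_poly A).
have cE : char_poly A = \prod_(z <- l) ('X - z%:P).
  by rewrite [LHS]lE (monicP (char_poly_monic A)) scale1r.
have : \prod_(z <- l) (A - z%:M) = 0.
  rewrite -(Cayley_Hamilton A) cE rmorph_prod; apply: eq_bigr => z _.
  by rewrite rmorphB /= horner_mx_X horner_mx_C.
case: l cE {lE} => [|z l] cE pE.
  by have := size_char_poly A; rewrite cE big_nil size_poly1.
have [E [s [E0 dE EA [_ dec]]]] := putzer A z l.
exists E; split=> //.
  by move=> t; apply: Mder_eq (dE t) _; rewrite pE scaler0 subr0.
move=> sA; have [l' [l'E [cE' [d d0 Hd]]]] := stable_gap sA.
exists d => //; apply: dec => w wl; apply: Hd; rewrite l'E eigenvalue_root_char cE.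
by rewrite root_prod_XsubC.
Qed.

Definition expm n (A : 'M[C]_n) : R -> 'M[C]_n := sval (cid (expm_exists A)).

Section Expm.
Variables (n : nat) (A : 'M[C]_n).

Lemma expm0 : expm A 0 = 1%:M.
Proof. by rewrite /expm; case: cid => E /= []. Qed.
Lemma Mder_expm t : Mder (expm A) t (A *m expm A t).
Proof. by rewrite /expm; case: cid => E /= [_ h _ _]; exact: h. Qed.
Lemma expm_comm t : A *m expm A t = expm A t *m A.
Proof. by rewrite /expm; case: cid => E /= [_ _ h _]; exact: h. Qed.
Lemma expm_decays : stable A -> exists2 d, 0 < d & decays (expm A) d.
Proof. by rewrite /expm; case: cid => E /= [_ _ _ h]; exact: h. Qed.

(** The product [E(s - u) E(u)] has derivative 0 in u because [E] commutes with [A]; compare u = t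
    and u = 0. *)
Lemma expm_subK s t : expm A (s - t) *m expm A t = expm A s.
Proof.
have := @Mder0_cst _ _ (fun u => expm A (s - u) *m expm A u) _ t 0.
rewrite subr0 expm0 mulmx1; apply=> u.
apply: Mder_eq (MderM (Mder_sub (Mder_expm (s - u))) (Mder_expm u)) _.
by rewrite mulNmx expm_comm mulmxA addNr.
Qed.

Lemma expmNK t : expm A (- t) *m expm A t = 1%:M.
Proof. by rewrite -[- t]sub0r expm_subK expm0. Qed.
Lemma expmKN t : expm A t *m expm A (- t) = 1%:M.
Proof. by apply: mulmx1C; exact: expmNK. Qed.
Lemma expm_sub s t : expm A (s - t) = expm A s *m expm A (- t).
Proof. by rewrite -[LHS]mulmx1 -(expmKN t) mulmxA expm_subK. Qed.

Lemma Mder_expmN t : Mder (fun u => expm A (- u)) t (- (A *m expm A (- t))).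
Proof.
have := @Mder_sub _ _ (expm A) 0 t _ (Mder_expm (0 - t)).
by under eq_fun do rewrite sub0r; rewrite sub0r.
Qed.

End Expm.
#[global] Opaque expm.
End MatrixExponential.

(** * Integrals of complex matrix functions *)

Section RealIntegrals.
Variable R : realType.
Local Notation leb := (@lebesgue_measure R).
Local Notation half := (`[0, +oo[%classic : set R).
Local Notation nhalf := (`]-oo, 0%R]%classic : set R).
Implicit Types (D : set R) (f g F : R -> R) (d M T : R).

Lemma integrable_scale D f (k : R) : measurable D -> leb.-integrable D (EFin \o f) ->
  leb.-integrable D (EFin \o (fun t => k * f t)).
Proof. by move=> mD h; have := @integrableZl _ _ R leb D mD k _ h; apply: eq_integrable. Qed.

Lemma integrable_add D f g : measurable D -> leb.-integrable D (EFin \o f) ->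
  leb.-integrable D (EFin \o g) -> leb.-integrable D (EFin \o (fun t => f t + g t)).
Proof. by move=> mD h h'; have := @integrableD _ _ R leb D mD _ _ h h'; apply: eq_integrable. Qed.

Lemma derive_continuous F f : (forall t, is_derive t (1 : R) F (f t)) -> continuous F.
Proof.
move=> h t; apply: differentiable_continuous; apply/derivable1_diffP.
by have [] := h t.
Qed.

Lemma continuous_measurable D f : measurable D -> continuous f -> measurable_fun D f.
Proof. by move=> mD cf; apply: measurable_funTS; exact: continuous_measurable_fun. Qed.

Lemma integrable_segment f a b : continuous f -> leb.-integrable `[a, b] (EFin \o f).
Proof.
move=> cf; apply: continuous_compact_integrable; first exact: segment_compact.
exact: continuous_subspaceT.
Qed.

Lemma Rintegral_segment F f T : (forall t, is_derive t (1 : R) F (f t)) -> continuous f -> 0 <= T ->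
  Rintegral leb `[0, T] f = F T - F 0.
Proof.
move=> dF cf; rewrite le_eqVlt => /predU1P[<-|T0].
  by rewrite set_itv1 Rintegral_set1 subrr.
have cF := derive_continuous dF.
rewrite /Rintegral (@continuous_FTC2 _ f F 0 T) //.
- exact: continuous_subspaceT.
- split; first by move=> t _; case: (dF t).
    by apply: cvg_at_right_filter; exact: cF.
  by apply: cvg_at_left_filter; exact: cF.
- by move=> t _; rewrite derive1E; case: (dF t).
Qed.

Lemma is_derive_expN d t : is_derive t (1 : R) (fun u => expR (- d * u)) (- d * expR (- d * t)).
Proof.
apply: (is_derive_eq (is_derive1_comp (is_derive_expR (- d * t)) (is_derive_linear (- d) t))).
by rewrite mulrC.
Qed.

Lemma cvg_expN d : 0 < d -> expR (- d * t) @[t --> +oo] --> (0 : R).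
Proof.
move=> d0; have h : (fun t => d * t) t @[t --> +oo] --> +oo.
  apply/cvgryPge => A; near=> t; rewrite mulrC -ler_pdivrMr //.
have := cvg_comp _ _ h (@cvgr_expR R).
by apply: cvg_trans; apply: near_eq_cvg; near=> t; rewrite /= mulNr.
Unshelve. all: by end_near. Qed.

Lemma cvg_decay F d M : 0 < d -> (forall t, 0 <= t -> `|F t| <= M * expR (- d * t)) ->
  F t @[t --> +oo] --> (0 : R).
Proof.
move=> d0 H.
have hM : (M * expR (- d * t)) @[t --> +oo] --> (0 : R).
  by rewrite -(mulr0 M); apply: cvgM; [exact: cvg_cst|exact: cvg_expN].
apply: (@squeeze_cvgr _ _ _ _ (fun t => - (M * expR (- d * t))) (fun t => M * expR (- d * t))) => //.
- near=> t; rewrite -ler_norml; apply: H; near: t; by apply: nbhs_pinfty_ge; rewrite num_real.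
- by rewrite -oppr0; exact: cvgN.
Unshelve. all: by end_near. Qed.

Lemma ray_ge0 F f a : (forall t, is_derive t (1 : R) F (f t)) -> continuous f ->
  (forall t, a <= t -> 0 <= f t) -> F t @[t --> +oo] --> (0 : R) ->
  (\int[leb]_(x in `[a, +oo[) (f x)%:E)%E = (- F a)%:E /\
  leb.-integrable `[a, +oo[ (EFin \o f).
Proof.
move=> dF cf f0 F0; have cF := derive_continuous dF.
have E : (\int[leb]_(x in `[a, +oo[) (f x)%:E)%E = (- F a)%:E.
  rewrite (@ge0_continuous_FTC2y _ f F a 0) ?sub0e //.
  - exact: continuous_subspaceT.
  - by apply: cvg_at_right_filter; exact: cF.
  - by move=> t _; rewrite derive1E; case: (dF t).
split=> //; apply/integrableP; split.
  by apply/measurable_EFinP; exact: continuous_measurable.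
rewrite (_ : (\int[leb]_(x in _) _)%E = (- F a)%:E) ?ltry // -E.
apply: eq_integral => t; rewrite inE /= in_itv /= andbT => ta.
by rewrite ger0_norm // f0.
Qed.

Lemma exp_ray d a : 0 < d ->
  Rintegral leb `[a, +oo[ (fun t => expR (- d * t)) = expR (- d * a) / d /\
  leb.-integrable `[a, +oo[ (EFin \o (fun t => expR (- d * t))).
Proof.
move=> d0; have dG t : is_derive t (1 : R) (fun u => - (d^-1) * expR (- d * u)) (expR (- d * t)).
  apply: (is_derive_eq (is_deriveZ (- d^-1) (is_derive_expN d t))).
  by rewrite /GRing.scale /= mulrA mulrNN mulVf ?mul1r // gt_eqF.
have hG : (- d^-1 * expR (- d * t)) @[t --> +oo] --> (0 : R).
  apply: (@cvg_decay (fun t => - (d^-1) * expR (- d * t)) d d^-1 d0) => t _.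
  by rewrite normrM normrN !ger0_norm ?expR_ge0 // invr_ge0 ltW.
have [E I] := @ray_ge0 _ _ a dG (derive_continuous (is_derive_expN d)) (fun t _ => expR_ge0 _) hG.
by split=> //; rewrite /Rintegral E /= mulNr opprK mulrC.
Qed.

(** The fundamental theorem on the half line for an integrand of any sign, reduced to the
    nonnegative case by adding [M e^(-dt)]. *)
Lemma ray F f d M : 0 < d -> (forall t, is_derive t (1 : R) F (f t)) -> continuous f ->
  (forall t, 0 <= t -> `|f t| <= M * expR (- d * t)) ->
  (forall t, 0 <= t -> `|F t| <= M * expR (- d * t)) ->
  leb.-integrable half (EFin \o f) /\ Rintegral leb half f = - F 0.
Proof.
move=> d0 dF cf fM FM.
have [Ee Ie] := exp_ray 0 d0.
have IM : leb.-integrable half (EFin \o (fun t => M * expR (- d * t))).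
  exact: integrable_scale.
have If : leb.-integrable half (EFin \o f).
  apply: le_integrable IM => //; first by apply/measurable_EFinP; exact: continuous_measurable.
  move=> t; rewrite /= in_itv /= andbT => t0; rewrite lee_fin (le_trans (fM t t0)) // ler_norm.
  by [].
split=> //.
pose g t := f t + M * expR (- d * t); pose G t := F t - M / d * expR (- d * t).
have dG t : is_derive t (1 : R) G (g t).
  apply: (is_derive_eq (is_deriveB (dF t) (is_deriveZ (M / d) (is_derive_expN d t)))).
  rewrite /GRing.scale /= /g; congr (_ + _).
  by rewrite (mulNr d) mulrN opprK mulrA divfK // gt_eqF.
have cg : continuous g.
  move=> t; apply: cvgD; first exact: cf.
  by apply: cvgM; [exact: cvg_cst|exact: (derive_continuous (is_derive_expN d))].
have g0 t : 0 <= t -> 0 <= g t.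
  by move=> t0; have := fM t t0; rewrite ler_norml => /andP[h _]; rewrite /g -lerBlDr sub0r.
have G0 : G t @[t --> +oo] --> (0 : R).
  rewrite -(subrr 0); apply: cvgB; first exact: (cvg_decay d0 FM).
  by rewrite -(mulr0 (M / d)); apply: cvgM; [exact: cvg_cst|exact: cvg_expN].
have [Eg _] := ray_ge0 (a := 0) dG cg g0 G0.
have : Rintegral leb half g = - G 0 by rewrite /Rintegral Eg.
rewrite /g RintegralD // RintegralZl // Ee /G mulr0 expR0 mulr1 div1r => E.
by apply: (addIr (M * d^-1)); rewrite E opprB addrC.
Qed.

Lemma negative_ray_exp d M : 0 < d -> 0 <= M ->
  leb.-integrable nhalf (EFin \o (fun t => M * expR (d * t))) /\
  Rintegral leb nhalf (fun t => M * expR (d * t)) =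
  Rintegral leb half (fun t => M * expR (- d * t)).
Proof.
move=> d0 M0.
have cg : continuous (fun t => M * expR (d * t)).
  have := derive_continuous (is_derive_expN (- d)); rewrite opprK => h t.
  by apply: cvgM; [exact: cvg_cst|exact: h].
have g0 t : 0 <= M * expR (d * t) by rewrite mulr_ge0 ?expR_ge0.
have E : (\int[leb]_(t in nhalf) (M * expR (d * t))%:E =
    \int[leb]_(t in half) (M * expR (- d * t))%:E)%E.
  have := @ge0_integration_by_substitutionNy R (fun t => M * expR (d * t)) 0.
  rewrite oppr0 => /(_ (continuous_subspaceT cg)) H; rewrite H.
    by apply: eq_integral => t _; rewrite /= mulrN mulNr.
  by move=> t _; exact: g0.
have [_ Ie] := exp_ray 0 d0.
have IM := @integrable_scale half _ M (measurable_itv _) Ie.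
split; last by rewrite /Rintegral E.
apply/integrableP; split; first by apply/measurable_EFinP; exact: continuous_measurable.
under eq_integral do rewrite gee0_abs ?lee_fin //.
rewrite E; case/integrableP: IM => _; congr (_ < _)%E.
by apply: eq_integral => t _; rewrite gee0_abs // lee_fin mulr_ge0 // expR_ge0.
Qed.

(** The substitution [t -> -t], again made nonnegative by adding the dominating exponential, whose
    own integral is then subtracted. *)
Lemma negative_ray f d M : 0 < d -> continuous f ->
  (forall t, 0 <= t -> `|f (- t)| <= M * expR (- d * t)) ->
  leb.-integrable nhalf (EFin \o f) /\
  Rintegral leb nhalf f = Rintegral leb half (fun t => f (- t)).
Proof.
move=> d0 cf fM.
have M0 : 0 <= M.
  by have := fM 0 (lexx _); rewrite mulr0 expR0 mulr1; apply: le_trans.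
have fM' t : t <= 0 -> `|f t| <= M * expR (d * t).
  by move=> t0; have := fM (- t); rewrite opprK mulrNN oppr_ge0; apply.
have [Ie Ee] := negative_ray_exp d0 M0.
have If : leb.-integrable nhalf (EFin \o f).
  apply: le_integrable Ie => //; first by apply/measurable_EFinP; exact: continuous_measurable.
  move=> t; rewrite /= in_itv /= => t0; rewrite lee_fin (le_trans (fM' t t0)) // ler_norm.
  by [].
split=> //.
have cN : continuous (fun t => f (- t)) by move=> t; apply: continuous_comp; [exact: oppr_continuous|exact: cf].
have [_ Ie0] := exp_ray 0 d0.
have IM := @integrable_scale half _ M (measurable_itv _) Ie0.
have IN : leb.-integrable half (EFin \o (fun t => f (- t))).
  apply: le_integrable IM => //; first by apply/measurable_EFinP; exact: continuous_measurable.
  move=> t; rewrite /= in_itv /= andbT => t0.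
  by rewrite lee_fin (le_trans (fM t t0)) // ler_norm.
pose g t := f t + M * expR (d * t).
have cg : continuous g.
  have := derive_continuous (is_derive_expN (- d)); rewrite opprK => h t.
  by apply: cvgD; [exact: cf|apply: cvgM; [exact: cvg_cst|exact: h]].
have E : Rintegral leb nhalf g = Rintegral leb half (fun t => f (- t) + M * expR (- d * t)).
  rewrite /Rintegral; congr fine.
  have := @ge0_integration_by_substitutionNy R g 0.
  rewrite oppr0 => /(_ (continuous_subspaceT cg)) H; rewrite H.
  - by apply: eq_integral => t _; rewrite /g /= mulrN mulNr.
  - move=> t; rewrite in_itv /= => /ltW t0; rewrite /g.
    by have := fM' t t0; rewrite ler_norml => /andP[+ _]; rewrite lerNl -subr_ge0 opprK addrC.
by move: E; rewrite !RintegralD // Ee => /addIr.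
Qed.

Lemma integrable_setU (A B : set R) f : measurable A -> measurable B -> [disjoint A & B] ->
  leb.-integrable A (EFin \o f) -> leb.-integrable B (EFin \o f) ->
  leb.-integrable (A `|` B) (EFin \o f).
Proof.
move=> mA mB AB /integrableP[mfA iA] /integrableP[mfB iB].
have mf : measurable_fun (A `|` B) (EFin \o f) by apply/measurable_funU.
apply/integrableP; split=> //; rewrite ge0_integral_setU //; last exact: measurableT_comp.
exact: lte_add_pinfty.
Qed.

End RealIntegrals.

(** * Integrals of complex functions and square integrability *)

Section ComplexIntegrals.
Variable R : realType.
Local Notation C := R[i].
Local Notation Re := complex.Re.
Local Notation Im := complex.Im.
Local Notation leb := (@lebesgue_measure R).
Local Notation half := (`[0%R, +oo[%classic : set R).
Local Notation nhalf := (`]-oo, 0%R]%classic : set R).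
Local Notation seg b := (`[0%R, b]%classic : set R).
Implicit Types (D A B : set R) (f g : R -> C) (z : C).

Lemma Cintegrable_eq D f g : measurable D -> (forall t, D t -> f t = g t) -> Cintegrable D f -> Cintegrable D g.
Proof.
by move=> mD fg [h1 h2]; split; [move: h1|move: h2]; apply: eq_integrable => // t /set_mem Dt; rewrite fg.
Qed.

Lemma Cintegral_eq D f g : (forall t, D t -> f t = g t) -> Cintegral D f = Cintegral D g.
Proof.
by move=> fg; congr Complex; apply: eq_Rintegral => t /set_mem Dt; rewrite fg.
Qed.

Lemma CintegrableD D f g : measurable D -> Cintegrable D f -> Cintegrable D g ->
  Cintegrable D (fun t => f t + g t).
Proof.
move=> mD [f1 f2] [g1 g2]; split.
  by have := integrable_add mD f1 g1; apply: eq_integrable => // t _; rewrite /= CRe_D.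
by have := integrable_add mD f2 g2; apply: eq_integrable => // t _; rewrite /= CIm_D.
Qed.

Lemma CintegralD D f g : measurable D -> Cintegrable D f -> Cintegrable D g ->
  Cintegral D (fun t => f t + g t) = Cintegral D f + Cintegral D g.
Proof.
move=> mD [f1 f2] [g1 g2]; apply: C_eqP; rewrite ?CRe_D ?CIm_D /=.
  by rewrite -RintegralD //; apply: eq_Rintegral => t _; rewrite CRe_D.
by rewrite -RintegralD //; apply: eq_Rintegral => t _; rewrite CIm_D.
Qed.

Lemma CintegrableZ D f z : measurable D -> Cintegrable D f -> Cintegrable D (fun t => z * f t).
Proof.
move=> mD [f1 f2]; split.
  have := integrable_add mD (integrable_scale (Re z) mD f1) (integrable_scale (- Im z) mD f2).
  by apply: eq_integrable => // t _; rewrite /= CRe_M mulNr.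
have := integrable_add mD (integrable_scale (Re z) mD f2) (integrable_scale (Im z) mD f1).
by apply: eq_integrable => // t _; rewrite /= CIm_M.
Qed.

Lemma CintegralZ D f z : measurable D -> Cintegrable D f ->
  Cintegral D (fun t => z * f t) = z * Cintegral D f.
Proof.
move=> mD [f1 f2]; apply: C_eqP; rewrite ?CRe_M ?CIm_M /=.
  rewrite -!RintegralZl // -RintegralB //; [|exact: integrable_scale|exact: integrable_scale].
  by apply: eq_Rintegral => t _; rewrite CRe_M.
rewrite -!RintegralZl // -RintegralD //; [|exact: integrable_scale|exact: integrable_scale].
by apply: eq_Rintegral => t _; rewrite CIm_M.
Qed.

Lemma Cintegrable0 D : Cintegrable D (fun=> 0).
Proof. by split; exact: integrable0. Qed.

Lemma Cintegral0 D : Cintegral D (fun=> 0) = 0.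
Proof. by apply: C_eqP; rewrite /= /Rintegral integral0. Qed.

Lemma Cintegrable_sum D (I : Type) (r : seq I) (F : I -> R -> C) : measurable D ->
  (forall i, Cintegrable D (F i)) -> Cintegrable D (fun t => \sum_(i <- r) F i t).
Proof.
move=> mD iF; elim: r => [|i r IH].
  by apply: (Cintegrable_eq mD _ (Cintegrable0 D)) => t _; rewrite big_nil.
by apply: (Cintegrable_eq mD _ (CintegrableD mD (iF i) IH)) => t _; rewrite big_cons.
Qed.

Lemma Cintegral_sum D (I : Type) (r : seq I) (F : I -> R -> C) : measurable D ->
  (forall i, Cintegrable D (F i)) ->
  Cintegral D (fun t => \sum_(i <- r) F i t) = \sum_(i <- r) Cintegral D (F i).
Proof.
move=> mD iF; elim: r => [|i r IH].
  by rewrite big_nil -[RHS](Cintegral0 D); apply: Cintegral_eq => t _; rewrite big_nil.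
rewrite big_cons -IH -CintegralD //; last exact: Cintegrable_sum.
by apply: Cintegral_eq => t _; rewrite big_cons.
Qed.

Lemma CintegrableS A B f : measurable A -> measurable B -> A `<=` B -> Cintegrable B f -> Cintegrable A f.
Proof. by move=> mA mB AB [h1 h2]; split; [move: h1|move: h2]; exact: integrableS. Qed.

Lemma Cintegral_setU A B f : measurable A -> measurable B -> [disjoint A & B] ->
  Cintegrable (A `|` B) f -> Cintegral (A `|` B) f = Cintegral A f + Cintegral B f.
Proof.
move=> mA mB AB [h1 h2]; apply: C_eqP; rewrite ?CRe_D ?CIm_D /=; exact: Rintegral_setU.
Qed.

Lemma Cintegrable_setU A B f : measurable A -> measurable B -> [disjoint A & B] ->
  Cintegrable A f -> Cintegrable B f -> Cintegrable (A `|` B) f.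
Proof. by move=> mA mB AB [a1 a2] [b1 b2]; split; exact: integrable_setU. Qed.

Lemma cn_Cintegral D f (b : R -> R) : measurable D -> Cintegrable D f ->
  leb.-integrable D (EFin \o b) -> (forall t, D t -> cn (f t) <= b t) ->
  cn (Cintegral D f) <= Rintegral leb D b.
Proof.
move=> mD [f1 f2] ib fb; rewrite /cn /=.
have l1 := @le_normr_Rintegral _ _ R leb D _ mD f1; have l2 := @le_normr_Rintegral _ _ R leb D _ mD f2.
apply: (le_trans (lerD l1 l2)).
rewrite -RintegralD //; [|exact: integrable_norm|exact: integrable_norm].
apply: le_Rintegral => //.
by apply: integrable_add => //; exact: integrable_norm.
Qed.

Lemma ae_imply (P S : R -> Prop) : (forall t, P t -> S t) ->
  {ae leb, forall t, P t} -> {ae leb, forall t, S t}.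
Proof. by move=> PS; apply: (@filterS _ _ (ae_filter_ringOfSetsType leb)). Qed.

Lemma ae_and (P S : R -> Prop) : {ae leb, forall t, P t} -> {ae leb, forall t, S t} ->
  {ae leb, forall t, P t /\ S t}.
Proof. by move=> hP hS; exact: (@filterI _ _ (ae_filter_ringOfSetsType leb)). Qed.

Lemma Cintegral_ae D f g : measurable D -> Cintegrable D f ->
  measurable_fun D (fun t => Re (g t)) -> measurable_fun D (fun t => Im (g t)) ->
  {ae leb, forall t, D t -> f t = g t} ->
  Cintegrable D g /\ Cintegral D g = Cintegral D f.
Proof.
move=> mD [f1 f2] m1 m2 fg.
have e1 : ae_eq leb D (fun t => (Re (f t))%:E) (fun t => (Re (g t))%:E).
  by move: fg; apply: ae_imply => t h Dt; rewrite h.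
have e2 : ae_eq leb D (fun t => (Im (f t))%:E) (fun t => (Im (g t))%:E).
  by move: fg; apply: ae_imply => t h Dt; rewrite h.
have aux (h k : R -> R) : leb.-integrable D (EFin \o h) -> measurable_fun D k ->
    ae_eq leb D (EFin \o h) (EFin \o k) ->
    leb.-integrable D (EFin \o k) /\ Rintegral leb D k = Rintegral leb D h.
  move=> ih mk hk; have mk' : measurable_fun D (EFin \o k) by apply/measurable_EFinP.
  have mh : measurable_fun D (EFin \o h) by case/integrableP: ih.
  split; last by congr fine; apply/esym/ae_eq_integral.
  apply/integrableP; split=> //.
  case/integrableP: ih => _; congr (_ < _)%E; apply: ae_eq_integral => //.
  - exact: measurableT_comp.
  - exact: measurableT_comp.
  - by move: hk; apply: ae_imply => t E Dt; have /= [->] := E Dt.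
have [i1 E1] := aux _ _ f1 m1 e1; have [i2 E2] := aux _ _ f2 m2 e2.
by split=> //; congr Complex.
Qed.


Lemma Cintegrable_bound D f (b : R -> R) : measurable D ->
  measurable_fun D (fun t => Re (f t)) -> measurable_fun D (fun t => Im (f t)) ->
  leb.-integrable D (EFin \o b) -> (forall t, D t -> cn (f t) <= b t) -> Cintegrable D f.
Proof.
move=> mD m1 m2 ib fb; split; apply: le_integrable ib => //.
- exact/measurable_EFinP.
- by move=> t Dt; rewrite lee_fin (le_trans (cn_Re _)) // (le_trans (fb t Dt)) // ler_norm.
- exact/measurable_EFinP.
- by move=> t Dt; rewrite lee_fin (le_trans (cn_Im _)) // (le_trans (fb t Dt)) // ler_norm.
Qed.

Definition abs2 z : R := Re z ^+ 2 + Im z ^+ 2.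

Lemma abs2_ge0 z : 0 <= abs2 z. Proof. by rewrite addr_ge0 ?sqr_ge0. Qed.

Lemma abs2_le_cn z : abs2 z <= cn z ^+ 2.
Proof.
rewrite /abs2 /cn sqrrD !real_normK ?num_real // lerD2r lerDl mulrn_wge0 // mulr_ge0.
Qed.

(** The pointwise form of the Cauchy-Schwarz estimate used for L^2 functions: a product is dominated
    by a sum of squares, hence integrable. *)
Lemma cnM_le z z' : cn (z * z') <= cn z ^+ 2 + abs2 z'.
Proof.
apply: (le_trans (cnM _ _)).
have : cn z' ^+ 2 <= 2 * abs2 z'.
  rewrite /abs2 /cn sqrrD !real_normK ?num_real //.
  have := sqr_ge0 (`|Re z'| - `|Im z'|); rewrite sqrrB !real_normK ?num_real //; lra.
have := abs2_ge0 z'; have := sqr_ge0 (cn z - cn z'); rewrite sqrrB; nra.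
Qed.

Definition Cmeas D f := measurable_fun D (fun t => Re (f t)) /\ measurable_fun D (fun t => Im (f t)).

Lemma CmeasM D f g : Cmeas D f -> Cmeas D g -> Cmeas D (fun t => f t * g t).
Proof.
move=> [f1 f2] [g1 g2]; split.
  by under eq_fun do rewrite CRe_M; apply: measurable_funB; apply: measurable_funM.
by under eq_fun do rewrite CIm_M; apply: measurable_funD; apply: measurable_funM.
Qed.

Lemma Cintegrable_L2 D f g : measurable D -> Cmeas D f -> Cmeas D g ->
  leb.-integrable D (EFin \o (fun t => cn (f t) ^+ 2)) ->
  leb.-integrable D (EFin \o (fun t => abs2 (g t))) -> Cintegrable D (fun t => f t * g t).
Proof.
move=> mD mf mg f2 g2; have [m1 m2] := CmeasM mf mg.
apply: (@Cintegrable_bound _ _ (fun t => cn (f t) ^+ 2 + abs2 (g t))) => //.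
  exact: integrable_add.
by move=> t _; exact: cnM_le.
Qed.

Definition Ccont f (t : R) :=
  continuous_at t (fun u => Re (f u)) /\ continuous_at t (fun u => Im (f u)).

Lemma Ccont_cst z t : Ccont (fun=> z) t.
Proof. by split; exact: cvg_cst. Qed.

Lemma CcontD f g t : Ccont f t -> Ccont g t -> Ccont (fun u => f u + g u) t.
Proof.
move=> [f1 f2] [g1 g2]; split.
  by under eq_fun do rewrite CRe_D; exact: continuousD.
by under eq_fun do rewrite CIm_D; exact: continuousD.
Qed.

Lemma CcontM f g t : Ccont f t -> Ccont g t -> Ccont (fun u => f u * g u) t.
Proof.
move=> [f1 f2] [g1 g2]; split.
  by under eq_fun do rewrite CRe_M; apply: cvgB; exact: cvgM.
by under eq_fun do rewrite CIm_M; apply: cvgD; exact: cvgM.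
Qed.

Lemma Ccont_sum (I : Type) (r : seq I) (F : I -> R -> C) t :
  (forall i, Ccont (F i) t) -> Ccont (fun u => \sum_(i <- r) F i u) t.
Proof.
move=> H; elim: r => [|i r IH].
  by under eq_fun do rewrite big_nil; exact: Ccont_cst.
by under eq_fun do rewrite big_cons; exact: CcontD.
Qed.

Lemma Cder_cont f t z : Cder f t z -> Ccont f t.
Proof.
move=> [h1 h2]; split; apply: differentiable_continuous; apply/derivable1_diffP.
  by case: h1.
by case: h2.
Qed.

Lemma Ccont_meas D f : measurable D -> (forall t, Ccont f t) -> Cmeas D f.
Proof.
by move=> mD cf; split; apply: continuous_measurable => // t; have [] := cf t.
Qed.

Lemma Ccont_cn f : (forall t, Ccont f t) -> continuous (fun t => cn (f t) ^+ 2).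
Proof.
move=> cf t; have [h1 h2] := cf t.
have h : {for t, continuous (fun u => cn (f u))}.
  by apply: continuousD; apply: (continuous_comp _ (@norm_continuous _ _ _)).
exact: (continuousM h h).
Qed.

Section RealPrimitive.
Variable h : R -> R.
Hypothesis ih : forall b, leb.-integrable (seg b) (EFin \o h).

Lemma primitive_continuous (t : R) : 0 < t -> continuous_at t (fun x : R => Rintegral leb (seg x) h).
Proof.
move=> t0; have b0 : 0 < t + 1 by rewrite addr_gt0.
have := parameterized_integral_continuous (ltW b0) (ih (t + 1)).
move/(continuous_within_itvP _ b0) => [H _ _]; apply: H.
by rewrite in_itv /= t0 ltrDl ltr01.
Qed.

Lemma primitive_derive (t : R) : 0 < t -> continuous_at t h ->
  is_derive t (1 : R) (fun x : R => Rintegral leb (seg x) h) (h t).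
Proof.
move=> t0 ch; have tt : t < t + 1 by rewrite ltrDl.
have [D1 D2] := continuous_FTC1_closed tt (ih (t + 1)) t0 ch.
by split; [exact: D1|rewrite -derive1E].
Qed.

End RealPrimitive.

(** The substitution [t = e^u] turns the open half line into the whole line. *)
Lemma positive_constant (F : R -> R) : (forall t : R, 0 < t -> is_derive t (1 : R) F 0) ->
  forall s t : R, 0 < s -> 0 < t -> F s = F t.
Proof.
move=> dF s t s0 t0; rewrite -(lnK s0) -(lnK t0).
apply: (@is_derive_0_is_cst _ (fun u => F (expR u))) => u.
by apply: (is_derive_eq (is_derive1_comp (dF _ (expR_gt0 u)) (is_derive_expR u))); rewrite mul0r.
Qed.

End ComplexIntegrals.

(** * Entrywise integrals, continuity and decay of matrix functions *)

Section MatrixIntegrals.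
Variable R : realType.
Local Notation C := R[i].
Local Notation Re := complex.Re.
Local Notation Im := complex.Im.
Local Notation leb := (@lebesgue_measure R).
Local Notation half := (`[0%R, +oo[%classic : set R).
Local Notation nhalf := (`]-oo, 0%R]%classic : set R).
Local Notation seg b := (`[0%R, b]%classic : set R).
Local Notation tail b := (`]b, +oo[%classic : set R).

Definition Mintegrable m n (D : set R) (F : R -> 'M[C]_(m, n)) :=
  forall i j, Cintegrable D (fun t => F t i j).
Definition Mint m n (D : set R) (F : R -> 'M[C]_(m, n)) : 'M[C]_(m, n) :=
  \matrix_(i, j) Cintegral D (fun t => F t i j).
Definition Mcont m n (F : R -> 'M[C]_(m, n)) t := forall i j, Ccont (fun u => F u i j) t.
Definition Mmeas m n (D : set R) (F : R -> 'M[C]_(m, n)) := forall i j, Cmeas D (fun u => F u i j).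

Section Linear.
Variables (D : set R) (mD : measurable D).

Lemma Mintegrable_eq m n (F G : R -> 'M[C]_(m, n)) : (forall t, D t -> F t = G t) ->
  Mintegrable D F -> Mintegrable D G.
Proof. by move=> FG h i j; apply: (Cintegrable_eq mD _ (h i j)) => t Dt; rewrite FG. Qed.

Lemma Mint_eq m n (F G : R -> 'M[C]_(m, n)) : (forall t, D t -> F t = G t) ->
  Mint D F = Mint D G.
Proof. by move=> FG; apply/matrixP => i j; rewrite !mxE; apply: Cintegral_eq => t Dt; rewrite FG. Qed.

Lemma MintegrableMl m n p (A : 'M[C]_(m, n)) (F : R -> 'M[C]_(n, p)) :
  Mintegrable D F -> Mintegrable D (fun t => A *m F t).
Proof.
move=> h i j; apply: (Cintegrable_eq mD (f := fun t => \sum_k A i k * F t k j)).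
  by move=> t _; rewrite mxE.
by apply: Cintegrable_sum => // k; exact: CintegrableZ.
Qed.

Lemma MintMl m n p (A : 'M[C]_(m, n)) (F : R -> 'M[C]_(n, p)) :
  Mintegrable D F -> Mint D (fun t => A *m F t) = A *m Mint D F.
Proof.
move=> h; apply/matrixP => i j; rewrite !mxE.
rewrite (@Cintegral_eq _ _ _ (fun t => \sum_k A i k * F t k j)); last by move=> t _; rewrite mxE.
rewrite Cintegral_sum //; last by move=> k; exact: CintegrableZ.
by apply: eq_bigr => k _; rewrite mxE CintegralZ.
Qed.

Lemma MintegrableMr m n p (F : R -> 'M[C]_(m, n)) (A : 'M[C]_(n, p)) :
  Mintegrable D F -> Mintegrable D (fun t => F t *m A).
Proof.
move=> h i j; apply: (Cintegrable_eq mD (f := fun t => \sum_k A k j * F t i k)).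
  by move=> t _; rewrite mxE; apply: eq_bigr => k _; rewrite mulrC.
by apply: Cintegrable_sum => // k; exact: CintegrableZ.
Qed.

Lemma MintMr m n p (F : R -> 'M[C]_(m, n)) (A : 'M[C]_(n, p)) :
  Mintegrable D F -> Mint D (fun t => F t *m A) = Mint D F *m A.
Proof.
move=> h; apply/matrixP => i j; rewrite !mxE.
rewrite (@Cintegral_eq _ _ _ (fun t => \sum_k A k j * F t i k)); last first.
  by move=> t _; rewrite mxE; apply: eq_bigr => k _; rewrite mulrC.
rewrite Cintegral_sum //; last by move=> k; exact: CintegrableZ.
by apply: eq_bigr => k _; rewrite mxE CintegralZ // mulrC.
Qed.

Lemma MintegrableS m n (A : set R) (F : R -> 'M[C]_(m, n)) : measurable A -> A `<=` D ->
  Mintegrable D F -> Mintegrable A F.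
Proof. by move=> mA AD h i j; exact: CintegrableS (h i j). Qed.

Lemma Mint_ae m n (F G : R -> 'M[C]_(m, n)) : Mintegrable D F -> Mmeas D G ->
  {ae leb, forall t, D t -> F t = G t} -> Mintegrable D G /\ Mint D G = Mint D F.
Proof.
move=> iF mG FG.
have H i j : Cintegrable D (fun t => G t i j) /\
    Cintegral D (fun t => G t i j) = Cintegral D (fun t => F t i j).
  have [m1 m2] := mG i j; apply: (Cintegral_ae mD (iF i j) m1 m2).
  by move: FG; apply: ae_imply => t h Dt; rewrite h.
split; first by move=> i j; have [] := H i j.
by apply/matrixP => i j; rewrite !mxE; have [] := H i j.
Qed.

End Linear.

Lemma half_split (t : R) : 0 <= t -> half = seg t `|` tail t /\ [disjoint seg t & tail t].
Proof.
move=> t0; split.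
  by rewrite -(@itv_bndbnd_setU _ _ _ (BRight t)).
apply/disj_setPS => u [/=]; rewrite !in_itv /= andbT => /andP[_ h1] h2.
by move: (le_lt_trans h1 h2); rewrite ltxx.
Qed.

Lemma Mint_half m n (F : R -> 'M[C]_(m, n)) t : 0 <= t -> Mintegrable half F ->
  Mint half F = Mint (seg t) F + Mint (tail t) F.
Proof.
move=> t0; have [-> d] := half_split t0 => h; apply/matrixP => i j.
by rewrite !mxE Cintegral_setU.
Qed.

Lemma Mintegrable_half m n (F : R -> 'M[C]_(m, n)) t : 0 <= t -> Mintegrable (seg t) F ->
  Mintegrable (tail t) F -> Mintegrable half F.
Proof.
move=> t0; have [-> d] := half_split t0 => h h' i j.
exact: Cintegrable_setU.
Qed.

Lemma McontD m n (F G : R -> 'M[C]_(m, n)) t : Mcont F t -> Mcont G t ->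
  Mcont (fun u => F u + G u) t.
Proof. by move=> h h' i j; under eq_fun do rewrite mxE; exact: CcontD. Qed.

Lemma McontM m n p (F : R -> 'M[C]_(m, n)) (G : R -> 'M[C]_(n, p)) t : Mcont F t -> Mcont G t ->
  Mcont (fun u => F u *m G u) t.
Proof.
move=> h h' i j; under eq_fun do rewrite mxE.
by apply: Ccont_sum => k; exact: CcontM.
Qed.

Lemma Mcont_cst m n (A : 'M[C]_(m, n)) t : Mcont (fun=> A) t.
Proof. by move=> i j; exact: Ccont_cst. Qed.

Lemma Mder_cont m n (F : R -> 'M[C]_(m, n)) t D : Mder F t D -> Mcont F t.
Proof. by move=> h i j; exact: Cder_cont (h i j). Qed.

Lemma Mcont_meas m n (F : R -> 'M[C]_(m, n)) : (forall t, 0 < t -> Mcont F t) -> Mmeas half F.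
Proof.
have aux (h : R -> R) : (forall t : R, 0 < t -> continuous_at t h) -> measurable_fun half h.
  move=> ch; apply/measurable_fun_itv_obnd_cbndP; apply: open_continuous_measurable_fun.
    exact: interval_open.
  by move=> t; rewrite inE /= in_itv /= andbT; exact: ch.
by move=> cF i j; split; apply: aux => t t0; have [] := cF t t0 i j.
Qed.

Lemma Mmeas_sub m n A B (F : R -> 'M[C]_(m, n)) : measurable B -> A `<=` B -> Mmeas B F -> Mmeas A F.
Proof. by move=> mB AB h i j; have [h1 h2] := h i j; split; exact: measurable_funS AB _. Qed.

Lemma Mint_primitive_cont m n (F : R -> 'M[C]_(m, n)) (t : R) :
  (forall b, Mintegrable (seg b) F) -> 0 < t -> Mcont (fun x => Mint (seg x) F) t.
Proof.
move=> iF t0 i j; split.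
  have := @primitive_continuous _ (fun t => Re (F t i j)) (fun b => (iF b i j).1) t t0.
  by under [X in _ -> continuous_at _ X]eq_fun do rewrite mxE.
have := @primitive_continuous _ (fun t => Im (F t i j)) (fun b => (iF b i j).2) t t0.
by under [X in _ -> continuous_at _ X]eq_fun do rewrite mxE.
Qed.

Lemma Mint_primitive_der m n (F : R -> 'M[C]_(m, n)) (t : R) :
  (forall b, Mintegrable (seg b) F) -> 0 < t -> Mcont F t ->
  Mder (fun x => Mint (seg x) F) t (F t).
Proof.
move=> iF t0 cF i j; split.
  have := @primitive_derive _ (fun t => Re (F t i j)) (fun b => (iF b i j).1) t t0 (cF i j).1.
  by under [X in _ -> is_derive _ _ X _]eq_fun do rewrite mxE.
have := @primitive_derive _ (fun t => Im (F t i j)) (fun b => (iF b i j).2) t t0 (cF i j).2.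
by under [X in _ -> is_derive _ _ X _]eq_fun do rewrite mxE.
Qed.

Lemma Mder_positive_cst m n (F : R -> 'M[C]_(m, n)) : (forall t, 0 < t -> Mder F t 0) ->
  forall s t, 0 < s -> 0 < t -> F s = F t.
Proof.
move=> dF s t s0 t0; apply/matrixP => i j; apply: C_eqP.
  apply: (@positive_constant _ (fun u => Re (F u i j))) => // u u0.
  by have := (dF u u0 i j).1; rewrite mxE.
apply: (@positive_constant _ (fun u => Im (F u i j))) => // u u0.
by have := (dF u u0 i j).2; rewrite mxE.
Qed.

Lemma Mder_adj m n (F : R -> 'M[C]_(m, n)) t D : Mder F t D -> Mder (fun u => (F u)^t*) t (D^t*).
Proof.
move=> h i j; rewrite !mxE; under eq_fun do rewrite !mxE.
have [h1 h2] := h j i.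
have e (z : C) : Re (Num.conj z) = Re z /\ Im (Num.conj z) = - Im z by case: z.
split; first by under eq_fun do rewrite (e _).1; rewrite (e _).1.
by under eq_fun do rewrite (e _).2; rewrite (e _).2; exact: is_deriveN.
Qed.

Lemma decays_adj m n (F : R -> 'M[C]_(m, n)) d : decays F d -> decays (fun t => (F t)^t*) d.
Proof.
move=> [M [M0 H]]; exists M; split=> // t i j t0; rewrite !mxE (le_trans _ (H t j i t0)) //.
by case: (F t j i) => a b; rewrite /cn /= normrN.
Qed.

Lemma decaysM m n p (F : R -> 'M[C]_(m, n)) (G : R -> 'M[C]_(n, p)) d e : 0 <= e ->
  decays F d -> decays G e -> decays (fun t => F t *m G t) d.
Proof.
move=> e0 [M [M0 HM]] [N [N0 HN]]; exists (\sum_(k < n) M * N); split.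
  by apply: sumr_ge0 => k _; exact: mulr_ge0.
move=> t i j t0; rewrite mxE (le_trans (cn_sum _ _)) // mulr_suml; apply: ler_sum => k _.
rewrite (le_trans (cnM _ _)) // mulrAC ler_pM ?cn_ge0 ?HM //.
rewrite (le_trans (HN t k j t0)) // ler_piMr // -expR0 ler_expR mulNr oppr_le0.
exact: mulr_ge0.
Qed.

Lemma decays_cst m n (A : 'M[C]_(m, n)) : decays (fun=> A) 0.
Proof.
exists (\sum_i \sum_j cn (A i j)); split.
  by apply: sumr_ge0 => i _; apply: sumr_ge0 => j _; exact: cn_ge0.
move=> t i j t0; rewrite oppr0 mul0r expR0 mulr1 (bigD1 i) //= (bigD1 j) //= -addrA lerDl addr_ge0 //.
  by apply: sumr_ge0 => k _; exact: cn_ge0.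
by apply: sumr_ge0 => k _; apply: sumr_ge0 => l _; exact: cn_ge0.
Qed.

Lemma decaysMl m n p (A : 'M[C]_(m, n)) (F : R -> 'M[C]_(n, p)) d : decays F d ->
  decays (fun t => A *m F t) d.
Proof.
move=> [N [N0 HN]]; have [M [M0 HM]] := decays_cst A; exists (\sum_(k < n) M * N); split.
  by apply: sumr_ge0 => k _; exact: mulr_ge0.
move=> t i j t0; rewrite mxE (le_trans (cn_sum _ _)) // mulr_suml; apply: ler_sum => k _.
rewrite (le_trans (cnM _ _)) // -mulrA ler_pM ?cn_ge0 ?HN //.
by have := HM t i k t0; rewrite oppr0 mul0r expR0 mulr1.
Qed.

Lemma decaysMr m n p (F : R -> 'M[C]_(m, n)) (A : 'M[C]_(n, p)) d : decays F d ->
  decays (fun t => F t *m A) d.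
Proof. by move=> h; exact: decaysM (lexx 0) h (decays_cst A). Qed.

Lemma decays_scaleb m n (f : R -> C) (F : R -> 'M[C]_(m, n)) d (b : R) : 0 <= b ->
  (forall t, cn (f t) <= b) -> decays F d -> decays (fun t => f t *: F t) d.
Proof.
move=> b0 fb [M [M0 HM]]; exists (b * M); split; first exact: mulr_ge0.
move=> t i j t0; rewrite mxE (le_trans (cnM _ _)) // -mulrA ler_pM ?cn_ge0 //; exact: HM.
Qed.

(** The derivative [f'] supplies the continuity of [f]; the sum [M + N] is a common constant for
    both decay bounds. *)
Lemma Mint_ray m n (F f f' : R -> 'M[C]_(m, n)) d : 0 < d ->
  (forall t, Mder F t (f t)) -> (forall t, Mder f t (f' t)) -> decays F d -> decays f d ->
  Mintegrable half f /\ Mint half f = - F 0.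
Proof.
move=> d0 dF df [M [M0 HM]] [N [N0 HN]].
have H i j : Cintegrable half (fun t => f t i j) /\ Cintegral half (fun t => f t i j) = - F 0 i j.
  have cf t := Mder_cont (df t) i j.
  have bM t : 0 <= t -> cn (F t i j) <= (M + N) * expR (- d * t).
    by move=> t0; rewrite (le_trans (HM _ _ _ t0)) // ler_wpM2r ?expR_ge0 // lerDl.
  have bN t : 0 <= t -> cn (f t i j) <= (M + N) * expR (- d * t).
    by move=> t0; rewrite (le_trans (HN _ _ _ t0)) // ler_wpM2r ?expR_ge0 // lerDr.
  have [i1 e1] := ray d0 (fun t => (dF t i j).1) (fun t => (cf t).1)
    (fun t t0 => le_trans (cn_Re _) (bN t t0)) (fun t t0 => le_trans (cn_Re _) (bM t t0)).
  have [i2 e2] := ray d0 (fun t => (dF t i j).2) (fun t => (cf t).2)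
    (fun t t0 => le_trans (cn_Im _) (bN t t0)) (fun t t0 => le_trans (cn_Im _) (bM t t0)).
  by split=> //; apply: C_eqP; rewrite /= ?e1 ?e2 ?CRe_N ?CIm_N.
split; first by move=> i j; have [] := H i j.
by apply/matrixP => i j; rewrite !mxE; have [] := H i j.
Qed.

Lemma Mint_negative_ray m n (f f' : R -> 'M[C]_(m, n)) d : 0 < d ->
  (forall t, Mder f t (f' t)) -> decays (fun t => f (- t)) d ->
  Mintegrable nhalf f /\ Mint nhalf f = Mint half (fun t => f (- t)).
Proof.
move=> d0 df [M [M0 HM]].
have H i j : Cintegrable nhalf (fun t => f t i j) /\
    Cintegral nhalf (fun t => f t i j) = Cintegral half (fun t => f (- t) i j).
  have cf t := Mder_cont (df t) i j.
  have [i1 e1] := negative_ray d0 (fun t => (cf t).1) (fun t t0 => le_trans (cn_Re _) (HM t i j t0)).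
  have [i2 e2] := negative_ray d0 (fun t => (cf t).2) (fun t t0 => le_trans (cn_Im _) (HM t i j t0)).
  by split=> //; apply: C_eqP; rewrite /= ?e1 ?e2.
split; first by move=> i j; have [] := H i j.
by apply/matrixP => i j; rewrite !mxE; have [] := H i j.
Qed.

Lemma Mint_seg m n (F f f' : R -> 'M[C]_(m, n)) T : 0 <= T ->
  (forall t, Mder F t (f t)) -> (forall t, Mder f t (f' t)) ->
  Mint (seg T) f = F T - F 0.
Proof.
move=> T0 dF df; apply/matrixP => i j; rewrite !mxE.
have cf t := Mder_cont (df t) i j.
have e1 := Rintegral_segment (fun t => (dF t i j).1) (fun t => (cf t).1) T0.
have e2 := Rintegral_segment (fun t => (dF t i j).2) (fun t => (cf t).2) T0.
by apply: C_eqP; rewrite /= ?e1 ?e2 ?CRe_D ?CIm_D ?CRe_N ?CIm_N.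
Qed.

End MatrixIntegrals.

(** * Square integrable functions against continuous kernels *)

Section KernelBasics.
Variable R : realType.
Local Notation C := R[i].
Local Notation Re := complex.Re.
Local Notation Im := complex.Im.
Local Notation leb := (@lebesgue_measure R).
Local Notation half := (`[0%R, +oo[%classic : set R).
Local Notation seg b := (`[0%R, b]%classic : set R).
Local Notation tail b := (`]b, +oo[%classic : set R).

Lemma stable_adj n (A : 'M[C]_n) : stable A -> stable (A^t*).
Proof.
move=> sA a; rewrite eigenvalue_unit -adjmx_unit adjmxD adjmxN trmxCK adjmx_scalar => h.
have := sA (Num.conj a); rewrite eigenvalue_unit => /(_ h).
by case: a {h}.
Qed.

Lemma seg_half (b : R) : seg b `<=` half.
Proof. by move=> t /=; rewrite !in_itv /= andbT => /andP[]. Qed.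
Lemma tail_half (b : R) : 0 <= b -> tail b `<=` half.
Proof. by move=> b0 t /=; rewrite !in_itv /= !andbT => /ltW; exact: le_trans. Qed.

Lemma L2_meas m (f : R -> 'cV[C]_m) : L2plus f -> Mmeas half f.
Proof. by move=> h i j; rewrite (ord1 j); have [m1 m2 _] := h i; split. Qed.

Lemma L2_abs2 m (f : R -> 'cV[C]_m) i : L2plus f -> leb.-integrable half (EFin \o (fun t => abs2 (f t i 0))).
Proof. by move=> h; have [_ _] := h i. Qed.

Lemma decays_cn2 m n (F : R -> 'M[C]_(m, n)) d i j : 0 < d -> (forall t, Mcont F t) -> decays F d ->
  leb.-integrable half (EFin \o (fun t => cn (F t i j) ^+ 2)).
Proof.
move=> d0 cF [M [M0 HM]]; have d2 : 0 < 2 * d by rewrite mulr_gt0.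
have [_ ie] := exp_ray 0 d2.
have iM := @integrable_scale _ half _ (M ^+ 2) (measurable_itv _) ie.
apply: le_integrable iM => //.
  apply/measurable_EFinP; apply: continuous_measurable => //; apply: Ccont_cn => t.
  exact: cF.
move=> t; rewrite /= in_itv /= andbT => t0.
rewrite lee_fin !ger0_norm ?mulr_ge0 ?sqr_ge0 ?expR_ge0 ?cn_ge0 //.
apply: (@le_trans _ _ ((M * expR (- d * t)) ^+ 2)).
  by rewrite ler_sqr ?nnegrE ?cn_ge0 ?mulr_ge0 ?expR_ge0 // HM.
by rewrite exprMn -expRM_natl mulrA mulrN mulNr.
Qed.

Lemma segment_cn2 m n (F : R -> 'M[C]_(m, n)) b i j : (forall t, Mcont F t) ->
  leb.-integrable (seg b) (EFin \o (fun t => cn (F t i j) ^+ 2)).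
Proof. by move=> cF; apply: integrable_segment; apply: Ccont_cn => t; exact: cF. Qed.

Lemma L2plus_decays m (F : R -> 'cV[C]_m) d : 0 < d -> (forall t, Mcont F t) -> decays F d -> L2plus F.
Proof.
move=> d0 cF dF i.
have [m1 m2] : Cmeas half (fun t => F t i 0) by apply: Ccont_meas => // t; exact: cF.
split=> //; apply: le_integrable (decays_cn2 i 0 d0 cF dF) => //.
  by apply/measurable_EFinP; apply: measurable_funD; apply: measurable_funX.
move=> t _; rewrite lee_fin !ger0_norm ?sqr_ge0 //; [exact: abs2_le_cn|exact: abs2_ge0].
Qed.

Lemma Mintegrable_L2 p m (D : set R) (G : R -> 'M[C]_(p, m)) (f : R -> 'cV[C]_m) :
  measurable D -> D `<=` half -> (forall t, Mcont G t) ->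
  (forall i j, leb.-integrable D (EFin \o (fun t => cn (G t i j) ^+ 2))) -> L2plus f ->
  Mintegrable D (fun t => G t *m f t).
Proof.
move=> mD Dh cG G2 f2 i j.
apply: (Cintegrable_eq mD (f := fun t => \sum_k G t i k * f t k j)).
  by move=> t _; rewrite mxE.
apply: Cintegrable_sum => // k; apply: Cintegrable_L2 => //.
- by apply: Ccont_meas => // t; exact: cG.
- exact: (Mmeas_sub _ Dh (L2_meas f2)).
- by rewrite (ord1 j); move: (L2_abs2 k f2); exact: integrableS.
Qed.

Lemma WH_opM m (D : 'M[C]_m) (r : R -> 'M[C]_m) f t :
  WH_op D r f t = D *m f t + Mint half (fun tau => r (t - tau) *m f tau).
Proof. by congr (_ + _); apply/matrixP => i j; rewrite !mxE (ord1 j). Qed.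

End KernelBasics.

(** * The kernel of the Wiener-Hopf operator *)

Section Kernel.
Variable R : realType.
Local Notation C := R[i].
Local Notation Re := complex.Re.
Local Notation Im := complex.Im.
Local Notation leb := (@lebesgue_measure R).
Local Notation half := (`[0%R, +oo[%classic : set R).
Local Notation seg b := (`[0%R, b]%classic : set R).
Local Notation tail b := (`]b, +oo[%classic : set R).

Lemma Mcont_expm n (A : 'M[C]_n) t : Mcont (expm A) t.
Proof. exact: Mder_cont (Mder_expm A t). Qed.
Lemma Mcont_expmN n (A : 'M[C]_n) t : Mcont (fun u => expm A (- u)) t.
Proof. exact: Mder_cont (Mder_expmN A t). Qed.

Section Observability.
Variables (m n : nat) (A : 'M[C]_n) (K : 'M[C]_(m, n)).
Hypotheses (sA : stable A) (dKK : A + A^t* + K^t* *m K = 0).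

Lemma output_gram : K^t* *m K = - (A + A^t*).
Proof. by move/eqP: dKK; rewrite addrC addr_eq0 => /eqP. Qed.

Lemma decays_output (y : 'cV[C]_n) : exists2 d, 0 < d & decays (fun t => K *m expm A t *m y) d.
Proof.
have [d d0 dec] := expm_decays sA; exists d => //.
exact: decaysMr (decaysMl K dec).
Qed.

Lemma Mcont_output (y : 'cV[C]_n) t : Mcont (fun t => K *m expm A t *m y) t.
Proof. by apply: McontM (Mcont_cst _ _); apply: McontM (Mcont_cst _ _) (Mcont_expm _ _). Qed.

Lemma output_L2 (y : 'cV[C]_n) : L2plus (fun t => K *m expm A t *m y).
Proof. by have [d d0 dec] := decays_output y; apply: L2plus_decays dec => //; exact: Mcont_output. Qed.

(** The observability Gramian is the identity: by dissipativity [-|e^(tA) y|^2] is a primitive of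
    the output energy. *)
Lemma output_energy (y : 'cV[C]_n) :
  let g t := (K *m expm A t *m y)^t* *m (K *m expm A t *m y) in
  Mintegrable half g /\ Mint half g = y^t* *m y.
Proof.
move=> g; have [d d0 dec] := expm_decays sA.
have dE t : Mder (fun t => expm A t *m y) t (A *m (expm A t *m y)).
  by apply: Mder_eq (MderMr y (Mder_expm A t)) _; rewrite mulmxA.
have dG t : Mder (fun t => - ((expm A t *m y)^t* *m (expm A t *m y))) t (g t).
  have := MderM (Mder_adj (dE t)) (dE t).
  move=> /(MderMl (- 1%:M)); under [X in Mder X _ _ -> _]eq_fun do rewrite mulNmx mul1mx.
  move=> h; apply: Mder_eq h _; rewrite /g -(mulmxA K).
  move: (expm A t *m y) => v.
  rewrite !adjmxM -(mulmxA _ (K^t*)) (mulmxA (K^t*)) output_gram mulNmx mul1mx mulNmx mulmxN; congr (- _).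
  by rewrite mulmxDl mulmxDr !mulmxA addrC.
have dg t : exists g', Mder g t g'.
  have h : Mder (fun t => K *m expm A t *m y) t (K *m (A *m expm A t) *m y).
    exact: MderMr (MderMl _ (Mder_expm A t)).
  by exists ((K *m (A *m expm A t) *m y)^t* *m (K *m expm A t *m y) + (K *m expm A t *m y)^t* *m (K *m (A *m expm A t) *m y));
    exact: MderM (Mder_adj h) h.
have [g' dg'] := choice dg.
have dyE : decays (fun t => expm A t *m y) d by exact: decaysMr.
have dyK : decays (fun t => K *m expm A t *m y) d by apply: decaysMr; exact: decaysMl.
have dG0 : decays (fun t => - ((expm A t *m y)^t* *m (expm A t *m y))) d.
  have := decaysMl (- 1%:M) (decaysM (ltW d0) (decays_adj dyE) dyE).
  by under eq_fun do rewrite mulNmx mul1mx.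
have dg0 : decays g d by exact: decaysM (ltW d0) (decays_adj dyK) dyK.
have [i E] := Mint_ray d0 dG dg' dG0 dg0.
by split=> //; rewrite E opprK expm0 mul1mx.
Qed.

Lemma output_eq0 (y : 'cV[C]_n) : eq_plus (fun t => K *m expm A t *m y) (fun=> 0) -> y = 0.
Proof.
move=> y0; have [i E] := output_energy y; apply: gram_eq0; rewrite -E.
have mD : measurable half by [].
have m0 : Mmeas half (fun=> 0 : 'M[C]_1) by move=> a b; apply: Ccont_meas => // t; exact: Ccont_cst.
have ae0 : {ae leb, forall t : R, half t ->
    (K *m expm A t *m y)^t* *m (K *m expm A t *m y) = (0 : 'M[C]_1)}.
  move: y0; apply: ae_imply => t h; rewrite /= in_itv /= andbT => /h ->.
  by rewrite adjmx0 mul0mx.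
have [_ <-] := Mint_ae mD i m0 ae0.
by apply/matrixP => a b; rewrite !mxE; exact: Cintegral0.
Qed.

End Observability.

Section SymbolKernel.
Variables (m nv nw : nat) (Av : 'M[C]_nv) (Bv : 'M[C]_(nv, m)) (Cv : 'M[C]_(m, nv)) (Dv : 'M[C]_m)
  (Aw : 'M[C]_nw) (Bw : 'M[C]_(nw, m)) (Cw : 'M[C]_(m, nw)) (Dw : 'M[C]_m) (Om : 'M[C]_(nv, nw)).
Hypotheses (sv : stable Av) (sw : stable Aw) (dv : dissipative Av Bv Cv Dv)
  (dw : dissipative Aw Bw Cw Dw) (lyap : Av *m Om + Om *m Aw^t* + Bv *m Bw^t* = 0).
Local Notation Co := (Dv *m Bw^t* + Cv *m Om).
Local Notation D := (Dv *m Dw^t*).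
Local Notation B1 := (Bv *m Dw^t* + Om *m Cw^t*).
Local Notation Ev := (expm Av).
Local Notation Ew := (expm Aw).
Local Notation Ews := (expm (Aw^t*)).

(* The inverse Fourier transform of R - R(oo), as the symbol is
   R(s) = D + Cv (s - Av)^-1 B1 - Co (s + Aw^* )^-1 Cw^*. *)
Definition rker (t : R) : 'M[C]_m :=
  if 0 <= t then Cv *m Ev t *m B1 else Co *m Ews (- t) *m Cw^t*.

Lemma BvBw : Bv *m Bw^t* = - (Av *m Om + Om *m Aw^t*).
Proof. by move/eqP: lyap; rewrite addrC addr_eq0 => /eqP. Qed.

(** On an input [C_w e^(tA_w) y] this makes the integrand of [past] the derivative of
    [-e^(-tA_v) Omega e^(tA_w) y]. *)
Lemma B1Cw : B1 *m Cw = Av *m Om - Om *m Aw.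
Proof.
rewrite mulmxDl -!mulmxA (dissDK dw) (dissKK dw) !mulmxN BvBw opprK mulmxDr opprD addrA.
by rewrite (addrAC _ (Om *m Aw^t*)) addrK.
Qed.

Lemma CvCo : Cv^t* *m Co + Av^t* *m Om = Om *m Aw^t*.
Proof.
rewrite mulmxDr !mulmxA (dissKD dv) (dissKK dv) mulNmx BvBw opprK mulNmx mulmxDl opprD.
by rewrite -addrA subrK addrAC subrr add0r.
Qed.

Lemma DCw : D *m Cw + Co = Cv *m Om.
Proof. by rewrite -mulmxA (dissDK dw) mulmxN addKr. Qed.

Lemma future_derivative n (E As A : 'M[C]_n) (v : 'cV[C]_n) :
  - 1%:M *m (E *m (As *m v) + E *m (A *m v)) = E *m (- (A + As) *m v).
Proof. by rewrite -mulmxDr -mulmxDl mulNmx mul1mx mulNmx mulmxN (addrC A). Qed.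

Lemma past_derivative n p (E A : 'M[C]_n) (O : 'M[C]_(n, p)) (A' : 'M[C]_p) (v : 'cV[C]_p) :
  - 1%:M *m (- (E *m A) *m (O *m v) + E *m (O *m (A' *m v))) = E *m ((A *m O - O *m A') *m v).
Proof. by rewrite mulNmx mul1mx mulNmx opprD opprK mulmxBl mulmxBr -!mulmxA. Qed.

Lemma output_response (E En : 'M[C]_nv) (F Fn W : 'M[C]_nw) (y : 'cV[C]_nw) : E *m En = 1%:M -> Fn *m F = 1%:M ->
  D *m (Cw *m W *m y) + Cv *m (E *m (Om *m y - En *m Om *m (W *m y))) +
    Co *m (Fn *m (F *m (W *m y))) = Cv *m E *m (Om *m y).
Proof.
move=> EE FF; rewrite (mulmxA Fn) FF mul1mx mulmxBr -(mulmxA En) (mulmxA E En) EE mul1mx mulmxBr.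
rewrite -(mulmxA Cw); move: (W *m y) => v; rewrite -(mulmxA Cv E).
move: (Cv *m (E *m _)) => a; rewrite (mulmxA D).
have -> : Cv *m (Om *m v) = D *m Cw *m v + Co *m v by rewrite -mulmxDl DCw mulmxA.
move: (D *m Cw *m v) (Co *m v) => x z.
by rewrite addrCA opprD addNKr subrK.
Qed.

Section Apply.
Variable f : R -> 'cV[C]_m.
Hypothesis f2 : L2plus f.

(** The kernel [rker (t - tau)] separates into a factor in t and one in tau; [past] and [future] are
    the tau parts for [tau <= t] and [tau > t]. *)
Definition past (tau : R) := Ev (- tau) *m B1 *m f tau.
Definition future (tau : R) := Ews tau *m Cw^t* *m f tau.

Lemma Mcont_past t : Mcont (fun u => Ev (- u) *m B1) t.
Proof. by apply: McontM (Mcont_expmN _ _) (Mcont_cst _ _). Qed.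
Lemma Mcont_future t : Mcont (fun u => Ews u *m Cw^t*) t.
Proof. by apply: McontM (Mcont_expm _ _) (Mcont_cst _ _). Qed.

Lemma past_int b : Mintegrable (seg b) past.
Proof.
apply: (Mintegrable_L2 _ (@seg_half _ b) Mcont_past) => //.
by move=> i j; apply: segment_cn2 => t; exact: Mcont_past.
Qed.

Lemma future_int : Mintegrable half future.
Proof.
have [d d0 dec] := expm_decays (stable_adj sw).
apply: (Mintegrable_L2 _ _ Mcont_future) => //.
move=> i j; apply: (decays_cn2 _ _ d0) => [t|]; first exact: Mcont_future.
exact: decaysMr.
Qed.

Lemma future_tail t : 0 <= t -> Mintegrable (tail t) future.
Proof. by move=> t0; move: future_int; apply: MintegrableS => //; exact: tail_half. Qed.

Lemma WH_opE t : 0 <= t -> WH_op D rker f t =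
  D *m f t + Cv *m (Ev t *m Mint (seg t) past) + Co *m (Ews (- t) *m Mint (tail t) future).
Proof.
move=> t0; rewrite WH_opM -addrA; congr (_ + _).
pose k tau := rker (t - tau) *m f tau.
have k1 tau : seg t tau -> Cv *m Ev t *m past tau = k tau.
  rewrite /= in_itv /= => /andP[_ h]; rewrite /k /rker subr_ge0 h expm_sub /past.
  by rewrite !mulmxA.
have k2 tau : tail t tau -> Co *m Ews (- t) *m future tau = k tau.
  rewrite /= in_itv /= andbT => h; rewrite /k /rker subr_ge0 leNgt h /=.
  have -> : - (t - tau) = - t - - tau by rewrite opprB opprK addrC.
  by rewrite expm_sub opprK /future !mulmxA.
have i1 : Mintegrable (seg t) k by apply: Mintegrable_eq k1 _ => //; apply: MintegrableMl => //; exact: past_int.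
have i2 : Mintegrable (tail t) k.
  by apply: Mintegrable_eq k2 _ => //; apply: MintegrableMl => //; exact: future_tail.
rewrite (Mint_half t0 (Mintegrable_half t0 i1 i2)) -(Mint_eq k1) -(Mint_eq k2).
by rewrite !MintMl ?mulmxA //; [exact: future_tail|exact: past_int].
Qed.

End Apply.

(** Both integrals have explicit primitives. The contributions at time t cancel by
    [D C_w + C_o = C_v Omega], and the initial value [Omega y] of the past integral remains. *)
Lemma WH_op_output y t : 0 <= t ->
  WH_op D rker (fun t => Cw *m Ew t *m y) t = Cv *m Ev t *m (Om *m y).
Proof.
move=> t0; have f2 := output_L2 Cw sw y.
have [dKK _ _] := dw.
set f := fun t => _ in f2 *.
have dE u : Mder (fun t => Ew t *m y) u (Aw *m (Ew u *m y)).
  by apply: Mder_eq (MderMr y (Mder_expm Aw u)) _; rewrite mulmxA.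
have dfut u : Mder (fun t => - (Ews t *m (Ew t *m y))) u (future f u).
  have := MderMl (- 1%:M) (MderM (Mder_expm (Aw^t*) u) (dE u)).
  under [X in Mder X _ _ -> _]eq_fun do rewrite mulNmx mul1mx.
  move=> h; apply: Mder_eq h _; rewrite expm_comm /future /f -!mulmxA (mulmxA (Cw^t*)) (output_gram dKK).
  exact: future_derivative.
have dpast u : Mder (fun t => - (Ev (- t) *m Om *m (Ew t *m y))) u (past f u).
  have := MderMl (- 1%:M) (MderM (MderMr Om (Mder_expmN Av u)) (dE u)).
  under [X in Mder X _ _ -> _]eq_fun do rewrite mulNmx mul1mx.
  move=> h; apply: Mder_eq h _; rewrite expm_comm /past /f -!mulmxA (mulmxA B1) B1Cw.
  exact: past_derivative.
have df u : Mder f u (Cw *m (Aw *m Ew u) *m y) by exact: MderMr (MderMl _ (Mder_expm Aw u)).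
have dpast' u : exists p', Mder (past f) u p'.
  by eexists; exact: MderM (MderMr B1 (Mder_expmN Av u)) (df u).
have dfut' u : exists p', Mder (future f) u p'.
  by eexists; exact: MderM (MderMr (Cw^t*) (Mder_expm (Aw^t*) u)) (df u).
have [p' dp'] := choice dpast'; have [q' dq'] := choice dfut'.
have P : Mint (seg t) (past f) = Om *m y - Ev (- t) *m Om *m (Ew t *m y).
  rewrite (Mint_seg t0 dpast dp') oppr0 !expm0 !mul1mx opprK addrC //.
have [d d0 dec] := expm_decays sw; have [e e0 dec'] := expm_decays (stable_adj sw).
have S : Mint half (future f) = y.
  have dF : decays (fun t => - (Ews t *m (Ew t *m y))) e.
    have := decaysMl (- 1%:M) (decaysM (ltW d0) dec' (decaysMr y dec)).
    by under eq_fun do rewrite mulNmx mul1mx.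
  have dG : decays (future f) e.
    by apply: decaysM (ltW d0) (decaysMr _ dec') _; apply: decaysMr; exact: decaysMl.
  by have [_ ->] := Mint_ray e0 dfut dq' dF dG; rewrite opprK !expm0 !mul1mx.
have Ttail : Mint (tail t) (future f) = Ews t *m (Ew t *m y).
  have := Mint_half t0 (future_int f2); rewrite S (Mint_seg t0 dfut dq') expm0 expm0 !mul1mx opprK.
  by move=> h; apply: (addrI (- (Ews t *m (Ew t *m y)) + y)); rewrite -h addrAC addNr add0r.
rewrite (WH_opE f2 t0) P Ttail.
apply: output_response; [exact: expmKN|exact: expmNK].
Qed.

End SymbolKernel.
End Kernel.

(** * Growth estimates *)

Section Bounds.
Variable R : realType.
Local Notation C := R[i].
Local Notation Re := complex.Re.
Local Notation Im := complex.Im.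
Local Notation leb := (@lebesgue_measure R).
Local Notation half := (`[0%R, +oo[%classic : set R).
Local Notation seg b := (`[0%R, b]%classic : set R).
Local Notation tail b := (`]b, +oo[%classic : set R).

(** Half of the rate [d] absorbs the linear factor, the other half tends to 0. *)
Lemma linear_decay0 (a b c d : R) : 0 < d -> 0 <= a -> 0 <= b ->
  (forall t, 0 < t -> c <= expR (- d * t) * (a * t + b)) -> c <= 0.
Proof.
move=> d0 a0 b0 H; pose e := d / 2; have e0 : 0 < e by rewrite divr_gt0.
have K0 : 0 <= a / e + b by rewrite addr_ge0 // divr_ge0 // ltW.
have h t : 0 < t -> c <= (a / e + b) * expR (- e * t).
  move=> t0; apply: (le_trans (H t t0)).
  have le1 : 1 + e * t <= expR (e * t) by exact: expR_ge1Dx.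
  have -> : expR (- d * t) = expR (- e * t) * expR (- e * t).
    by rewrite -expRD; congr expR; rewrite /e; lra.
  rewrite -mulrA mulrC ler_wpM2r ?expR_ge0 //.
  rewrite mulrC -ler_pdivlMr ?expR_gt0 // mulNr expRN invrK.
  have et0 : 0 < e * t by exact: mulr_gt0.
  rewrite mulrDl lerD //; last by rewrite ler_peMr //; lra.
  rewrite mulrAC ler_pdivlMr // -mulrA ler_wpM2l // mulrC; lra.
have lim0 : ((a / e + b) * expR (- e * t)) @[t --> +oo] --> (0 : R).
  by rewrite -(mulr0 (a / e + b)); apply: cvgM; [exact: cvg_cst|exact: cvg_expN].
apply: (ler_cvg_to (@cvg_cst _ c _ (pinfty_nbhs R) _) lim0).
near=> t; apply: h; near: t; apply: nbhs_pinfty_gt; exact: num_real.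
Unshelve. all: by end_near. Qed.

Lemma Rintegral_subset (A B : set R) (g : R -> R) : measurable A -> measurable B -> A `<=` B ->
  leb.-integrable B (EFin \o g) -> (forall t, 0 <= g t) -> Rintegral leb A g <= Rintegral leb B g.
Proof.
move=> mA mB AB ig g0.
have iA : leb.-integrable A (EFin \o g) by move: ig; exact: integrableS.
apply: fine_le; [exact: integrable_fin_num|exact: integrable_fin_num|].
apply: ge0_subset_integral => //; last by move=> t _; rewrite lee_fin.
by case/integrableP: ig.
Qed.

Definition energy m (f : R -> 'cV[C]_m) t := \sum_k abs2 (f t k 0).

Lemma energy_int m (f : R -> 'cV[C]_m) : L2plus f -> leb.-integrable half (EFin \o energy f).
Proof.
move=> f2; rewrite /energy; elim: (index_enum _) => [|k r IH].
  have h := @integrable0 _ _ R leb half; move: h; apply: eq_integrable => // t _.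
  by rewrite /= big_nil.
have h := integrable_add (measurable_itv _) (L2_abs2 k f2) IH.
by move: h; apply: eq_integrable => // t _; rewrite /= big_cons.
Qed.

Lemma energy_ge0 m (f : R -> 'cV[C]_m) t : 0 <= energy f t.
Proof. by apply: sumr_ge0 => k _; exact: abs2_ge0. Qed.

(** Each of the m products in a row is bounded by [q] plus the square of one component of [f], which
    explains the factor [m] and the single energy term. *)
Lemma Mint_L2_bound p m (D : set R) (G : R -> 'M[C]_(p, m)) (f : R -> 'cV[C]_m) (q : R -> R) i :
  measurable D -> D `<=` half -> L2plus f -> Mintegrable D (fun t => G t *m f t) ->
  leb.-integrable D (EFin \o q) -> (forall t j k, D t -> cn (G t j k) ^+ 2 <= q t) ->
  cn (Mint D (fun t => G t *m f t) i 0) <= m%:R * Rintegral leb D q + Rintegral leb half (energy f).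
Proof.
move=> mD Dh f2 iGf iq Gq; rewrite mxE.
have iE : leb.-integrable D (EFin \o energy f) by move: (energy_int f2); exact: integrableS.
have imq := integrable_scale m%:R mD iq.
apply: (@le_trans _ _ (Rintegral leb D (fun t => m%:R * q t + energy f t))).
  apply: cn_Cintegral => //; first exact: integrable_add.
  move=> t Dt; rewrite mxE (le_trans (cn_sum _ _)) // /energy.
  have -> : m%:R * q t = \sum_(k < m) q t by rewrite sumr_const card_ord mulr_natl.
  rewrite -big_split /=; apply: ler_sum => k _; rewrite (le_trans (cnM_le _ _)) // lerD2r.
  exact: Gq.
rewrite RintegralD // RintegralZl // lerD2l; apply: Rintegral_subset => //; first exact: energy_int.
exact: energy_ge0.
Qed.

End Bounds.

(** * States of a function in the kernel *)

Section KernelElements.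
Variable R : realType.
Local Notation C := R[i].
Local Notation Re := complex.Re.
Local Notation Im := complex.Im.
Local Notation leb := (@lebesgue_measure R).
Local Notation half := (`[0%R, +oo[%classic : set R).
Local Notation seg b := (`[0%R, b]%classic : set R).
Local Notation tail b := (`]b, +oo[%classic : set R).
Variables (m nv nw : nat) (Av : 'M[C]_nv) (Bv : 'M[C]_(nv, m)) (Cv : 'M[C]_(m, nv)) (Dv : 'M[C]_m)
  (Aw : 'M[C]_nw) (Bw : 'M[C]_(nw, m)) (Cw : 'M[C]_(m, nw)) (Dw : 'M[C]_m) (Om : 'M[C]_(nv, nw)).
Hypotheses (sv : stable Av) (sw : stable Aw) (dv : dissipative Av Bv Cv Dv)
  (dw : dissipative Aw Bw Cw Dw) (lyap : Av *m Om + Om *m Aw^t* + Bv *m Bw^t* = 0).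
Local Notation Co := (Dv *m Bw^t* + Cv *m Om).
Local Notation D := (Dv *m Dw^t*).
Local Notation B1 := (Bv *m Dw^t* + Om *m Cw^t*).
Local Notation Ev := (expm Av).
Local Notation Ew := (expm Aw).
Local Notation Ews := (expm (Aw^t*)).
Local Notation r := (rker Av Bv Cv Dv Aw Bw Cw Dw Om).
Local Notation past_of := (past Av Bv Cw Dw Om).
Local Notation future_of := (future Aw Cw).

(** The solution [f] of [D f + C_v x + C_o y = 0]; [D] is unitary as a product of unitary
    matrices. *)
Definition feedback (x : 'cV[C]_nv) (y : 'cV[C]_nw) : 'cV[C]_m := - (D^t* *m (Cv *m x + Co *m y)).

Lemma D_adj : D^t* *m D = 1%:M /\ D^t* = Dw *m Dv^t*.
Proof.
have [_ /unitary_adj[_ vv] _] := dv; have [_ /unitary_adj[ww _] _] := dw.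
have e : D^t* = Dw *m Dv^t* by rewrite adjmxM trmxCK.
by split=> //; rewrite e mulmxA -(mulmxA Dw) vv mulmx1 ww.
Qed.

Lemma feedback_eq (f : 'cV[C]_m) x y : D *m f + Cv *m x + Co *m y = 0 -> f = feedback x y.
Proof.
move=> h; have [DD _] := D_adj; apply/eqP; rewrite -subr_eq0 opprK -{1}[f]mul1mx -DD -mulmxA -mulmxDr.
by rewrite addrA h mulmx0.
Qed.

Lemma feedback_state x y (f := feedback x y) :
  Av *m x + B1 *m f + Om *m (- (Aw^t* *m y) - Cw^t* *m f) = - (Av^t* *m (x + Om *m y)).
Proof.
have [_ /unitary_adj[_ ww] _] := dw.
have E : Bv *m Dw^t* *m f = Cv^t* *m (Cv *m x + Co *m y).
  rewrite /f /feedback (D_adj).2 mulmxN mulmxA (mulmxA (_ *m _) Dw) -(mulmxA Bv) ww mulmx1.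
  by rewrite (dissBD dv) mulNmx opprK.
have F : Cv^t* *m (Cv *m x + Co *m y) = - (Av *m x + Av^t* *m x) + (Om *m Aw^t* *m y - Av^t* *m Om *m y).
  rewrite mulmxDr (mulmxA _ Cv) (mulmxA _ Co) (dissKK dv) mulNmx (mulmxDl Av); congr (_ + _).
  by rewrite -(CvCo dv lyap) -mulmxBl addrK.
clearbody f; rewrite mulmxDl E F mulmxBr mulmxN (mulmxDr (Av^t*)) (mulmxA Om (Aw^t*)) (mulmxA Om (Cw^t*)) (mulmxA (Av^t*) Om).
move: (Av *m x) (Av^t* *m x) (Om *m Aw^t* *m y) (Av^t* *m Om *m y) (Om *m Cw^t* *m f) => a b c d e.
by apply/matrixP => i j; rewrite !mxE; ring.
Qed.

(** On [x = -Omega y] the terms with [C_v] cancel, leaving [-D_w B_w^* y = C_w y]. *)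
Lemma feedback_graph y : feedback (- (Om *m y)) y = Cw *m y.
Proof.
have [_ /unitary_adj[_ vv] _] := dv.
rewrite /feedback (D_adj).2 mulmxDl mulmxN (mulmxA Cv) addrCA addNr addr0.
by rewrite -!mulmxA (mulmxA (Dv^t*)) vv mul1mx mulmxA (dissDB dw) mulNmx opprK.
Qed.

Lemma adj_output (y : 'cV[C]_nw) : - (Aw^t* *m y) - Cw^t* *m (Cw *m y) = Aw *m y.
Proof. by rewrite mulmxA (dissKK dw) mulNmx opprK mulmxDl addrC addrK. Qed.

Section Trajectory.
Variable f : R -> 'cV[C]_m.
Hypothesis kf : WH_ker D r f.

Let f2 : L2plus f. Proof. by case: kf. Qed.
Definition past_state t := Ev t *m Mint (seg t) (past_of f).
(** The integral over the tail is written as total minus initial part, so that it can be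
    differentiated in t. *)
Definition future_state t := Ews (- t) *m (Mint half (future_of f) - Mint (seg t) (future_of f)).
(** The representative of [f] obtained from the states, continuous on [t > 0] although [f] is
    determined only almost everywhere. *)
Definition phi t := feedback (past_state t) (future_state t).
Definition defect_state t := past_state t + Om *m future_state t.

Lemma future_stateE t : 0 <= t -> future_state t = Ews (- t) *m Mint (tail t) (future_of f).
Proof. by move=> t0; rewrite /future_state (Mint_half t0 (future_int Cw sw f2)) addrC addKr. Qed.

Lemma f_phi : {ae leb, forall t, 0 <= t -> f t = phi t}.
Proof.
have [_] := kf; apply: ae_imply => t h t0; apply: feedback_eq; rewrite -[RHS](h t0).
by rewrite (WH_opE Av Bv Cv Dv Bw Cw Dw Om sw f2 t0) -future_stateE.
Qed.

Lemma future_seg b : Mintegrable (seg b) (future_of f).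
Proof. by move: (future_int Cw sw f2); apply: MintegrableS => //; exact: seg_half. Qed.

Lemma past_state_cont t : 0 < t -> Mcont past_state t.
Proof.
by move=> t0; apply: McontM (Mcont_expm _ _) _; apply: Mint_primitive_cont => // b; exact: past_int.
Qed.

Lemma future_state_cont t : 0 < t -> Mcont future_state t.
Proof.
move=> t0; apply: McontM (Mcont_expmN _ _) _; apply: McontD (Mcont_cst _ _) _.
have h := McontM (Mcont_cst (- 1%:M) t) (Mint_primitive_cont future_seg t0).
by move: h; under [X in Mcont X _ -> _]eq_fun do rewrite mulNmx mul1mx.
Qed.

Lemma phi_cont t : 0 < t -> Mcont phi t.
Proof.
move=> t0; have h := McontM (Mcont_cst (- D^t*) t) (McontD (McontM (Mcont_cst Cv t) (past_state_cont t0))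
  (McontM (Mcont_cst Co t) (future_state_cont t0))).
by move: h; under [X in Mcont X _ -> _]eq_fun do rewrite mulNmx.
Qed.

Lemma past_cont t : 0 < t -> Mcont (past_of phi) t.
Proof. by move=> t0; apply: McontM (phi_cont t0); exact: Mcont_past. Qed.
Lemma future_cont t : 0 < t -> Mcont (future_of phi) t.
Proof. by move=> t0; apply: McontM (phi_cont t0); exact: Mcont_future. Qed.

(** Replacing [f] by [phi] leaves the integral unchanged but makes the integrand continuous, so that
    the state becomes differentiable. *)
Lemma past_phi b : Mintegrable (seg b) (past_of phi) /\ Mint (seg b) (past_of phi) = Mint (seg b) (past_of f).
Proof.
apply: Mint_ae => //; first exact: past_int.
  exact: (Mmeas_sub _ (@seg_half _ b) (Mcont_meas past_cont)).
move: f_phi; apply: ae_imply => t h /seg_half /=; rewrite in_itv /= andbT => /h.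
by rewrite /past => ->.
Qed.

Lemma future_phi b : Mintegrable (seg b) (future_of phi) /\ Mint (seg b) (future_of phi) = Mint (seg b) (future_of f).
Proof.
apply: Mint_ae => //; first exact: future_seg.
  exact: (Mmeas_sub _ (@seg_half _ b) (Mcont_meas future_cont)).
move: f_phi; apply: ae_imply => t h /seg_half /=; rewrite in_itv /= andbT => /h.
by rewrite /future => ->.
Qed.

Lemma past_state_der t : 0 < t -> Mder past_state t (Av *m past_state t + B1 *m phi t).
Proof.
move=> t0; have dP : Mder (fun u => Mint (seg u) (past_of f)) t (past_of phi t).
  rewrite (_ : (fun u => _) = fun u => Mint (seg u) (past_of phi)); last first.
    by apply/funext => u; rewrite (past_phi u).2.
  apply: Mint_primitive_der => //; [by move=> b; case: (past_phi b)|exact: past_cont].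
apply: Mder_eq (MderM (Mder_expm Av t) dP) _.
by rewrite /past -mulmxA -[_ *m B1 *m _]mulmxA (mulmxA (Ev t)) expmKN mul1mx.
Qed.

Lemma future_state_der t : 0 < t -> Mder future_state t (- (Aw^t* *m future_state t) - Cw^t* *m phi t).
Proof.
move=> t0; have dP : Mder (fun u => Mint (seg u) (future_of f)) t (future_of phi t).
  rewrite (_ : (fun u => _) = fun u => Mint (seg u) (future_of phi)); last first.
    by apply/funext => u; rewrite (future_phi u).2.
  apply: Mint_primitive_der => //; [by move=> b; case: (future_phi b)|exact: future_cont].
have dT : Mder (fun u => Mint half (future_of f) - Mint (seg u) (future_of f)) t (- future_of phi t).
  have := MderD (Mder_cst (Mint half (future_of f)) t) (MderMl (- 1%:M) dP).
  under [X in Mder X _ _ -> _]eq_fun do rewrite mulNmx mul1mx.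
  by move=> h; apply: Mder_eq h _; rewrite add0r mulNmx mul1mx.
apply: Mder_eq (MderM (Mder_expmN (Aw^t*) t) dT) _.
rewrite /future mulmxN -[_ *m Cw^t* *m _]mulmxA (mulmxA (Ews (- t))) expmNK mul1mx mulNmx.
by rewrite -mulmxA.
Qed.

Lemma defect_state_der t : 0 < t -> Mder defect_state t (- (Av^t* *m defect_state t)).
Proof.
move=> t0; apply: Mder_eq (MderD (past_state_der t0) (MderMl Om (future_state_der t0))) _.
exact: feedback_state.
Qed.

(** For [tau <= t] the kernel is bounded by a constant, so its square contributes at most [M^2 t];
    the rest is the energy of [f]. *)
Lemma past_state_bound : exists a b : R, [/\ 0 <= a, 0 <= b & forall t i, 0 < t -> cn (past_state t i 0) <= a * t + b].
Proof.
have [d d0 /(decaysMr B1)[M [M0 HM]]] := expm_decays sv.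
exists (m%:R * M ^+ 2), (Rintegral leb half (energy f)); split.
- by rewrite mulr_ge0 ?sqr_ge0.
- by apply: Rintegral_ge0 => t _; exact: energy_ge0.
move=> t i t0.
pose G tau := Ev t *m (Ev (- tau) *m B1).
have e : past_state t = Mint (seg t) (fun tau => G tau *m f tau).
  rewrite /past_state -MintMl //; last exact: past_int.
  by apply: Mint_eq => // tau _; rewrite /G /past mulmxA.
have iM : leb.-integrable (seg t) (EFin \o (fun=> M ^+ 2)).
  by apply: integrable_segment => u; exact: cvg_cst.
rewrite e; apply: (le_trans (@Mint_L2_bound _ _ _ (seg t) G f (fun=> M ^+ 2) i _ (@seg_half _ t) f2 _ iM _)) => //.
- apply: Mintegrable_eq (MintegrableMl _ (Ev t) (past_int Av Bv Cw Dw Om f2 t)) => // tau _.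
  by rewrite /G /past mulmxA.
- move=> tau j k; rewrite /= in_itv /= => /andP[_ h].
  rewrite ler_sqr ?nnegrE ?cn_ge0 // /G mulmxA -expm_sub.
  have tt : 0 <= t - tau by rewrite subr_ge0.
  rewrite (le_trans (HM _ j k tt)) // ler_piMr // -expR0 ler_expR mulNr oppr_le0 mulr_ge0 //.
  exact: ltW.
- rewrite lerD2r -mulrA ler_wpM2l //.
  rewrite Rintegral_cst //= lebesgue_measure_itv /= lte_fin t0 -EFinB /= subr0.
  by rewrite mulrC.
Qed.

(** The kernel decays like [e^(-d(tau - t))], whose square integrates over the tail to [1/(2d)] for
    every t. *)
Lemma future_state_bound : exists b : R, 0 <= b /\ forall t i, 0 < t -> cn (future_state t i 0) <= b.
Proof.
have [d d0 /(decaysMr (Cw^t*))[M [M0 HM]]] := expm_decays (stable_adj sw).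
have d2 : 0 < 2 * d by rewrite mulr_gt0.
exists (m%:R * (M ^+ 2 / (2 * d)) + Rintegral leb half (energy f)); split.
  apply: addr_ge0; first by rewrite mulr_ge0 // divr_ge0 ?sqr_ge0 // ltW.
  by apply: Rintegral_ge0 => t _; exact: energy_ge0.
move=> t i t0; rewrite future_stateE ?(ltW t0) //.
pose G tau := Ews (- t) *m (Ews tau *m Cw^t*).
pose q tau := M ^+ 2 * expR (2 * d * t) * expR (- (2 * d) * tau).
have ft := future_tail Cw sw f2 (ltW t0).
have [Ee ie] := exp_ray t d2.
have ie' : leb.-integrable (tail t) (EFin \o (fun tau => expR (- (2 * d) * tau))).
  by move: ie; apply: integrableS => // u /=; rewrite !in_itv /= !andbT; exact: ltW.
have iq : leb.-integrable (tail t) (EFin \o q) by exact: integrable_scale.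
have Eq : Rintegral leb (tail t) q = M ^+ 2 / (2 * d).
  rewrite /q RintegralZl // Rintegral_itv_obnd_cbnd // Ee -[LHS]mulrA; congr (_ * _).
  by rewrite mulrA -expRD mulNr subrr expR0 mul1r.
have e : Ews (- t) *m Mint (tail t) (future_of f) = Mint (tail t) (fun tau => G tau *m f tau).
  rewrite -MintMl //; by apply: Mint_eq => // tau _; rewrite /G /future mulmxA.
rewrite e -Eq; apply: Mint_L2_bound; [by []|exact: tail_half (ltW t0)|exact: f2| |exact: iq|].
- apply: Mintegrable_eq (MintegrableMl _ (Ews (- t)) ft) => // tau _.
  by rewrite /G /future mulmxA.
- move=> tau j k; rewrite /= in_itv /= andbT => h.
  have -> : q tau = (M * expR (- d * (tau - t))) ^+ 2.
    rewrite exprMn -expRM_natl /q -mulrA -expRD; congr (_ * expR _); ring.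
  rewrite ler_sqr ?nnegrE ?cn_ge0 ?mulr_ge0 ?expR_ge0 // /G mulmxA.
  have -> : Ews (- t) *m Ews tau = Ews (tau - t).
    by rewrite -[in LHS](opprK tau) -expm_sub opprK addrC.
  by apply: HM; rewrite subr_ge0 ltW.
Qed.

Lemma defect_state_eq0 t : 0 < t -> defect_state t = 0.
Proof.
pose c u := expm (Av^t*) u *m defect_state u.
have dc u : 0 < u -> Mder c u 0.
  move=> u0; apply: Mder_eq (MderM (Mder_expm _ u) (defect_state_der u0)) _.
  by rewrite expm_comm mulmxN mulmxA addrN.
have cE u : 0 < u -> c u = c 1 by move=> u0; exact: Mder_positive_cst dc _ _ u0 ltr01.
have [d d0 [M [M0 HM]]] := expm_decays (stable_adj sv).
have [a [b [a0 b0 xB]]] := past_state_bound; have [b' [b'0 yB]] := future_state_bound.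
pose N := \sum_(i < nv) \sum_(k < nw) cn (Om i k).
have N0 : 0 <= N by apply: sumr_ge0 => i _; apply: sumr_ge0 => k _; exact: cn_ge0.
have zB u i : 0 < u -> cn (defect_state u i 0) <= a * u + (b + N * b').
  move=> u0; rewrite mxE (le_trans (cnD _ _)) // (addrA (a * u)); apply: lerD; first exact: xB.
  rewrite mxE (le_trans (cn_sum _ _)) //.
  apply: (@le_trans _ _ ((\sum_(k < nw) cn (Om i k)) * b')).
    rewrite mulr_suml; apply: ler_sum => k _; rewrite (le_trans (cnM _ _)) // ler_wpM2l ?cn_ge0 //.
    exact: yB.
  rewrite ler_wpM2r // /N (bigD1 i) //= lerDl sumr_ge0 // => j _; apply: sumr_ge0 => k _; exact: cn_ge0.
(* The constant [c] is bounded by a decaying exponential times a linear function of [u], for every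
   [u > 0]. *)
have c1 : c 1 = 0.
  apply/matrixP => i j; rewrite (ord1 j) [RHS]mxE; apply: cn_eq0; apply/eqP.
  rewrite eq_le cn_ge0 andbT.
  apply: (@linear_decay0 _ (nv%:R * M * a) (nv%:R * M * (b + N * b')) _ d) => //.
  - by rewrite !mulr_ge0.
  - by rewrite !mulr_ge0 // addr_ge0 // mulr_ge0.
  move=> u u0; rewrite -(cE u u0) mxE (le_trans (cn_sum _ _)) //.
  have -> : expR (- d * u) * (nv%:R * M * a * u + nv%:R * M * (b + N * b')) =
      \sum_(k < nv) M * expR (- d * u) * (a * u + (b + N * b')).
    by rewrite sumr_const card_ord -[RHS]mulr_natl; ring.
  apply: ler_sum => k _; rewrite (le_trans (cnM _ _)) // ler_pM ?cn_ge0 ?zB //.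
  exact: HM (ltW u0).
move=> t0; have : c t = 0 by rewrite cE.
by move=> h; rewrite -[defect_state t]mul1mx -(expmNK (Av^t*) t) -mulmxA -/(c t) h mulmx0.
Qed.

(** With [z = 0] the feedback is [C_w y], so [y' = -A_w^* y - C_w^* C_w y = A_w y] and
    [e^(-tA_w) y(t)] is constant. *)
Lemma kernel_shape : exists y : 'cV[C]_nw, forall t, 0 < t -> phi t = Cw *m Ew t *m y.
Proof.
have xE t : 0 < t -> past_state t = - (Om *m future_state t).
  by move=> t0; apply/eqP; rewrite -addr_eq0 -/(defect_state t) defect_state_eq0.
have pE t : 0 < t -> phi t = Cw *m future_state t by move=> t0; rewrite /phi xE // feedback_graph.
have dy t : 0 < t -> Mder future_state t (Aw *m future_state t).
  by move=> t0; apply: Mder_eq (future_state_der t0) _; rewrite pE // adj_output.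
pose c u := Ew (- u) *m future_state u.
have dc u : 0 < u -> Mder c u 0.
  move=> u0; apply: Mder_eq (MderM (Mder_expmN _ u) (dy u u0)) _.
  by rewrite mulNmx expm_comm -mulmxA addNr.
exists (c 1) => t t0; rewrite -(Mder_positive_cst dc t0 ltr01) pE //.
by rewrite /c -mulmxA (mulmxA (Ew t)) expmKN mul1mx.
Qed.

End Trajectory.

End KernelElements.

(** * A basis of the kernel *)

Section Nullity.
Variable R : realType.
Local Notation C := R[i].
Local Notation Re := complex.Re.
Local Notation Im := complex.Im.
Local Notation leb := (@lebesgue_measure R).
Local Notation half := (`[0%R, +oo[%classic : set R).
Local Notation seg b := (`[0%R, b]%classic : set R).
Local Notation tail b := (`]b, +oo[%classic : set R).

Lemma ae_neq0 : {ae leb, forall t : R, t <> 0}.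
Proof.
exists [set (0 : R)]; split; [exact: measurable_set1|exact: lebesgue_measure_set1|].
by move=> t /= /contrapT.
Qed.

Lemma Mintegrable_meas m n (D : set R) (F : R -> 'M[C]_(m, n)) : Mintegrable D F -> Mmeas D F.
Proof.
move=> h i j; have [h1 h2] := h i j.
split; apply/measurable_EFinP; [by case/integrableP: h1|by case/integrableP: h2].
Qed.

Variables (m nv nw : nat) (Av : 'M[C]_nv) (Bv : 'M[C]_(nv, m)) (Cv : 'M[C]_(m, nv)) (Dv : 'M[C]_m)
  (Aw : 'M[C]_nw) (Bw : 'M[C]_(nw, m)) (Cw : 'M[C]_(m, nw)) (Dw : 'M[C]_m) (Om : 'M[C]_(nv, nw)).
Hypotheses (sv : stable Av) (sw : stable Aw) (dv : dissipative Av Bv Cv Dv)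
  (dw : dissipative Aw Bw Cw Dw) (lyap : Av *m Om + Om *m Aw^t* + Bv *m Bw^t* = 0).
Local Notation D := (Dv *m Dw^t*).
Local Notation Ev := (expm Av).
Local Notation Ew := (expm Aw).
Local Notation r := (rker Av Bv Cv Dv Aw Bw Cw Dw Om).
Local Notation out y := (fun t : R => Cw *m Ew t *m y).

(** The integrals see only the class of [f], but the term [D f(t)] needs equality at [t] itself. *)
Lemma WH_op_ae f g t : L2plus f -> L2plus g -> eq_plus f g -> 0 <= t -> f t = g t ->
  WH_op D r f t = WH_op D r g t.
Proof.
move=> f2 g2 fg t0 ft; rewrite (WH_opE Av Bv Cv Dv Bw Cw Dw Om sw f2 t0) (WH_opE Av Bv Cv Dv Bw Cw Dw Om sw g2 t0) ft.
have -> : Mint (seg t) (past Av Bv Cw Dw Om f) = Mint (seg t) (past Av Bv Cw Dw Om g).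
  have mD : measurable (seg t) by [].
  apply/esym; apply: (Mint_ae mD (past_int Av Bv Cw Dw Om f2 t) _ _).2.
    exact: Mintegrable_meas (past_int Av Bv Cw Dw Om g2 t).
  move: fg; apply: ae_imply => u h /seg_half /=; rewrite in_itv /= andbT => /h.
  by rewrite /past => ->.
have -> // : Mint (tail t) (future Aw Cw f) = Mint (tail t) (future Aw Cw g).
have mD : measurable (tail t) by [].
apply/esym; apply: (Mint_ae mD (future_tail Cw sw f2 t0) _ _).2.
  exact: Mintegrable_meas (future_tail Cw sw g2 t0).
move: fg; apply: ae_imply => u h /(tail_half t0) /=; rewrite in_itv /= andbT => /h.
by rewrite /future => ->.
Qed.

Lemma WH_ker_output y : Om *m y = 0 -> WH_ker D r (out y).
Proof.
move=> Oy; split; first exact: output_L2.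
apply: aeW => t t0; rewrite (WH_op_output Cv Dv sw dw lyap) //.
by rewrite Oy mulmx0.
Qed.

(** Once [f] is the output of some [y], the operator maps it to [C_v e^(tA_v) Omega y];
    observability of [V] gives [Omega y = 0]. The point t = 0, not covered by [phi], is a null
    set. *)
Lemma WH_kerP f : WH_ker D r f -> exists2 y, Om *m y = 0 & eq_plus f (out y).
Proof.
move=> kf; have [f2 f0] := kf; have [dKK _ _] := dw; have [dKKv _ _] := dv.
have [y yE] := kernel_shape sv sw dv dw lyap kf.
have fy : eq_plus f (out y).
  move: (ae_and (f_phi sw dv dw kf) ae_neq0); apply: ae_imply => t [h tn0] t0.
  rewrite h // yE // lt_def t0 andbT; exact/eqP.
exists y => //.
apply: (output_eq0 sv dKKv).
move: (ae_and f0 fy); apply: ae_imply => t [h1 h2] t0.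
rewrite -(WH_op_output Cv Dv sw dw lyap) // -(WH_op_ae f2 (output_L2 Cw sw y) fy t0 (h2 t0)).
exact: h1.
Qed.

Lemma WH_nullity_gram F : WH_kernel_fun F D r -> WH_nullity F (nullity (Om^t* *m Om)).
Proof.
move=> kF; exists D, r; split=> //; have [dKK _ _] := dw.
pose K := kermx (Om^t* *m Om)^T; pose y (i : 'I_(\rank K)) := (row i (row_base K))^T.
have Oy i : Om *m y i = 0.
  apply/gram_kernel; apply: trmx_inj; rewrite trmx_mul trmx0 /y trmxK.
  by apply/sub_kermxP; rewrite (submx_trans (row_sub _ _)) // eq_row_base.
have sumE (c : 'I_(\rank K) -> C) t : \sum_i c i *: (Cw *m Ew t *m y i) = Cw *m Ew t *m (\sum_i c i *: y i).
  by rewrite mulmx_sumr; apply: eq_bigr => i _; rewrite -scalemxAr.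
have rowE (c : 'I_(\rank K) -> C) : \sum_i c i *: y i = ((\row_i c i) *m row_base K)^T.
  rewrite mulmx_sum_row linear_sum; apply: eq_bigr => i _; by rewrite linearZ /= mxE.
exists (fun i => out (y i)); split.
- by move=> i; exact: WH_ker_output.
- move=> c c0 i.
  have : \sum_i c i *: y i = 0.
    apply: (output_eq0 sw dKK); move: c0; apply: ae_imply => t h t0.
    by rewrite -sumE h.
  rewrite rowE => /(congr1 trmx); rewrite trmxK trmx0 => /eqP.
  rewrite mulmx_free_eq0 ?row_base_free // => /eqP /rowP /(_ i).
  by rewrite !mxE.
- move=> f /WH_kerP[x Ox fx].
  have : (x^T <= row_base K)%MS.
    rewrite eq_row_base; apply/sub_kermxP; rewrite -trmx_mul -mulmxA Ox mulmx0 trmx0 //.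
  move=> /submxP[u uE]; exists (fun i => u 0 i).
  move: fx; apply: ae_imply => t h t0; rewrite h // sumE rowE; congr (_ *m _).
  rewrite -[x]trmxK uE; congr (_ *m _)^T; by apply/rowP => i; rewrite mxE.
Qed.

End Nullity.

(** * The symbol as a Fourier transform *)

Section LimInfty.
Variables (R : realType) (FF : fracfield (R[i])).
Local Notation C := R[i].
Local Notation K := (ff_sort FF).

Lemma agree_lim_infty m (F : C -> 'M[C]_m) (M : 'M[K]_m) D : agree F M -> evm None M D -> lim_infty F D.
Proof.
move=> [q q0 qF] MD; apply: lim_infty_of_ev MD _.
by move: (near_infty_horner q0); apply: filterS => z; exact: qF.
Qed.

Lemma symbolK_infty m nv nw (Av : 'M[C]_nv) (Bv : 'M[C]_(nv, m)) (Cv : 'M[C]_(m, nv)) (Dv : 'M[C]_m)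
  (Aw : 'M[C]_nw) (Bw : 'M[C]_(nw, m)) (Cw : 'M[C]_(m, nw)) (Dw : 'M[C]_m) :
  evm None (symbolK FF Av Bv Cv Dv Aw Bw Cw Dw) (Dv *m Dw^t*).
Proof.
have hv : evm None (transfer FF Av Bv Cv Dv) (Dv + Cv *m 0 *m Bv).
  apply: evmD; first exact: evm_const.
  apply: evmM; last exact: evm_const.
  by apply: evmM; [exact: evm_const|exact: resolvent_inf].
have hw : evm None (transfer_adj FF Aw Bw Cw Dw) (Dw^t* - Bw^t* *m 0 *m Cw^t*).
  apply: evmD; first exact: evm_const.
  apply: evmN; apply: evmM; last exact: evm_const.
  by apply: evmM; [exact: evm_const|exact: resolvent_inf].
rewrite !mulmx0 !mul0mx addr0 subr0 in hv hw.
exact: evmM hv hw.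
Qed.

End LimInfty.

Section Symbol.
Variable R : realType.
Local Notation C := R[i].
Local Notation Re := complex.Re.
Local Notation Im := complex.Im.
Local Notation leb := (@lebesgue_measure R).
Local Notation half := (`[0%R, +oo[%classic : set R).
Local Notation nhalf := (`]-oo, 0%R]%classic : set R).
Local Notation nhalfo := (`]-oo, 0%R[%classic : set R).

Lemma expNiE (w t : R) : expNi w t = cexp (Complex 0 (- w)) t.
Proof. by rewrite /cexp /= mul0r expR0 !mul1r mulNr cosN sinN. Qed.

Lemma expNiN (w t : R) : expNi w (- t) = expNi (- w) t.
Proof. by rewrite /expNi mulrN mulNr. Qed.

Lemma Cder_expNi (w t : R) : Cder (expNi w) t (- (Complex 0 w) * expNi w t).
Proof.
have := Cder_cexp (Complex 0 (- w)) t; rewrite -expNiE.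
rewrite (_ : cexp _ = expNi w); last by apply/funext => u; rewrite expNiE.
by move=> h; apply: Cder_eq h _; congr (_ * _); apply: C_eqP; rewrite /= ?oppr0.
Qed.

Lemma cn_expNi (w t : R) : cn (expNi w t) <= 2.
Proof. by have := cn_cexp (Complex 0 (- w)) t; rewrite -expNiE /= mul0r expR0 mulr1. Qed.

Lemma MderZl m n (f : R -> C) (F : R -> 'M[C]_(m, n)) t d D : Cder f t d -> Mder F t D ->
  Mder (fun u => f u *: F u) t (d *: F t + f t *: D).
Proof.
move=> h H i j; under eq_fun do rewrite mxE.
by apply: Cder_eq (CderM h (H i j)) _; rewrite !mxE.
Qed.

Lemma imaginary_unit n (A : 'M[C]_n) (w : R) : stable A -> (Complex 0 w)%:M - A \in unitmx.
Proof.
move=> sA; rewrite -[_ \in _]negbK -eigenvalue_unit; apply/negP => /sA /=.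
by rewrite ltxx.
Qed.

(** With X the inverse of [iw - A], a primitive of [e^(-iwt) e^(tA)] is [-X e^(-iwt) e^(tA)], which
    decays and equals [-X] at 0. *)
Lemma fourier_expm n (A : 'M[C]_n) (w : R) : stable A ->
  Mintegrable half (fun t => expNi w t *: expm A t) /\
  Mint half (fun t => expNi w t *: expm A t) = invmx ((Complex 0 w)%:M - A).
Proof.
move=> sA; have u := imaginary_unit w sA; have [d d0 dec] := expm_decays sA.
have [X [XE XK]] : exists X, X = invmx ((Complex 0 w)%:M - A) /\ X *m ((Complex 0 w)%:M - A) = 1%:M.
  by exists (invmx ((Complex 0 w)%:M - A)); rewrite mulVmx.
have dF t : Mder (fun t => expNi w t *: (- X *m expm A t)) t (expNi w t *: expm A t).
  apply: Mder_eq (MderZl (Cder_expNi w t) (MderMl (- X) (Mder_expm A t))) _.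
  move: (expm A t) => E; rewrite mulrC -scalerA -scalerDr; congr (_ *: _).
  rewrite -[RHS]mul1mx -XK !mulNmx scalerN scaleNr opprK mulmxBr mul_mx_scalar mulmxBl.
  by rewrite -scalemxAl mulmxA.
have df t := MderZl (Cder_expNi w t) (Mder_expm A t).
have b2 := decays_scaleb (ler0n _ 2) (cn_expNi w).
have [h1 ->] := Mint_ray d0 dF df (b2 _ _ _ _ (decaysMl (- X) dec)) (b2 _ _ _ _ dec).
split=> //; rewrite expm0 mulmx1 /expNi mulr0 cos0 sin0 oppr0 -XE.
by rewrite (_ : Complex 1 0 = 1 :> C) // scale1r opprK.
Qed.

Lemma fourier_expm_neg n (A : 'M[C]_n) (w : R) : stable A ->
  Mintegrable nhalf (fun t => expNi w t *: expm A (- t)) /\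
  Mint nhalf (fun t => expNi w t *: expm A (- t)) = invmx ((- Complex 0 w)%:M - A).
Proof.
move=> sA; have [d d0 dec] := expm_decays sA.
have df t := MderZl (Cder_expNi w t) (Mder_expmN A t).
have e t : expNi w (- t) *: expm A (- - t) = expNi (- w) t *: expm A t by rewrite expNiN opprK.
have dec' : decays (fun t => expNi w (- t) *: expm A (- - t)) d.
  under eq_fun do rewrite e.
  exact: decays_scaleb (ler0n _ 2) (cn_expNi (- w)) dec.
have [h ->] := Mint_negative_ray d0 df dec'; split=> //.
transitivity (Mint half (fun t => expNi (- w) t *: expm A t)).
  by apply: Mint_eq => t _; exact: e.
have [_ ->] := fourier_expm (- w) sA; congr (invmx (_%:M - _)).
by apply: C_eqP; rewrite /= ?oppr0.
Qed.

Lemma real_line : [set: R] = nhalfo `|` half /\ [disjoint nhalfo & half].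
Proof.
split; first by apply/esym/seteqP; split=> // t _ /=; rewrite !in_itv /= andbT; case: ltP => _; [left|right].
apply/disj_setPS => u [/=]; rewrite !in_itv /= andbT => h1 h2.
by move: (lt_le_trans h1 h2); rewrite ltxx.
Qed.

(** The kernel has one formula on [t < 0] and another on [t >= 0]; the formula for negative t is
    integrated up to 0 included, a null point. *)
Lemma Mint_line m n (F : R -> 'M[C]_(m, n)) (G H : R -> 'M[C]_(m, n)) :
  (forall t, t < 0 -> F t = G t) -> (forall t, 0 <= t -> F t = H t) ->
  Mintegrable nhalf G -> Mintegrable half H ->
  Mintegrable setT F /\ Mint setT F = Mint nhalf G + Mint half H.
Proof.
move=> FG FH iG iH; have [lE ld] := real_line.
have FG' t : nhalfo t -> G t = F t by rewrite /= in_itv /= => h; rewrite FG.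
have FH' t : half t -> H t = F t by rewrite /= in_itv /= andbT => h; rewrite FH.
have iGo : Mintegrable nhalfo G.
  by move: iG; apply: MintegrableS => // t /=; rewrite !in_itv /= => /ltW.
have i1 : Mintegrable nhalfo F by apply: Mintegrable_eq FG' iGo.
have i2 : Mintegrable half F by apply: Mintegrable_eq FH' iH.
have i : Mintegrable setT F by move=> a b; rewrite lE; exact: Cintegrable_setU.
split=> //; have -> : Mint setT F = Mint nhalfo F + Mint half F.
  apply/matrixP => a b; rewrite !mxE lE; apply: Cintegral_setU => //.
  by rewrite -lE; exact: i.
rewrite -(Mint_eq FG') -(Mint_eq FH'); congr (_ + _).
apply/matrixP => a b; rewrite !mxE; have [g1 g2] := iGo a b.
by apply: C_eqP => /=; exact: Rintegral_itv_bndo_bndc.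
Qed.

Variables (m nv nw : nat) (V W : C -> 'M[C]_m).
Variables (Av : 'M[C]_nv) (Bv : 'M[C]_(nv, m)) (Cv : 'M[C]_(m, nv)) (Dv : 'M[C]_m)
  (Aw : 'M[C]_nw) (Bw : 'M[C]_(nw, m)) (Cw : 'M[C]_(m, nw)) (Dw : 'M[C]_m) (Om : 'M[C]_(nv, nw)).
Hypotheses (rv : stable_dissipative_realization Av Bv Cv Dv V)
  (rw : stable_dissipative_realization Aw Bw Cw Dw W)
  (lyap : Av *m Om + Om *m Aw^t* + Bv *m Bw^t* = 0).
Local Notation Co := (Dv *m Bw^t* + Cv *m Om).
Local Notation D := (Dv *m Dw^t*).
Local Notation B1 := (Bv *m Dw^t* + Om *m Cw^t*).
Local Notation r := (rker Av Bv Cv Dv Aw Bw Cw Dw Om).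

(** On the axis [-conj s = s], and the Lyapunov equation becomes [B_v B_w^* = (s - A_v) Omega +
    Omega (-s - A_w^* )], which splits the product of resolvents as in [sylvester]. *)
Lemma symbol_imaginary (w : R) (s := Complex 0 w) : V s *m para_adj W s =
  D + (Co *m invmx ((- s)%:M - Aw^t*) *m Cw^t* + Cv *m invmx (s%:M - Av) *m B1).
Proof.
have [hv sv _ _ _] := rv; have [hw sw _ _ _] := rw.
have uv := imaginary_unit w sv; have uw := imaginary_unit w sw.
have sc : - Num.conj s = s by apply: C_eqP; rewrite /= ?oppr0 ?opprK.
have uw' : (- s)%:M - Aw^t* \in unitmx.
  by have := adjmx_unit (s%:M - Aw); rewrite uw adjmxD adjmxN adjmx_scalar -[Num.conj s]opprK sc.
rewrite /para_adj sc hv ?eigenvalue_unit ?negbK // hw ?eigenvalue_unit ?negbK //.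
rewrite adjmxD !adjmxM trmx_inv map_invmx adjmxD adjmxN adjmx_scalar -[Num.conj s]opprK sc -/s.
have BB : Bv *m Bw^t* = (s%:M - Av) *m Om + Om *m ((- s)%:M - Aw^t*).
  move/eqP: lyap; rewrite addrC addr_eq0 => /eqP ->.
  rewrite mulmxBl mulmxBr mul_scalar_mx mul_mx_scalar scaleNr opprD.
  by rewrite addrACA subrr add0r.
have [X [XE XK]] : exists X, X = invmx (s%:M - Av) /\ X *m (s%:M - Av) = 1%:M.
  by exists (invmx (s%:M - Av)); rewrite mulVmx.
have [Y [YE YK]] : exists Y, Y = invmx ((- s)%:M - Aw^t*) /\ ((- s)%:M - Aw^t*) *m Y = 1%:M.
  by exists (invmx ((- s)%:M - Aw^t*)); rewrite mulmxV.
rewrite -XE -YE; have XY : X *m (Bv *m Bw^t*) *m Y = Om *m Y + X *m Om.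
  by rewrite BB mulmxDr mulmxA XK mul1mx mulmxDl -!mulmxA YK mulmx1.
rewrite !mulmxDl !mulmxDr.
have -> : Cv *m X *m Bv *m (Bw^t* *m (Y *m Cw^t*)) = Cv *m (Om *m Y + X *m Om) *m Cw^t*.
  by rewrite -XY !mulmxA.
rewrite mulmxDr mulmxDl !mulmxA -!addrA; congr (_ + _).
move: (Dv *m Bw^t* *m Y *m Cw^t*) (Cv *m X *m Bv *m Dw^t*) (Cv *m Om *m Y *m Cw^t*) => a b c.
by rewrite (addrCA b c); congr (_ + _).
Qed.

Lemma symbol_kernel_fun : WH_kernel_fun (fun s => V s *m para_adj W s) D r.
Proof.
have [hv sv _ _ _] := rv; have [hw sw _ _ _] := rw.
have F w : Mintegrable setT (fun t => expNi w t *: r t) /\ Mint setT (fun t => expNi w t *: r t) =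
    Co *m invmx ((- Complex 0 w)%:M - Aw^t*) *m Cw^t* + Cv *m invmx ((Complex 0 w)%:M - Av) *m B1.
  have [iv Ev] := fourier_expm w sv; have [iw Ew] := fourier_expm_neg w (stable_adj sw).
  have iv' := MintegrableMr (measurable_itv _) B1 (MintegrableMl (measurable_itv _) Cv iv).
  have iw' := MintegrableMr (measurable_itv _) (Cw^t*) (MintegrableMl (measurable_itv _) Co iw).
  have [|t t0|i ->] := @Mint_line _ _ (fun t => expNi w t *: r t) _ _ _ _ iw' iv'.
  - move=> t t0; rewrite /rker leNgt t0 /=; by rewrite -scalemxAr -scalemxAl.
  - by rewrite /rker t0 -scalemxAr -scalemxAl.
  split=> //; rewrite -Ev -Ew -!MintMl // -!MintMr //.
  - exact: MintegrableMl.
  - exact: MintegrableMl.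
split.
- have [FF] := fracfield_exists (R[i]).
  apply: agree_lim_infty (symbolK_infty FF Av Bv Cv Dv Aw Bw Cw Dw).
  by apply: agree_mul; [exact: realization_agree|exact: para_adj_agree].
- move=> i j; have [h _] := F 0; apply: (Cintegrable_eq measurableT _ (h i j)) => t _.
  by rewrite mxE /expNi mul0r cos0 sin0 oppr0 (_ : Complex 1 0 = 1 :> C) // mul1r.
- move=> w i j; rewrite symbol_imaginary mxE; congr (_ + _).
  have [_ <-] := F w; rewrite mxE; apply: Cintegral_eq => t _.
  by rewrite mxE.
Qed.

Lemma WH_nullity_symbol : WH_nullity (fun s => V s *m para_adj W s) (nullity (Om^t* *m Om)).
Proof.
have [_ sv _ _ _] := rv; have [_ sw _ _ _] := rw.
have dv : dissipative Av Bv Cv Dv by case: rv.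
have dw : dissipative Aw Bw Cw Dw by case: rw.
exact: (WH_nullity_gram sv sw dv dw lyap symbol_kernel_fun).
Qed.

End Symbol.

(** * Kernel dimensions and indices *)

Section ShiftedSymbol.
Variables (R : realType) (FF : fracfield (R[i])) (m nv nw : nat) (V W : R[i] -> 'M[R[i]]_m)
    (Av : 'M[R[i]]_nv) (Bv : 'M[R[i]]_(nv, m)) (Cv : 'M[R[i]]_(m, nv))
    (Dv : 'M[R[i]]_m)
    (Aw : 'M[R[i]]_nw) (Bw : 'M[R[i]]_(nw, m)) (Cw : 'M[R[i]]_(m, nw))
    (Dw : 'M[R[i]]_m) (Om : 'M[R[i]]_(nv, nw)) (Q : 'M[R[i]]_nw).
Local Notation Co := (Dv *m Bw^t* + Cv *m Om).
Hypotheses (rv : stable_dissipative_realization Av Bv Cv Dv V)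
  (rw : stable_dissipative_realization Aw Bw Cw Dw W)
  (lyapO : Av *m Om + Om *m Aw^t* + Bv *m Bw^t* = 0)
  (lyapQ : Aw *m Q + Q *m Aw^t* + Co^t* *m Co = 0).
Local Notation symb := (fun s => V s *m para_adj W s).
Local Notation SK := (symbolK FF Av Bv Cv Dv Aw Bw Cw Dw).

Lemma symbol_agree : agree symb SK.
Proof.
have [hv _ _ _ _] := rv; have [hw _ _ _ _] := rw.
by apply: agree_mul; [exact: realization_agree|exact: para_adj_agree].
Qed.

Lemma gram_defect : 1%:M - Q = Om^t* *m Om.
Proof.
have [_ sv _ _ _] := rv; have [_ sw _ _ _] := rw.
exact: (I_minus_Q FF (@half_planes_cover R) (@reflect_left R) (sdr_dissipative rv) (stable_stab sw)
  (sdr_dissipative rw) lyapO lyapQ).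
Qed.

Lemma nullity_defect_symbol : WH_nullity symb (nullity (1%:M - Q)).
Proof. by rewrite gram_defect; exact: WH_nullity_symbol rv rw lyapO. Qed.

Lemma nullity_defect_indices lam : WH_indices symb lam ->
  nullity (1%:M - Q) = (\sum_j negpart (lam j))%N.
Proof.
have [_ sv _ _ _] := rv; have [_ sw _ _ _] := rw.
move=> /(WH_lift symbol_agree)[Wm [Wp [[um up] [mr mVr] [pr pVr] fact]]].
rewrite gram_defect.
exact: (wh_dimension (@half_planes_cover R) (@right_excludes_N1 R) (@left_excludes_1 R) (@reflect_left R) (stable_stab sv) (sdr_dissipative rv)
  (stable_stab sw) (sdr_dissipative rw) lyapO um up mr mVr pr pVr fact).
Qed.

Lemma symbol_indices_exist : exists lam, WH_indices symb lam.
Proof.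
have [_ sv _ _ _] := rv; have [_ sw _ _ _] := rw.
apply: (WH_exists symbol_agree).
- exact: symbolK_unit (sdr_dissipative rv) (sdr_dissipative rw).
- by move=> a; apply: (symbolK_reg FF (@reflect_left R)); exact: stable_stab.
- move=> a; exact: (symbolK_inv_reg FF (@reflect_left R) (stable_stab sv) (sdr_dissipative rv)
    (stable_stab sw) (sdr_dissipative rw)).
Qed.

End ShiftedSymbol.

Local Open Scope complex_scope.
Local Open Scope sesquilinear_scope.
Local Open Scope ring_scope.

Theorem theorem2p2 (R : realType) (m nv nw : nat)
    (V W : R[i] -> 'M[R[i]]_m)
    (Av : 'M[R[i]]_nv) (Bv : 'M[R[i]]_(nv, m)) (Cv : 'M[R[i]]_(m, nv))
    (Dv : 'M[R[i]]_m)
    (Aw : 'M[R[i]]_nw) (Bw : 'M[R[i]]_(nw, m)) (Cw : 'M[R[i]]_(m, nw))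
    (Dw : 'M[R[i]]_m)
    (Omega : 'M[R[i]]_(nv, nw)) (Co : 'M[R[i]]_(m, nw)) (Q : 'M[R[i]]_nw)
    (symb : R[i] -> 'M[R[i]]_m) :
  rational_mx V -> bi_inner V ->
  rational_mx W -> bi_inner W ->
  symb = (fun s => V s *m para_adj W s) ->
  stable_dissipative_realization Av Bv Cv Dv V ->
  stable_dissipative_realization Aw Bw Cw Dw W ->
  Av *m Omega + Omega *m Aw^t* + Bv *m Bw^t* = 0 ->
  Co = Dv *m Bw^t* + Cv *m Omega ->
  Aw *m Q + Q *m Aw^t* + Co^t* *m Co = 0 ->
  [/\ positive_op Q /\ contraction_op Q,
      [/\ WH_nullity symb (mup 1 (char_poly Q)),
          WH_nullity symb (nullity (1%:M - Q))
        & forall k : nat,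
            WH_nullity (fun s => zeta s ^+ k *: symb s) (shifted_nullity Aw Q k)]
    & (exists lam : 'I_m -> int, WH_indices symb lam) /\
      forall lam : 'I_m -> int, WH_indices symb lam ->
        (size (kappas lam))%:Z = mu_seq Aw Q 1 /\
        forall j : nat, (1 <= j <= size (kappas lam))%N ->
          ([set k : nat | (1 <= k)%N /\ (j%:Z <= mu_seq Aw Q k)%R]
             #= `I_(nth 0%N (kappas lam) j.-1))%card].
Proof.
move=> _ _ _ _ -> rv rw lyapO -> lyapQ.
have [FF] := fracfield_exists (R[i]).
have [_ sw _ _ _] := rw.
have QO := gram_defect FF rv rw lyapO lyapQ.
have N0 := nullity_defect_symbol FF rv rw lyapO lyapQ.
(* Since [zeta^k R = (zeta^k V) W^*], the case k = 0 applies to the cascade realization with the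
   same [W]; on the indices the factor [zeta^k] acts as the shift by k. *)
have shift k : WH_nullity (fun s => zeta s ^+ k *: (V s *m para_adj W s)) (shifted_nullity Aw Q k) /\
    forall lam, WH_indices (fun s => V s *m para_adj W s) lam ->
      shifted_nullity Aw Q k = (\sum_j negpart (lam j + k%:Z))%N.
  have [n' [A1 [B1 [K1 [D1 [om1 [rv1 lyap1 lyapQ1]]]]]]] := cascade k rv sw lyapO lyapQ.
  have e : (fun s => zeta s ^+ k *: (V s *m para_adj W s)) =
      (fun s => (zeta s ^+ k *: V s) *m para_adj W s).
    by apply/funext => s; rewrite scalemxAl.
  rewrite e; split; first by have := nullity_defect_symbol FF rv1 rw lyap1 lyapQ1.
  move=> lam /(WH_shift k); rewrite e => lamP.
  by have := nullity_defect_indices FF rv1 rw lyap1 lyapQ1 lamP.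
split.
- apply: (@positive_contraction _ _ _ _ _ Bw _ _ _ sw _ lyapQ QO).
  by rewrite (dissBB (sdr_dissipative rw)) subrr.
- split; [|exact: N0|by move=> k; have [] := shift k].
  (* Algebraic and geometric multiplicity agree because [Q = 1 - Omega^* Omega] is hermitian. *)
  rewrite mup_nullity //.
  have -> : Q = 1%:M - Omega^t* *m Omega by rewrite -QO opprB addrC subrK.
  by rewrite adjmxD adjmxN adjmx1 adjmxM trmxCK.
- split; first by have := symbol_indices_exist FF rv rw.
  move=> lam lamP; apply: (@kappas_conjugate _ lam (shifted_nullity Aw Q)) => // k.
  by have [_] := shift k; apply.
Qed.
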